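(* For every fixed positive integer $m$, the function $n\mapsto f(m,n)$ can be computed in time bounded by a polynomial in $n$; that is, there is an algorithm and a polynomial $p_m$ such that on input $n$ the algorithm outputs $f(m,n)$ in time at most $p_m(n)$.
   Context: $f(m,n)$ denotes the number of unimodular triangulations of the rectangle $P_{m,n}=[0,m]\times[0,n]$, i.e., the number of subdivisions of $P_{m,n}$ into lattice triangles of area $\tfrac12$ (with vertices in $\mathbb{Z}^2$) any two of which intersect in a common (possibly empty) face. *)

(* Defs.v *)
From mathcomp Require Import all_boot all_order all_algebra.
From mathcomp Require Import boolp classical_sets reals.

Set Implicit Arguments.
Unset Strict Implicit.
Unset Printing Implicit Defensive.

Import Order.TTheory GRing.Theory Num.Theory.
Local Open Scope ring_scope.
Local Open Scope classical_set_scope.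

(* The lattice points of P_{m,n} = [0,m] x [0,n].  Every lattice triangle of a
   subdivision of P_{m,n} is contained in P_{m,n}, so its vertices lie here. *)
Definition grid (m n : nat) : finType := ('I_m.+1 * 'I_n.+1)%type.

Section Triangulations.
Variables (R : realType) (m n : nat).
Implicit Types (v a b c : grid m n) (s t : {set grid m n}).

Definition px v : R := (v.1 : nat)%:R.
Definition py v : R := (v.2 : nat)%:R.

Definition rectangle : set (R * R) :=
  [set z | 0 <= z.1 <= m%:R /\ 0 <= z.2 <= n%:R].

Definition hull s : set (R * R) :=
  [set z | exists w : grid m n -> R,
    [/\ forall v, v \in s -> 0 <= w v,
        \sum_(v in s) w v = 1,
        z.1 = \sum_(v in s) w v * px v
      & z.2 = \sum_(v in s) w v * py v]].

Definition triangle_area a b c : R :=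
  `|(px b - px a) * (py c - py a) - (px c - px a) * (py b - py a)| / 2.

(* A triangle is represented by its set of vertices. *)
Definition unimodular_triangle s : Prop :=
  exists a b c, s = [set a; b; c]%SET /\ triangle_area a b c = 1 / 2.

(* The faces of a simplex are the convex hulls of the subsets of its vertex
   set, the empty subset giving the empty face. *)
Definition is_face (F : set (R * R)) s : Prop :=
  exists2 u : {set grid m n}, u \subset s & F = hull u.

Definition unimodular_triangulation (T : {set {set grid m n}}) : Prop :=
  [/\ forall s, s \in T -> unimodular_triangle s,
      \bigcup_(s in [set s | s \in T]) hull s = rectangle
    & forall s t, s \in T -> t \in T ->
        is_face (hull s `&` hull t) s /\ is_face (hull s `&` hull t) t].

Definition num_triangulations : nat :=
  #|[set T : {set {set grid m n}} | `[< unimodular_triangulation T >]]%SET|.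

End Triangulations.

(* The random access machine of Cook and Reckhow with the logarithmic cost
   criterion of Aho, Hopcroft and Ullman.  Registers X_0, X_1, ... hold natural
   numbers, and subtraction is truncated at 0.  There is no unit-cost
   multiplication, and every number an instruction handles (contents and
   addresses) is charged its length in binary, so polynomial time here is
   polynomial time on a Turing machine. *)
Inductive instr : Type :=
  | Const of nat & nat          (* X_i <- c *)
  | Add of nat & nat & nat      (* X_i <- X_j + X_k *)
  | Sub of nat & nat & nat      (* X_i <- X_j - X_k *)
  | LoadInd of nat & nat        (* X_i <- X_(X_j) *)
  | StoreInd of nat & nat       (* X_(X_i) <- X_j *)
  | JumpPos of nat & nat.       (* if X_j > 0 go to instruction number l *)

Definition program := seq instr.
Definition memory := nat -> nat.

Definition set_reg (X : memory) (i x : nat) : memory :=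
  fun j => if j == i then x else X j.

Definition exec (I : instr) (X : memory) : memory :=
  match I with
  | Const i c => set_reg X i c
  | Add i j k => set_reg X i (X j + X k)%N
  | Sub i j k => set_reg X i (X j - X k)%N
  | LoadInd i j => set_reg X i (X (X j))
  | StoreInd i j => set_reg X (X i) (X j)
  | JumpPos _ _ => X
  end.

Definition next (I : instr) (X : memory) (pc : nat) : nat :=
  match I with
  | JumpPos j l => if (0 < X j)%N then l else pc.+1
  | _ => pc.+1
  end.

(* Number of binary digits; trunc_log 2 0 = 0, so that bitlen 0 = 1. *)
Definition bitlen (x : nat) : nat := (trunc_log 2 x).+1.

Definition cost (I : instr) (X : memory) : nat :=
  match I with
  | Const i c => bitlen i + bitlen c
  | Add i j k | Sub i j k =>
      bitlen i + (bitlen j + bitlen (X j)) + (bitlen k + bitlen (X k))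
  | LoadInd i j => bitlen i + (bitlen j + bitlen (X j) + bitlen (X (X j)))
  | StoreInd i j => bitlen i + bitlen (X i) + (bitlen j + bitlen (X j))
  | JumpPos j _ => bitlen j + bitlen (X j)
  end%N.

(* run P pc X t Y: started at instruction pc with memory X, the program P halts
   with memory Y at total cost t.  It halts when pc leaves the program. *)
Inductive run (P : program) : nat -> memory -> nat -> memory -> Prop :=
  | run_halt pc X : (size P <= pc)%N -> run P pc X 0 X
  | run_step pc X I t Y :
      onth P pc = Some I ->
      run P (next I X pc) (exec I X) t Y ->
      run P pc X (cost I X + t)%N Y.

(* The input is in X_0 and all other registers contain 0; the output is X_0. *)
Definition outputs_within (P : program) (n y time : nat) : Prop :=
  exists (t : nat) (Y : memory),
    [/\ run P 0 (set_reg (fun=> 0%N) 0 n) t Y, Y 0%N = y & (t <= time)%N].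

(* Main.v *)
Require Import Defs.
From mathcomp Require Import all_boot all_order all_algebra.
From mathcomp Require Import boolp classical_sets reals.
From mathcomp Require Import zify ring lra.

Set Implicit Arguments.
Unset Strict Implicit.
Unset Printing Implicit Defensive.

Import boot.fintype boot.finset Defs.
Import Order.TTheory GRing.Theory Num.Theory.

(** Below an x-monotone lattice path from the left to the right side of the
rectangle, every edge that is not on the bottom side bounds from above a
triangle of any given triangulation.  Reading the path from the left, there is
a first place where one can remove one triangle, or the two triangles that have
a common vertical edge below a vertex, such that the rest is again the region
below a monotone path: its apex lies between the ends of the edge, or two
neighbouring edges have a common triangle, or a vertex moves down by one.  So
the triangulations correspond to the sequences of such removals that lead from
the top side to the bottom side.  A path together with the position of the
scan is given by at most [m + 2] numbers, which leaves polynomially many states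
for fixed [m], and the sequences are counted by dynamic programming.

That a set of unimodular triangles is a triangulation means that every point
on no line through two lattice points is in exactly one of them; in this form
the condition is local and is inherited by the removals. *)

(** * Random access machines *)

(** The numbers counted can be exponentially large in n, so the entries of the table have
    polynomially many digits. This does no harm: they are only added and copied, and a bound on the
    number of instructions also bounds the logarithmic cost.

    The obstacle is double counting, as one triangulation can be taken apart in many orders. The
    position of the scan prescribes one of them. It records that every edge passed so far lies on
    the bottom side or leans to the right, meaning that the apex of its triangle lies in or beyond
    the column of its right end. An edge leaning to the left after one leaning to the right always
    permits a move. After a move the scan goes back just far enough for its record to stay true, and
    putting the removed triangles back restores the old record; this makes removal and restoration
    inverse to each other.

    An edge must be a full side of a triangle, so all paths keep primitive edges. Points are pushed
    off the lattice lines along parabolas, because a straight segment might run inside such a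
    line. *)

Inductive steps (P : program) : nat -> memory -> nat -> memory -> Prop :=
  | steps_halt pc X : size P <= pc -> steps P pc X 0 X
  | steps_step pc X I k Y :
      onth P pc = Some I ->
      steps P (next I X pc) (exec I X) k Y ->
      steps P pc X k.+1 Y.

Definition operands (I : instr) : seq nat :=
  match I with
  | Const i c => [:: i; c]
  | Add i j k | Sub i j k => [:: i; j; k]
  | LoadInd i j | StoreInd i j => [:: i; j]
  | JumpPos j l => [:: j]
  end.

Lemma bitlen_le b x : x <= 2 ^ b -> bitlen x <= b.+1.
Proof. by move=> xb; rewrite /bitlen ltnS -[b in _ <= b](trunc_expnK b (isT : 1 < 2)) leq_trunc_log. Qed.

(* Every instruction at most doubles the largest number in memory, so the
   logarithmic cost of k instructions is quadratic in k. *)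
Lemma run_of_steps P pc X k Y b : steps P pc X k Y ->
  (forall q I, onth P q = Some I -> all (fun x => x <= 2 ^ b) (operands I)) ->
  (forall j, X j <= 2 ^ b) ->
  exists2 t, run P pc X t Y & t <= 6 * k * (b + k + 1).
Proof.
move=> S; elim: S b => {pc X k Y} [pc X h|pc X I k Y PI _ IH] b hP hX.
  by exists 0 => //; apply: run_halt.
have le2 x : x <= 2 ^ b -> x <= 2 ^ b.+1 by rewrite expnS; lia.
have [|j|t rt tle] := IH b.+1.
- by move=> q J /hP; apply: sub_all => x; apply: le2.
- have := hP _ _ PI; case: I {IH PI} => /= [i c|i j1 k1|i j1 k1|i j1|i j1|j1 l]; rewrite /set_reg.
  + by move=> /and3P[_ cb _]; case: eqP => _; apply: le2.
  + by move=> _; case: eqP => _; [rewrite expnS; have := hX j1; have := hX k1; lia|apply: le2].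
  + by move=> _; case: eqP => _; [rewrite expnS; have := hX j1; have := hX k1; lia|apply: le2].
  + by move=> _; case: eqP => _; apply: le2.
  + by move=> _; case: eqP => _; apply: le2.
  + by move=> _; apply: le2.
exists (cost I X + t); first exact: run_step PI rt.
suff cb : cost I X <= 6 * b.+1.
  apply: leq_trans (leq_add cb tle) _; nia.
have bl x : x <= 2 ^ b -> bitlen x <= b.+1 := @bitlen_le b x.
have hb j : bitlen (X j) <= b.+1 by apply: bl.
have := hP _ _ PI; case: I {IH PI rt} => /= [i c|i j1 k1|i j1 k1|i j1|i j1|j1 l].
- by move=> /and3P[/bl ? /bl ? _]; lia.
- move=> /and4P[/bl ? /bl ? /bl ? _]; have := hb j1; have := hb k1; lia.
- move=> /and4P[/bl ? /bl ? /bl ? _]; have := hb j1; have := hb k1; lia.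
- move=> /and3P[/bl ? /bl ? _]; have := hb j1; have := hb (X j1); lia.
- move=> /and3P[/bl ? /bl ? _]; have := hb j1; have := hb i; lia.
- move=> /andP[/bl ? _]; have := hb j1; lia.
Qed.

(** * Structured commands and their compilation *)

Inductive cmd : Type :=
  | Ins of instr
  | Seq of cmd & cmd
  | While of nat & nat & cmd.

Fixpoint csize (c : cmd) : nat :=
  match c with
  | Ins _ => 1
  | Seq c1 c2 => csize c1 + csize c2
  | While _ _ c => csize c + 3
  end.

(* [While u j c] repeats c as long as X_j > 0.  The only jump being
   conditional, the initial jump to the test needs a positive register, for
   which the scratch register X_u is overwritten. *)
Fixpoint compile (base : nat) (c : cmd) : program :=
  match c with
  | Ins J => [:: J]
  | Seq c1 c2 => compile base c1 ++ compile (base + csize c1) c2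
  | While u j c =>
      [:: Const u 1; JumpPos u (base + 2 + csize c)]
      ++ compile (base + 2) c ++ [:: JumpPos j (base + 2)]
  end.

Lemma size_compile base c : size (compile base c) = csize c.
Proof.
elim: c base => //= [c1 IH1 c2 IH2|u j c IH] base; rewrite size_cat ?IH1 ?IH2 //.
by rewrite IH /= addn1 addn3.
Qed.

Definition code_at (P : program) (b : nat) (s : program) :=
  forall i I, onth s i = Some I -> onth P (b + i) = Some I.

Lemma code_at_cat P b s1 s2 :
  code_at P b (s1 ++ s2) -> code_at P b s1 /\ code_at P (b + size s1) s2.
Proof.
move=> h; split=> i I hi.
- apply: h; rewrite onth_cat; case: ltnP => // /onth_default; by rewrite hi.
- by rewrite -addnA; apply: h; rewrite onth_cat ltnNge leq_addr /= addKn.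
Qed.

(** Continuation form: any run starting right behind the code of [c] is prolonged at its front by k
    instructions. Jump targets are absolute, hence the quantification over the position of the
    code. *)
Definition sem (c : cmd) (X : memory) (k : nat) (Y : memory) : Prop :=
  forall P base, code_at P base (compile base c) ->
  forall k' Z, steps P (base + csize c) Y k' Z -> steps P base X (k + k') Z.

Definition terminates (c : cmd) (X : memory) (K : nat) (Q : memory -> Prop) :=
  exists k Y, [/\ sem c X k Y, k <= K & Q Y].

Definition is_jump (I : instr) := if I is JumpPos _ _ then true else false.

Lemma terminates_ins I X Q : ~~ is_jump I -> Q (exec I X) -> terminates (Ins I) X 1 Q.
Proof.
move=> nI QI; exists 1, (exec I X); split=> // P base hP k' Z S.
apply: (@steps_step _ _ _ I); first by rewrite -[base]addn0; apply: hP.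
have -> : next I X base = base + 1 by case: I nI {QI hP S} => //= *; rewrite addn1.
exact: S.
Qed.

Lemma terminates_seq c1 c2 X K1 K2 Q :
  terminates c1 X K1 (fun Y => terminates c2 Y K2 Q) -> terminates (Seq c1 c2) X (K1 + K2) Q.
Proof.
move=> [k1 [Y1 [S1 l1 [k2 [Y2 [S2 l2 QY]]]]]].
exists (k1 + k2), Y2; split=> //; last by rewrite leq_add.
move=> P base /= /code_at_cat[h1 h2] k' Z S; rewrite -addnA; apply: S1 => //.
by apply: S2; [rewrite -{1}(size_compile base)|rewrite -addnA].
Qed.

Lemma terminates_weaken c X K K' (Q Q' : memory -> Prop) :
  K <= K' -> (forall Y, Q Y -> Q' Y) -> terminates c X K Q -> terminates c X K' Q'.
Proof.
move=> KK QQ [k [Y [S l q]]]; exists k, Y; split=> //; [exact: leq_trans KK|exact: QQ].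
Qed.

(** The loop counter is the register X_j itself, so [Inv] is indexed by its value and the body runs
    exactly r times. The bound counts two instructions on entry, one test before the first round and
    one test after each round. *)
Lemma terminates_while u j c X (Inv : nat -> memory -> Prop) r K :
  (forall i Y, Inv i Y -> Y j = i) ->
  (forall i Y, i < r -> Inv i.+1 Y -> terminates c Y K (Inv i)) ->
  Inv r (set_reg X u 1) ->
  terminates (While u j c) X (3 + r * K.+1) (Inv 0).
Proof.
move=> Ij step I0.
suff [k [Z [S kl IZ]]] : exists k Z, [/\
    forall P base, code_at P base (compile base (While u j c)) ->
      forall k' W, steps P (base + csize c + 3) Z k' W ->
      steps P (base + 2 + csize c) (set_reg X u 1) (k + k') W,
    k <= 1 + r * K.+1 & Inv 0 Z].
  exists k.+2, Z; split=> //.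
  move=> P base hP k' W SW; rewrite !addSn.
  apply: (@steps_step _ _ _ (Const u 1)).
    by rewrite -[base in onth _ base]addn0; apply: hP.
  apply: (@steps_step _ _ _ (JumpPos u (base + 2 + csize c))).
    by have := hP 1 _ erefl; rewrite addn1.
  rewrite /= /set_reg eqxx /=; apply: S => //.
  by move: SW; rewrite /= addnA.
elim: r (set_reg X u 1) I0 step => [|r IH] Y IY step.
  exists 1, Y; split=> // P base hP k' W SW; rewrite add1n.
  apply: (@steps_step _ _ _ (JumpPos j (base + 2))).
    rewrite -addnA; apply: hP; rewrite /= onth_cat size_compile ltnn subnn //.
  by rewrite /= (Ij _ _ IY) /=; move: SW; congr steps; lia.
have [k1 [Y1 [S1 l1 I1]]] := step r Y (leqnn _) IY.
have [|k2 [Z [S2 l2 IZ]]] := IH _ I1.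
  by move=> i Y' /ltnW; apply: step.
exists (1 + k1 + k2), Z; split=> //; last by lia.
move=> P base hP k' W SW; rewrite add1n !addSn.
apply: (@steps_step _ _ _ (JumpPos j (base + 2))).
  rewrite -addnA; apply: hP; rewrite /= onth_cat size_compile ltnn subnn //.
rewrite /= (Ij _ _ IY) /= -addnA; apply: S1.
  have /code_at_cat[_ hP'] : code_at P base ([:: Const u 1; JumpPos u (base + 2 + csize c)] ++ compile (base + 2) c ++ [:: JumpPos j (base + 2)]) := hP.
  by have /code_at_cat[] := hP'.
exact: S2.
Qed.

Lemma terminates_outputs c :
  exists C, forall n K Q, terminates c (set_reg (fun=> 0) 0 n) K Q ->
  exists2 Y, Q Y & outputs_within (compile 0 c) n (Y 0) (6 * K * (n + C + K + 1)).
Proof.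
(* [C] bounds all constants and register addresses of the program; since x <= 2 ^ x, the number n +
   C is an admissible initial bit length. *)
pose C := \sum_(x <- flatten [seq operands J | J <- compile 0 c]) x.
exists C => n K Q [k [Y [S kK QY]]]; exists Y => //.
have S0 : steps (compile 0 c) 0 (set_reg (fun=> 0) 0 n) k Y.
  rewrite -[k]addn0; apply: S => //.
  by apply: steps_halt; rewrite size_compile.
have ltp x : x <= n + C -> x <= 2 ^ (n + C).
  by move=> h; apply: leq_trans h _; apply: ltnW; apply: ltn_expl.
have [||t rt tl] := run_of_steps (b := n + C) S0.
- move=> q I hI; apply/allP => x xI; apply: ltp; apply: leq_trans (leq_addl n C).
  have xf : x \in flatten [seq operands J | J <- compile 0 c].
    apply/flattenP; exists (operands I) => //.
    by apply/onthP; exists q; rewrite onth_map hI.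
  by rewrite /C (big_rem x xf) /= leq_addr.
- by move=> j; apply: ltp; rewrite /set_reg; case: ifP => //; rewrite leq_addr.
exists t, Y; split=> //; apply: leq_trans tl _; rewrite leq_mul // ?leq_mul // leq_add2r leq_add2l //.
Qed.

(** * Polynomial bounds *)

(** The base M + 2 is at least 2, so constants and sums are absorbed into the exponent and a single
    number k describes the bound. *)
Definition poly_bounded (F : nat -> nat) := exists k, forall M, F M <= (M + 2) ^ k.

Lemma poly_bounded_cst c : poly_bounded (fun=> c).
Proof.
exists c => M; apply: leq_trans (ltnW (ltn_expl c (isT : 1 < 2))) _.
by case: c => // c; rewrite leq_exp2r ?leq_addl.
Qed.

Lemma poly_bounded_id : poly_bounded id.
Proof. by exists 1 => M; rewrite expn1 leq_addr. Qed.

Lemma poly_bounded_mul F G : poly_bounded F -> poly_bounded G ->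
  poly_bounded (fun M => F M * G M).
Proof. by move=> [a Fa] [b Gb]; exists (a + b) => M; rewrite expnD leq_mul. Qed.

Lemma poly_bounded_add F G : poly_bounded F -> poly_bounded G ->
  poly_bounded (fun M => F M + G M).
Proof.
move=> [a Fa] [b Gb]; exists (a + b).+1 => M; rewrite expnS.
have pa : 0 < (M + 2) ^ a by rewrite expn_gt0 addn2.
have pb : 0 < (M + 2) ^ b by rewrite expn_gt0 addn2.
have := Fa M; have := Gb M; rewrite expnD; nia.
Qed.

Lemma poly_bounded_comp F G : poly_bounded F -> poly_bounded G ->
  poly_bounded (fun M => F (G M)).
Proof.
move=> [a Fa] [b Gb]; exists (b.+2 * a) => M; apply: leq_trans (Fa _) _.
rewrite expnM; case: a {Fa} => // a; rewrite leq_exp2r // !expnS.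
have p : 0 < (M + 2) ^ b by rewrite expn_gt0 addn2.
have := Gb M; nia.
Qed.

(** * Arithmetic expressions with bounded sums *)

(** Truncated subtraction and bounded sums are strong enough to recover products, comparisons,
    connectives and division, so the compiler has only these few constructors to treat.
    [Sum i e1 e2] binds X_i, which runs from 0 to the value of [e1] minus 1. *)
Inductive expr : Type :=
  | Var of nat
  | Cst of nat
  | Plus of expr & expr
  | Minus of expr & expr
  | Sum of nat & expr & expr.

Fixpoint eval (X : memory) (e : expr) : nat :=
  match e with
  | Var i => X i
  | Cst c => c
  | Plus e1 e2 => eval X e1 + eval X e2
  | Minus e1 e2 => eval X e1 - eval X e2
  | Sum i e1 e2 => \sum_(k < eval X e1) eval (set_reg X i k) e2
  end.

Fixpoint vbound (e : expr) : nat :=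
  match e with
  | Var i => i.+1
  | Cst c => 0
  | Plus e1 e2 | Minus e1 e2 => maxn (vbound e1) (vbound e2)
  | Sum i e1 e2 => maxn i.+1 (maxn (vbound e1) (vbound e2))
  end.

Lemma eq_eval X Y e : (forall j, j < vbound e -> X j = Y j) -> eval X e = eval Y e.
Proof.
elim: e X Y => //= [i|e1 IH1 e2 IH2|e1 IH1 e2 IH2|i e1 IH1 e2 IH2] X Y h.
- exact: h.
- by rewrite (IH1 X Y) ?(IH2 X Y) // => j jl; apply: h; lia.
- by rewrite (IH1 X Y) ?(IH2 X Y) // => j jl; apply: h; lia.
- rewrite (IH1 X Y); last by move=> j jl; apply: h; lia.
  apply: eq_bigr => k _; apply: IH2 => j jl; rewrite /set_reg; case: ifP => // _.
  by apply: h; lia.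
Qed.

(** In a [Sum] the bound register stays below [value_bound e1 M]; adding this number to M covers it
    together with all other registers. *)
Fixpoint value_bound (e : expr) (M : nat) : nat :=
  match e with
  | Var i => M
  | Cst c => c
  | Plus e1 e2 => value_bound e1 M + value_bound e2 M
  | Minus e1 e2 => value_bound e1 M
  | Sum i e1 e2 => value_bound e1 M * value_bound e2 (M + value_bound e1 M)
  end.

Fixpoint step_bound (e : expr) (M : nat) : nat :=
  match e with
  | Var i => 2
  | Cst c => 1
  | Plus e1 e2 | Minus e1 e2 => step_bound e1 M + step_bound e2 M + 1
  | Sum i e1 e2 =>
      step_bound e1 M + 11
      + value_bound e1 M * (step_bound e2 (M + value_bound e1 M) + 5)
  end.

Lemma poly_value_bound e : poly_bounded (value_bound e).
Proof.
elim: e => /= [i|c|e1 IH1 e2 IH2|e1 IH1 e2 IH2|i e1 IH1 e2 IH2] //.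
- exact: poly_bounded_id.
- exact: poly_bounded_cst.
- exact: poly_bounded_add.
- apply: poly_bounded_mul => //; apply: poly_bounded_comp => //.
  by apply: poly_bounded_add => //; apply: poly_bounded_id.
Qed.

Lemma poly_step_bound e : poly_bounded (step_bound e).
Proof.
elim: e => /= [i|c|e1 IH1 e2 IH2|e1 IH1 e2 IH2|i e1 IH1 e2 IH2].
- exact: poly_bounded_cst.
- exact: poly_bounded_cst.
- by apply: poly_bounded_add; [apply: poly_bounded_add|apply: poly_bounded_cst].
- by apply: poly_bounded_add; [apply: poly_bounded_add|apply: poly_bounded_cst].
- apply: poly_bounded_add.
    by apply: poly_bounded_add => //; apply: poly_bounded_cst.
  apply: poly_bounded_mul; first exact: poly_value_bound.
  apply: poly_bounded_add; last exact: poly_bounded_cst.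
  apply: poly_bounded_comp => //; apply: poly_bounded_add; first exact: poly_bounded_id.
  exact: poly_value_bound.
Qed.

Lemma eval_le e X M : (forall j, j < vbound e -> X j <= M) -> eval X e <= value_bound e M.
Proof.
elim: e X M => //= [i|e1 IH1 e2 IH2|e1 IH1 e2 IH2|i e1 IH1 e2 IH2] X M h.
- exact: h.
- by apply: leq_add; [apply: IH1|apply: IH2] => j jl; apply: h; lia.
- by apply: leq_trans (leq_subr _ _) _; apply: IH1 => j jl; apply: h; lia.
have le1 : eval X e1 <= value_bound e1 M by apply: IH1 => j jl; apply: h; lia.
apply: leq_trans (_ : \sum_(k < eval X e1) value_bound e2 (M + value_bound e1 M) <= _).
  apply: leq_sum => k _; apply: IH2 => j jl; rewrite /set_reg; case: ifP => _.
    by have := ltn_ord k; lia.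
  by apply: leq_trans (leq_addr _ _); apply: h; lia.
by rewrite sum_nat_const card_ord leq_mul2r le1 orbT.
Qed.

Fixpoint seqs (I : instr) (s : seq instr) : cmd :=
  if s is J :: s' then Seq (Ins I) (seqs J s') else Ins I.

Lemma terminates_seqs I s X Q : ~~ has is_jump (I :: s) ->
  Q (foldl (fun Y J => exec J Y) X (I :: s)) -> terminates (seqs I s) X (size s).+1 Q.
Proof.
elim: s I X => [|J s IH] I X /=; first by rewrite orbF => nI; apply: terminates_ins.
rewrite negb_or => /andP[nI ns] q; rewrite -add1n; apply: terminates_seq.
by apply: terminates_ins => //; apply: IH.
Qed.

Arguments seqs : simpl never.

(* The value of e is left in X_d; the registers below d are preserved, and
   only finitely many registers above are used as scratch. *)
Fixpoint cexpr (e : expr) (d : nat) : cmd :=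
  match e with
  | Var i => seqs (Const d 0) [:: Add d d i]
  | Cst c => Ins (Const d c)
  | Plus e1 e2 => Seq (cexpr e1 d) (Seq (cexpr e2 d.+1) (Ins (Add d d d.+1)))
  | Minus e1 e2 => Seq (cexpr e1 d) (Seq (cexpr e2 d.+1) (Ins (Sub d d d.+1)))
  | Sum i e1 e2 =>
      Seq (cexpr e1 d)
     (Seq (seqs (Const d.+1 0) [:: Const d.+2 0; Add d.+2 d.+2 i; Const i 0])
     (Seq (While d.+3 d
             (Seq (cexpr e2 d.+3)
                  (seqs (Add d.+1 d.+1 d.+3)
                     [:: Const d.+3 1; Add i i d.+3; Sub d d d.+3])))
          (seqs (Const i 0) [:: Add i i d.+2; Const d 0; Add d d d.+1])))
  end.

Fixpoint width (e : expr) : nat :=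
  match e with
  | Var _ | Cst _ => 1
  | Plus e1 e2 | Minus e1 e2 => maxn (width e1) (width e2).+1
  | Sum i e1 e2 => maxn (width e1) (3 + width e2)
  end.

Lemma width_gt0 e : 0 < width e.
Proof. by elim: e => //=; lia. Qed.

Ltac regs := rewrite /= /set_reg; repeat (case: eqP => ?); try lia.

Lemma terminates_cexpr e d X M : vbound e <= d -> (forall j, j < vbound e -> X j <= M) ->
  terminates (cexpr e d) X (step_bound e M)
    (fun Y => Y d = eval X e /\ forall j, (j < d) || (d + width e <= j) -> Y j = X j).
Proof.
elim: e d X M => [i|c|e1 IH1 e2 IH2|e1 IH1 e2 IH2|i e1 IH1 e2 IH2] d X M vd hM.
- by rewrite /= in vd; apply: terminates_seqs => //; split=> [|j /= jd]; regs.
- by apply: terminates_ins => //; split=> [|j /= jd]; regs.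
- rewrite /= in vd hM *; rewrite -addnA; apply: terminates_seq.
  apply: terminates_weaken (IH1 d X M _ _) => //; [|lia|by move=> j jl; apply: hM; lia].
  move=> Y [Yd Yj]; apply: terminates_seq.
  have YX : forall j, j < d -> Y j = X j by move=> j jd; apply: Yj; rewrite jd.
  apply: terminates_weaken (IH2 d.+1 Y M _ _) => //; [|lia|].
    move=> Z [Zd Zj]; apply: terminates_ins => //.
    split=> [|j jd]; regs.
      rewrite Zd Zj ?ltnSn // Yd; congr (_ + _); apply: eq_eval => j jl; apply: YX; lia.
    by rewrite Zj ?Yj //; lia.
  by move=> j jl; rewrite YX; [apply: hM|]; lia.
- rewrite /= in vd hM *; rewrite -addnA; apply: terminates_seq.
  apply: terminates_weaken (IH1 d X M _ _) => //; [|lia|by move=> j jl; apply: hM; lia].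
  move=> Y [Yd Yj]; apply: terminates_seq.
  have YX : forall j, j < d -> Y j = X j by move=> j jd; apply: Yj; rewrite jd.
  apply: terminates_weaken (IH2 d.+1 Y M _ _) => //; [|lia|].
    move=> Z [Zd Zj]; apply: terminates_ins => //.
    split=> [|j jd]; regs.
      rewrite Zd Zj ?ltnSn // Yd; congr (_ - _); apply: eq_eval => j jl; apply: YX; lia.
    by rewrite Zj ?Yj //; lia.
  by move=> j jl; rewrite YX; [apply: hM|]; lia.
rewrite /= in vd hM *; set N := value_bound e1 M; set S2 := step_bound e2 _.
have Nle : eval X e1 <= N by apply: eval_le => j jl; apply: hM; lia.
apply: (@terminates_weaken _ _ (step_bound e1 M + (4 + ((3 + eval X e1 * (S2 + 4).+1) + 4))) _
  (fun Y => Y d = \sum_(k < eval X e1) eval (set_reg X i k) e2 /\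
    forall j, (j < d) || (d + maxn (width e1) (3 + width e2) <= j) -> Y j = X j)) => //.
  have := leq_mul Nle (leqnn (S2 + 5)); lia.
apply: terminates_seq; apply: terminates_weaken (IH1 d X M _ _) => //; [|lia|by move=> j jl; apply: hM; lia].
move=> Y [Yd Yj]; apply: terminates_seq; apply: terminates_seqs => //.
set Y1 := foldl _ _ _; apply: terminates_seq.
have w2 := width_gt0 e2.
(* X_d counts the terms still to be added, X_(d+1) holds the partial sum, X_(d+2) the saved value of
   X_i, and X_i the current summation index. *)
pose Inv r Z := [/\ r <= eval X e1, Z d = r,
  Z d.+1 = \sum_(k < eval X e1 - r) eval (set_reg X i k) e2,
  Z d.+2 = X i /\ Z i = eval X e1 - r &
  forall j, (j < d) && (j != i) || (d + maxn (width e1) (3 + width e2) <= j) -> Z j = X j].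
apply: terminates_weaken (terminates_while (Inv := Inv) (K := S2 + 4) _ _ _); first by [].
- move=> Z [_ _ Z1 [Z2 Zi] Zj]; apply: terminates_seqs => //.
  split; regs; first by rewrite Z1 subn0 add0n.
  move=> j jd; regs; first by subst j; rewrite Z2.
  by apply: Zj; move/orP: jd => [jd|->]; rewrite ?orbT // jd; apply/orP; left; apply/eqP.
- by move=> r Z [].
- move=> r Z rl [rle Zd Z1 [Z2 Zi] Zj]; apply: terminates_seq.
  have evZ : eval Z e2 = eval (set_reg X i (eval X e1 - r.+1)) e2.
    apply: eq_eval => j jl; rewrite /set_reg; case: eqP => [->|/eqP nj]; first by rewrite Zi.
    by apply: Zj; rewrite nj; lia.
  apply: terminates_weaken (IH2 d.+3 Z (M + N) _ _) => //; [|lia|]; last first.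
    move=> j jl; have [->|nj] := eqVneq j i; first by rewrite Zi; lia.
    by rewrite Zj ?nj; [have := hM j; lia|lia].
  move=> W [Wd Wj]; apply: terminates_seqs => //.
  have Wj' j : j < d.+3 -> W j = Z j by move=> jl; apply: Wj; rewrite jl.
  have [W0 W1 W2 Wi] : [/\ W d = Z d, W d.+1 = Z d.+1, W d.+2 = Z d.+2 & W i = Z i].
    by split; apply: Wj'; lia.
  split; first by lia.
  + by regs; rewrite W0 Zd; lia.
  + regs; rewrite W1 Wd Z1 evZ.
    have -> : eval X e1 - r = (eval X e1 - r.+1).+1 by lia.
    by rewrite big_ord_recr.
  + by split; regs; rewrite ?W2 // Wi Zi; lia.
  + by move=> j jd; regs; rewrite Wj ?Zj //; lia.
- have Y1j j : j < d -> j != i -> Y1 j = X j.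
    by move=> jd /eqP ji; rewrite /Y1; regs; apply: Yj; rewrite jd.
  split=> //.
  + by rewrite /Y1; regs.
  + by rewrite subnn big_ord0 /Y1; regs.
  + by split; rewrite ?subnn /Y1; regs; rewrite add0n; apply: Yj; lia.
  + move=> j jd; rewrite /Y1; regs; apply: Yj; lia.
Qed.

(** * Filling a table by recursion *)

Definition env (n x y : nat) : memory :=
  fun j => match j with 0 => n | 1 => x | 2 => y | _ => 0 end.

Lemma env_y n x y y' j : j <> 2 -> env n x y j = env n x y' j.
Proof. by case: j => [|[|[|]]]. Qed.

Lemma env_x n x x' y j : j <> 1 -> env n x y j = env n x' y j.
Proof. by case: j => [|[|[|]]]. Qed.

Section TableProgram.
Variables (eT eA eW : expr).

(** Register layout. Below D: the variables of the expressions, with n, x, y in X_0, X_1, X_2,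
    whence D >= 3. Then X_D counts the entries still to be computed, X_(D+1) the summands left,
    X_(D+2) accumulates, X_(D+3) serves for addresses and as scratch, X_(D+4) receives the entry
    read. Expressions are evaluated from d on, and the table starts at [base]. *)
Let D := maxn 3 (maxn (vbound eT) (maxn (vbound eA) (vbound eW))).
Let d := D + 5.
Let base := d + maxn (width eT) (maxn (width eA) (width eW)).

(** The product of weight and entry is formed by adding the entry as often as the weight says: the
    weight is polynomially bounded, whereas the entry may be exponentially large. *)
Definition table_inner : cmd :=
  Seq (cexpr eW d)
 (Seq (seqs (Const (D + 3) base) [:: Add (D + 3) (D + 3) 2; LoadInd (D + 4) (D + 3)])
 (Seq (While (D + 3) d
         (seqs (Add (D + 2) (D + 2) (D + 4)) [:: Const (D + 3) 1; Sub d d (D + 3)]))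
      (seqs (Const (D + 3) 1) [:: Add 2 2 (D + 3); Sub (D + 1) (D + 1) (D + 3)]))).

Definition table_body : cmd :=
  Seq (Ins (Const 2 0))
 (Seq (cexpr eA d)
 (Seq (seqs (Const (D + 2) 0)
         [:: Add (D + 2) (D + 2) d; Const (D + 1) 0; Add (D + 1) (D + 1) 1])
 (Seq (While (D + 3) (D + 1) table_inner)
(Seq (seqs (Const (D + 3) base) [:: Add (D + 3) (D + 3) 1])
      (seqs (StoreInd (D + 3) (D + 2))
         [:: Const (D + 3) 1; Add 1 1 (D + 3); Sub D D (D + 3)]))))).

Definition table_program : cmd :=
  Seq (cexpr eT d)
 (Seq (seqs (Const (D + 3) 1) [:: Add D d (D + 3)])
 (Seq (While (D + 3) D table_body) (seqs (Const 0 0) [:: Add 0 0 (D + 2)]))).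

Variables (n : nat) (V : nat -> nat).
Hypothesis V_rec : forall x, V x =
  eval (env n x 0) eA + \sum_(y < x) eval (env n x y) eW * V y.

Let frame r x y (Z : memory) :=
  [/\ forall j, j < D -> Z j = env n x y j, Z D = r & forall k, k < x -> Z (base + k) = V k].

Let D_bounds : [/\ 3 <= D, vbound eT <= D, vbound eA <= D & vbound eW <= D].
Proof. by rewrite /D; split; lia. Qed.

Let base_bounds : [/\ d + width eT <= base, d + width eA <= base & d + width eW <= base].
Proof. by rewrite /base; split; lia. Qed.

Lemma terminates_table_inner M r x y c Z : n <= M -> x <= M -> y < x ->
  frame r x y Z -> Z (D + 1) = c.+1 ->
  terminates table_inner Z (step_bound eW M + (3 + ((3 + value_bound eW M * 4) + 3)))
    (fun Z' => [/\ frame r x y.+1 Z', Z' (D + 1) = c &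
       Z' (D + 2) = Z (D + 2) + eval (env n x y) eW * V y]).
Proof.
have [D3 DT DA DW] := D_bounds; have [bT bA bW] := base_bounds; have dE : d = D + 5 by [].
have w0 := width_gt0 eW.
move=> nM xM yx [Zj ZD ZT] Zc.
have envM j : env n x y j <= M by case: j => [|[|[|j]]] //=; lia.
have eW_le : eval (env n x y) eW <= value_bound eW M by apply: eval_le.
have evE : eval Z eW = eval (env n x y) eW by apply: eq_eval => j jl; apply: Zj; lia.
apply: terminates_seq; apply: terminates_weaken (terminates_cexpr (M := M) _ _) => //.
- move=> Z1 [Z1d Z1j]; apply: terminates_seq; apply: terminates_seqs => //.
  set Z2 := foldl _ _ _.
  have Z2d : Z2 d = eval (env n x y) eW by rewrite /Z2; regs; rewrite Z1d evE.
  have Z2V : Z2 (D + 4) = V y.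
    have a2 : Z1 2 = y by rewrite Z1j ?Zj //; lia.
    have aT : Z1 (base + y) = V y by rewrite Z1j ?ZT //; lia.
    have ne : (2 == D + 3) = false by apply/negbTE; lia.
    by rewrite /Z2 /= /set_reg !eqxx ne a2; case: eqP => //; lia.
  have Z2j j : (j < D + 3) || (base <= j) -> Z2 j = Z j.
    by move=> jl; rewrite /Z2; regs; rewrite Z1j //; lia.
  apply: terminates_seq.
  pose Inv q W := [/\ q <= eval (env n x y) eW, W d = q,
    W (D + 2) = Z (D + 2) + (eval (env n x y) eW - q) * V y, W (D + 4) = V y &
    forall j, (j < D + 2) || (base <= j) -> W j = Z j].
  apply: terminates_weaken (terminates_while (Inv := Inv) (K := 3) (r := eval (env n x y) eW) _ _ _).
  + by lia.
  + move=> W [_ _ W2 W4 Wj]; apply: terminates_seqs => //.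
    split.
    * split.
      - move=> j jD; regs; rewrite ?Wj; try lia; rewrite ?Zj //; try lia.
          by subst j; rewrite /=; lia.
        exact: env_y.
      - by regs; rewrite Wj //; lia.
      - by move=> k kx; regs; rewrite Wj ?ZT //; lia.
    * by regs; rewrite Wj ?Zc //; lia.
    * by regs; rewrite W2 subn0.
  + by move=> q W [].
  + move=> q W ql [qle Wd W2 W4 Wj]; apply: terminates_seqs => //; split.
    * by lia.
    * by regs; rewrite Wd; lia.
    * regs; rewrite W2 W4 -addnA -mulSnr; congr (_ + _ * _); lia.
    * by regs.
    * by move=> j jl; regs; apply: Wj.
  + split=> //.
    * by regs.
    * by regs; rewrite Z2j ?subnn ?addn0 //; lia.
    * by regs.
    * by move=> j jl; regs; apply: Z2j; lia.
- by lia.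
- by move=> j jl; rewrite Zj //; lia.
Qed.

Lemma terminates_table_body M r x Z : n <= M -> x <= M ->
  (exists y, frame r.+1 x y Z) ->
  terminates table_body Z
    (1 + (step_bound eA M + (4 + ((3 + x * (step_bound eW M + (3 + ((3 + value_bound eW M * 4) + 3))).+1) + (2 + 4)))))
    (fun Z' => (exists y, frame r x.+1 y Z') /\ Z' (D + 2) = V x).
Proof.
have [D3 DT DA DW] := D_bounds; have [bT bA bW] := base_bounds; have dE : d = D + 5 by [].
have w0 := width_gt0 eW.
move=> nM xM [y0 [Zj ZD ZT]].
apply: terminates_seq; apply: terminates_ins => //; set Z0 := exec _ _.
have F0 : frame r.+1 x 0 Z0.
  split.
  - by move=> j jD; rewrite /Z0; regs; [subst j|rewrite Zj //; apply: env_y].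
  - by rewrite /Z0; regs.
  - by move=> k kx; rewrite /Z0; regs; apply: ZT.
move: Z0 F0 => Z0 [Z0j Z0D Z0T].
have envM j : env n x 0 j <= M by case: j => [|[|[|j]]] //=; lia.
have evE : eval Z0 eA = eval (env n x 0) eA by apply: eq_eval => j jl; apply: Z0j; lia.
apply: terminates_seq; apply: terminates_weaken (terminates_cexpr (M := M) _ _) => //.
- move=> Z1 [Z1d Z1j]; apply: terminates_seq; apply: terminates_seqs => //.
  set Z2 := foldl _ _ _.
  have F2 : frame r.+1 x 0 Z2.
    split.
    + by move=> j jD; rewrite /Z2; regs; rewrite Z1j ?Z0j //; lia.
    + by rewrite /Z2; regs; rewrite Z1j ?Z0D //; lia.
    + by move=> k kx; rewrite /Z2; regs; rewrite Z1j ?Z0T //; lia.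
  have Z21 : Z2 (D + 1) = x by rewrite /Z2; regs; rewrite Z1j ?Z0j //=; lia.
  have Z22 : Z2 (D + 2) = eval (env n x 0) eA by rewrite /Z2; regs; rewrite Z1d evE add0n.
  move: Z2 F2 Z21 Z22 => Z2 F2 Z21 Z22; apply: terminates_seq.
  pose Inv c W := [/\ c <= x, W (D + 1) = c, frame r.+1 x (x - c) W &
    W (D + 2) = eval (env n x 0) eA + \sum_(y < x - c) eval (env n x y) eW * V y].
  apply: terminates_weaken (terminates_while (Inv := Inv)
    (K := step_bound eW M + (3 + ((3 + value_bound eW M * 4) + 3))) (r := x) _ _ _) => //.
  + move=> W [_ _ [Wj WD WT] W2]; apply: terminates_seq; apply: terminates_seqs => //.
    rewrite subn0 -V_rec in W2; rewrite subn0 in Wj.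
    have W1 : W 1 = x by rewrite Wj //; lia.
    set W' := foldl _ _ _.
    have W'3 : W' (D + 3) = base + x by rewrite /W'; regs; rewrite W1.
    have W'j j : j != D + 3 -> W' j = W j by move=> /eqP nj; rewrite /W'; regs.
    move: W' W'3 W'j => W' W'3 W'j; apply: terminates_seqs => //.
    have ne k : k < D -> (k == base + x) = false by move=> kD; apply/negbTE; lia.
    split; first exists x; first split.
    * move=> j jD; rewrite /= W'3; regs.
        by subst j; rewrite W'j ?W1 //=; lia.
      by rewrite W'j ?Wj //; [apply: env_x|lia].
    * by rewrite /= W'3; regs; rewrite W'j ?WD //; lia.
    * move=> k kx; rewrite /= W'3; regs; rewrite W'j; try lia.
        by rewrite W2; congr V; lia.
      by apply: WT; lia.
    * by rewrite /= W'3; regs; rewrite W'j //; lia.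
  + by move=> c W [].
  + move=> c W cl [cle W1 F W2].
    apply: terminates_weaken (terminates_table_inner (M := M) nM xM _ F W1) => //; last by lia.
    move=> W' [F' W1' W2']; have e : x - c = (x - c.+1).+1 by lia.
    by split; rewrite ?e //; [lia|rewrite W2' W2 big_ord_recr /= addnA].
  + have [F2j F2D F2T] := F2; split=> //; first by regs.
      rewrite subnn; split; first by move=> j jD; regs; apply: F2j.
      - by regs.
      - by move=> k kx; regs; apply: F2T.
    by rewrite subnn big_ord0 addn0; regs.
- by lia.
- by move=> j jl; rewrite Z0j //; lia.
Qed.

Lemma terminates_table_program T M : T = eval (env n 0 0) eT -> n + T <= M ->
  terminates table_program (set_reg (fun=> 0) 0 n)
    (step_bound eT n + (2 + ((3 + T.+1 *
      (1 + (step_bound eA M + (4 + ((3 + M * (step_bound eW M + (3 + ((3 + value_bound eW M * 4) + 3))).+1) + (2 + 4))))).+1) + 2)))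
    (fun Z => Z 0 = V T).
Proof.
have [D3 DT DA DW] := D_bounds; have [bT bA bW] := base_bounds; have dE : d = D + 5 by [].
move=> TE TM; set X0 := set_reg _ _ _.
have X0E j : X0 j = env n 0 0 j by rewrite /X0 /set_reg; case: j => [|[|[|j]]].
have evE : eval X0 eT = T by rewrite TE; apply: eq_eval => j _; apply: X0E.
apply: terminates_seq; apply: terminates_weaken (terminates_cexpr (M := n) _ _) => //.
- move=> Z1 [Z1d Z1j]; apply: terminates_seq; apply: terminates_seqs => //.
  set Z2 := foldl _ _ _.
  have F2 : frame T.+1 0 0 Z2.
    split=> //.
    + by move=> j jD; rewrite /Z2; regs; rewrite Z1j ?X0E //; lia.
    + by rewrite /Z2; regs; rewrite Z1d evE addn1.
  move: Z2 F2 => Z2 F2; apply: terminates_seq.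
  (* The accumulator keeps the entry computed last, so at the end the answer V T is found in
     X_(D+2). *)
  pose Inv r W := [/\ r <= T.+1, exists y, frame r (T.+1 - r) y W & r <= T -> W (D + 2) = V (T - r)].
  set KK := (X in T.+1 * X.+1).
  apply: terminates_weaken (terminates_while (Inv := Inv) (K := KK) (r := T.+1) _ _ _) => //.
  + by move=> W [_ _ W2]; apply: terminates_seqs => //; regs; rewrite W2 ?subn0.
  + by move=> r W [_ [y []]].
  + move=> r W rl [rle F _].
    apply: terminates_weaken (terminates_table_body (M := M) _ _ F); [|move=> W' [F' W'2]|lia|lia].
      rewrite /KK; have : T.+1 - r.+1 <= M by lia.
      move: (step_bound eW M + _).+1 => B TB; have := leq_mul TB (leqnn B); lia.
    split; first by lia.
      by have -> : T.+1 - r = (T.+1 - r.+1).+1 by lia.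
    by move=> _; rewrite W'2; congr V; lia.
  + have [F2j F2D F2T] := F2; split=> //; last by lia.
    by exists 0; rewrite subnn; split=> [j jD||]; regs; rewrite ?F2j.
- by lia.
- by move=> j jl; rewrite X0E; case: j {jl} => [|[|[|j]]].
Qed.

End TableProgram.

Lemma poly_bounded_horner F : poly_bounded F ->
  exists p : {poly nat}, forall n, F n <= p.[n]%R.
Proof.
move=> [k Fk]; exists (('X + 2%N%:P) ^+ k)%R => n; apply: leq_trans (Fk n) _.
rewrite horner_exp hornerD hornerX hornerC {Fk}.
by elim: k => // k IH; rewrite expnS exprS leq_mul.
Qed.

(** The number of instructions depends only on the values of the three expressions, and the length
    of the entries of V is controlled by the number of additions that produce them. *)
Theorem table_computable eT eA eW (V : nat -> nat -> nat) :
  (forall n x, V n x = eval (env n x 0) eA + \sum_(y < x) eval (env n x y) eW * V n y) ->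
  exists (P : program) (p : {poly nat}), forall n,
    outputs_within P n (V n (eval (env n 0 0) eT)) p.[n]%R.
Proof.
move=> V_rec; have [C hC] := terminates_outputs (table_program eT eA eW).
pose M n := n + value_bound eT n.
pose K n := step_bound eT n + (2 + ((3 + (value_bound eT n).+1 *
      (1 + (step_bound eA (M n) + (4 + ((3 + M n * (step_bound eW (M n) + (3 + ((3 + value_bound eW (M n) * 4) + 3))).+1) + (2 + 4))))).+1) + 2)).
have pM : poly_bounded M by apply: poly_bounded_add; [apply: poly_bounded_id|apply: poly_value_bound].
have pS e : poly_bounded (fun n => step_bound e (M n)) by apply: poly_bounded_comp => //; apply: poly_step_bound.
have pV e : poly_bounded (fun n => value_bound e (M n)) by apply: poly_bounded_comp => //; apply: poly_value_bound.
have pc := poly_bounded_cst.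
have p1 F : poly_bounded F -> poly_bounded (fun n => (F n).+1).
  by move=> pF; have [k hk] := poly_bounded_add (pc 1) pF; exists k => n; apply: hk.
have pK : poly_bounded K.
  repeat first [exact: pc | exact: pS | exact: pV | exact: pM | exact: poly_step_bound
    | exact: poly_value_bound | apply: poly_bounded_add | apply: poly_bounded_mul | refine (p1 _ _)].
have [p hp] : exists p : {poly nat}, forall n, 6 * K n * (n + C + K n + 1) <= p.[n]%R.
  apply: poly_bounded_horner.
  by repeat first [exact: pc | exact: pK | exact: poly_bounded_id | apply: poly_bounded_add
    | apply: poly_bounded_mul].
exists (compile 0 (table_program eT eA eW)), p => n.
have Tle : eval (env n 0 0) eT <= value_bound eT n.
  by apply: eval_le => -[|[|[|j]]].
have tp := @terminates_table_program eT eA eW n (V n) (V_rec n) _ (M n) erefl.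
have {}tp := tp (leq_add (leqnn n) Tle).
have [|Y <- [t [Z [rt <- tl]]]] := hC n (K n) (fun Z => Z 0 = V n (eval (env n 0 0) eT)).
  by apply: terminates_weaken tp => //; rewrite /K !leq_add2l leq_add2r leq_add2l leq_mul2r ltnS Tle orbT.
by exists t, Z; split=> //; apply: leq_trans tl (hp n).
Qed.

(** * Functions definable by expressions *)

Definition definable (f : memory -> nat) := exists e, forall X, eval X e = f X.

Lemma definable_ext f g : f =1 g -> definable f -> definable g.
Proof. by move=> fg [e he]; exists e => X; rewrite he fg. Qed.

Lemma definable_var i : definable (fun X => X i).
Proof. by exists (Var i). Qed.

Lemma definable_cst c : definable (fun=> c).
Proof. by exists (Cst c). Qed.

Lemma definable_add f g : definable f -> definable g -> definable (fun X => f X + g X).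
Proof. by move=> [e he] [e' he']; exists (Plus e e') => X; rewrite /= he he'. Qed.

Lemma definable_sub f g : definable f -> definable g -> definable (fun X => f X - g X).
Proof. by move=> [e he] [e' he']; exists (Minus e e') => X; rewrite /= he he'. Qed.

Lemma eval_set_fresh X i k e : vbound e <= i -> eval (set_reg X i k) e = eval X e.
Proof.
by move=> vi; apply: eq_eval => j jl; rewrite /set_reg; case: eqP => // ?; lia.
Qed.

(** A product is a sum of equal terms; [vbound e'] is a summation register that does not occur in
    the second factor. *)
Lemma definable_mul f g : definable f -> definable g -> definable (fun X => f X * g X).
Proof.
move=> [e he] [e' he']; exists (Sum (vbound e') e e') => X /=.
by under eq_bigr do rewrite eval_set_fresh // he'; rewrite sum_nat_const card_ord he.
Qed.

Lemma definable_exp f k : definable f -> definable (fun X => f X ^ k).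
Proof.
move=> df; elim: k => [|k IH]; first exact: (definable_cst 1).
by apply: (definable_ext (f := fun X => f X * f X ^ k)) => [X|]; [rewrite expnS|apply: definable_mul].
Qed.

Lemma definable_leq f g : definable f -> definable g -> definable (fun X => f X <= g X).
Proof.
move=> df dg; apply: (definable_ext (f := fun X => 1 - (f X - g X))) => [X|].
  by have [?|?] := leqP (f X) (g X); lia.
by apply: definable_sub; [apply: definable_cst|apply: definable_sub].
Qed.

Lemma definable_and (p q : memory -> bool) : definable (fun X => p X : nat) ->
  definable (fun X => q X : nat) -> definable (fun X => p X && q X : nat).
Proof.
move=> dp dq; apply: (definable_ext (f := fun X => p X * q X)); last exact: definable_mul.
by move=> X; rewrite mulnb.
Qed.

Lemma definable_not (p : memory -> bool) : definable (fun X => p X : nat) ->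
  definable (fun X => ~~ p X : nat).
Proof.
move=> dp; apply: (definable_ext (f := fun X => 1 - p X)) => [X|]; first by case: (p X).
by apply: definable_sub => //; apply: definable_cst.
Qed.

Lemma definable_or (p q : memory -> bool) : definable (fun X => p X : nat) ->
  definable (fun X => q X : nat) -> definable (fun X => p X || q X : nat).
Proof.
move=> dp dq; apply: (definable_ext (f := fun X => ~~ (~~ p X && ~~ q X))) => [X|].
  by rewrite negb_and !negbK.
by apply: definable_not; apply: definable_and; apply: definable_not.
Qed.

Lemma definable_imply (p q : memory -> bool) : definable (fun X => p X : nat) ->
  definable (fun X => q X : nat) -> definable (fun X => p X ==> q X : nat).
Proof.
move=> dp dq; apply: (definable_ext (f := fun X => ~~ p X || q X)) => [X|].
  by rewrite implybE.
by apply: definable_or => //; apply: definable_not.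
Qed.

Lemma definable_eq f g : definable f -> definable g -> definable (fun X => f X == g X).
Proof.
move=> df dg; apply: (definable_ext (f := fun X => (f X <= g X) && (g X <= f X))) => [X|].
  by rewrite -eqn_leq.
by apply: definable_and; apply: definable_leq.
Qed.

Lemma definable_forall (I : finType) (p : I -> memory -> bool) :
  (forall i, definable (fun X => p i X : nat)) -> definable (fun X => [forall i, p i X] : nat).
Proof.
move=> dp; apply: (definable_ext (f := fun X => all (fun i => p i X) (enum I))) => [X|].
  congr nat_of_bool; apply/allP/forallP => h i; first by apply: h; rewrite mem_enum.
  by move=> _; apply: h.
elim: (enum I) => [|i s IH] /=; first exact: (definable_cst 1).
exact: definable_and.
Qed.

Lemma definable_exists (I : finType) (p : I -> memory -> bool) :
  (forall i, definable (fun X => p i X : nat)) -> definable (fun X => [exists i, p i X] : nat).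
Proof.
move=> dp; apply: (definable_ext (f := fun X => ~~ [forall i, ~~ p i X])) => [X|].
  by rewrite negb_forall; congr nat_of_bool; apply: eq_existsb => i; rewrite negbK.
by apply: definable_not; apply: definable_forall => i; apply: definable_not.
Qed.

(** The quotient counts the positive multiples of y up to x, and as y >= 1 there are at most x of
    them. *)
Lemma divn_sum x y : 0 < y -> x %/ y = \sum_(q < x) (q.+1 * y <= x).
Proof.
move=> y0; under eq_bigr do rewrite -leq_divRL //.
have : x %/ y <= x by rewrite leq_div.
elim: x (x %/ y) => [|x IH] d; first by rewrite big_ord0; lia.
rewrite big_ord_recr /= => dx; have [e|lt] := eqVneq d x.+1.
  rewrite e ltnS leqnn (eq_bigr (fun=> 1)) ?sum_nat_const ?card_ord; first by lia.
  by move=> [i il] _ /=; rewrite ltnS ltnW.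
by rewrite -IH; lia.
Qed.

Lemma definable_div f g : (forall X, 0 < g X) -> definable f -> definable g ->
  definable (fun X => f X %/ g X).
Proof.
move=> g0 [e he] [e' he']; pose i := maxn (vbound e) (vbound e').
have [e'' he''] : definable (fun X => (X i).+1 * eval X e' <= eval X e).
  apply: definable_leq; last by exists e.
  apply: definable_mul; last by exists e'.
  apply: (definable_ext (f := fun X => X i + 1)) => [X|]; first by rewrite addn1.
  by apply: definable_add; [apply: definable_var|apply: definable_cst].
exists (Sum i e e'') => X /=; rewrite divn_sum // he; apply: eq_bigr => k _.
rewrite he'' !eval_set_fresh ?leq_maxl ?leq_maxr // he he'.
by rewrite /set_reg eqxx.
Qed.

Lemma definable_mod f g : (forall X, 0 < g X) -> definable f -> definable g ->
  definable (fun X => f X %% g X).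
Proof.
move=> g0 df dg; apply: (definable_ext (f := fun X => f X - f X %/ g X * g X)) => [X|].
  by rewrite {1}(divn_eq (f X) (g X)) addKn.
by apply: definable_sub => //; apply: definable_mul => //; apply: definable_div.
Qed.

(* Layer t of the iteration occupies the indices t * B, ..., t * B + B - 1. *)
Theorem iteration_computable (B L out : nat -> nat) (start : nat -> nat -> bool)
    (adj : nat -> nat -> nat -> bool) (U : nat -> nat -> nat -> nat) :
  (forall n, 0 < B n) -> (forall n, out n < B n) ->
  definable (fun X => B (X 0)) -> definable (fun X => L (X 0)) ->
  definable (fun X => out (X 0)) ->
  definable (fun X => start (X 0) (X 1 %% B (X 0)) : nat) ->
  definable (fun X => adj (X 0) (X 1 %% B (X 0)) (X 2 %% B (X 0)) : nat) ->
  (forall n s, U n 0 s = 0) ->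
  (forall n t s, U n t.+1 s = start n s + \sum_(s' < B n) adj n s s' * U n t s') ->
  exists (P : program) (p : {poly nat}), forall n, outputs_within P n (U n (L n) (out n)) p.[n]%R.
Proof.
move=> B0 outB dB dL dout dstart dadj U0 US.
pose V n x := U n (x %/ B n) (x %% B n).
have dmod i : definable (fun X => X i %/ B (X 0)).
  by apply: definable_div => //; apply: definable_var.
have [eT hT] : definable (fun X => L (X 0) * B (X 0) + out (X 0)).
  by apply: definable_add => //; apply: definable_mul.
(* The test [B (X 0) <= X 1] silences layer 0, on which U vanishes. *)
have [eA hA] : definable (fun X => (B (X 0) <= X 1) && start (X 0) (X 1 %% B (X 0)) : nat).
  by apply: definable_and => //; apply: definable_leq => //; apply: definable_var.
have [eW hW] : definable (fun X => (X 1 %/ B (X 0) == X 2 %/ B (X 0) + 1)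
    && adj (X 0) (X 1 %% B (X 0)) (X 2 %% B (X 0)) : nat).
  by apply: definable_and => //; apply: definable_eq => //; apply: definable_add => //; apply: definable_cst.
have [|P [p hP]] := @table_computable eT eA eW V; last first.
  exists P, p => n; have := hP n; rewrite hT /= /V divnMDl // divn_small // addn0.
  by rewrite modnMDl modn_small.
move=> n x; rewrite hA /=; under eq_bigr do rewrite hW /=.
rewrite /V; have Bn := B0 n; set b := B n in Bn *.
have [lt|ge] := ltnP x b.
  rewrite (divn_small lt) U0 big1 // => y _.
  by rewrite (_ : (0 == _) = false) // addn1.
have [t xt] : exists t, x %/ b = t.+1.
  by exists (x %/ b).-1; rewrite prednK // divn_gt0.
have xE : x = t.+1 * b + x %% b by rewrite -xt -divn_eq.
rewrite xt US andTb; congr (_ + _); apply/esym.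
have -> : \sum_(i < x) ((t.+1 == i %/ b + 1) && adj n (x %% b) (i %% b)) * U n (i %/ b) (i %% b)
  = \sum_(0 <= i < x | t.+1 == i %/ b + 1) adj n (x %% b) (i %% b) * U n (i %/ b) (i %% b).
  rewrite big_mkord [RHS]big_mkcond; apply: eq_bigr => i _.
  by case: (t.+1 == _).
(* Only the indices of layer t, those in [t * b, (t + 1) * b), contribute. They all precede x, which
   lies in layer t + 1, so the sum is cut at both ends of the layer. *)
have le1 : t * b <= t.+1 * b by rewrite leq_mul2r leqnSn orbT.
have le2 : t.+1 * b <= x by rewrite [x]xE leq_addr.
rewrite (big_cat_nat (n := t * b)) ?(leq_trans le1) //= (big_cat_nat (n := t.+1 * b) (m := t * b)) //=.
rewrite big_nat_cond big1 ?add0n; last first.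
  move=> i /andP[il]; rewrite addn1 eqSS => /eqP e.
  by move: il; rewrite /= e ltnNge leq_divM.
rewrite [X in _ + X]big_nat_cond [X in _ + X]big1 ?addn0; last first.
  move=> i /andP[/andP[il _]]; rewrite addn1 eqSS => /eqP e.
  by move: il; rewrite leqNgt e mulSn addnC {1}(divn_eq i b) ltn_add2l ltn_mod Bn.
rewrite -{1}[t * b]add0n big_addn -mulnBl subSnn mul1n big_mkord big_mkcond /=.
apply: eq_bigr => -[i il] _ /=; rewrite [i + _]addnC divnMDl // divn_small // addn0 addn1 eqxx.
by rewrite modnMDl (modn_small il).
Qed.

(** * Exact covers by unimodular triangles *)

Local Open Scope ring_scope.

(** * Generic points near a given point *)

Section SmallParameter.
Variable R : realType.

Definition small (Q : R -> Prop) := exists2 e : R, 0 < e & forall s, 0 < s < e -> Q s.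

Lemma small_and (Q1 Q2 : R -> Prop) : small Q1 -> small Q2 -> small (fun s => Q1 s /\ Q2 s).
Proof.
move=> [e1 e1p h1] [e2 e2p h2]; exists (Num.min e1 e2); first by rewrite lt_min e1p.
by move=> s; rewrite lt_min => /and3P[s0 s1 s2]; split; [apply: h1|apply: h2]; rewrite s0.
Qed.

Lemma small_impl (Q1 Q2 : R -> Prop) :
  (forall s, 0 < s -> Q1 s -> Q2 s) -> small Q1 -> small Q2.
Proof.
by move=> h [e ep he]; exists e => // s /andP[s0 se]; apply: h => //; apply: he; rewrite s0.
Qed.

Lemma small_seq (I : eqType) (r : seq I) (Q : I -> R -> Prop) :
  (forall i, i \in r -> small (Q i)) -> small (fun s => forall i, i \in r -> Q i s).
Proof.
elim: r => [|i r IH] h; first by exists 1.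
have [||e ep he] := @small_and (Q i) (fun s => forall i, i \in r -> Q i s).
- by apply: h; rewrite inE eqxx.
- by apply: IH => j jr; apply: h; rewrite inE jr orbT.
exists e => // s /he[Qi Qr] j; rewrite inE => /orP[/eqP->|/Qr] //.
Qed.

(** For s < 1 the two higher terms are together at most (|b| + |c|) * s in absolute value, which
    settles a positive constant term; if the constant term is zero, a factor s is taken out. *)
Lemma small_quad_gt0 (q0 q1 q2 : R) : (0 < q0) || (q0 == 0) && (0 < q1) ->
  small (fun s => 0 < q0 + q1 * s + q2 * s ^+ 2).
Proof.
have pos (a b c : R) : 0 < a -> small (fun s => 0 < a + b * s + c * s ^+ 2).
  move=> a0; set k := `|b| + `|c| + 1.
  have k0 : 0 < k by rewrite /k; have := normr_ge0 b; have := normr_ge0 c; lra.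
  exists (Num.min 1 (a / k)); first by rewrite lt_min ltr01 divr_gt0.
  move=> s; rewrite lt_min => /and3P[s0 s1 sk].
  rewrite ltr_pdivlMr // in sk.
  have hb : - (`|b| * s) <= b * s.
    by rewrite -mulNr ler_pM2r // lerNl; have := ler_norm (- b); rewrite normrN.
  have hc : - (`|c| * s) <= c * s ^+ 2.
    have h1 : - `|c| <= c by rewrite lerNl; have := ler_norm (- c); rewrite normrN.
    have h2 := normr_ge0 c.
    have h3 : 0 <= s - s ^+ 2 by nra.
    have h4 : 0 <= c + `|c| by lra.
    have := mulr_ge0 h2 h3; have := mulr_ge0 h4 (sqr_ge0 s); lra.
  move: sk; rewrite /k !mulrDr mulr1 ![s * _]mulrC; lra.
case/orP => [|/andP[/eqP-> q10]]; first exact: pos.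
apply: small_impl (pos q1 q2 0 q10) => s s0; nra.
Qed.

Lemma small_quad_neq0 (q0 q1 q2 : R) : [|| q0 != 0, q1 != 0 | q2 != 0] ->
  small (fun s => q0 + q1 * s + q2 * s ^+ 2 != 0).
Proof.
have main (a b c : R) : a != 0 -> small (fun s => a + b * s + c * s ^+ 2 != 0).
  rewrite neq_lt => /orP[a0|a0]; last first.
    by apply: small_impl (@small_quad_gt0 a b c _) => [s _|]; rewrite ?a0 // => /gt_eqF->.
  apply: small_impl (@small_quad_gt0 (- a) (- b) (- c) _) => [s _ h|]; last by rewrite oppr_gt0 a0.
  by rewrite lt_eqF //; nra.
have [->|n0] := eqVneq q0 0; last by move=> _; apply: main.
have [->|n1] := eqVneq q1 0 => /= n2.
  by apply: small_impl (main q2 0 0 n2) => s s0; rewrite !mul0r !add0r !addr0 => h; rewrite mulf_neq0 // expf_neq0 // gt_eqF.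
apply: small_impl (main q1 q2 0 n1) => s s0; rewrite mul0r addr0 => h.
by rewrite add0r expr2 mulrA -mulrDl mulf_neq0 // gt_eqF.
Qed.

(* The affine form z |-> L.1.1 * z.1 + L.1.2 * z.2 + L.2 and its linear part. *)
Definition form_at (L : R * R * R) (z : R * R) : R := L.1.1 * z.1 + L.1.2 * z.2 + L.2.
Definition form_dir (L : R * R * R) (v : R * R) : R := L.1.1 * v.1 + L.1.2 * v.2.

(* L is positive at u + s v for all small s > 0. *)
Definition inward (u v : R * R) (L : R * R * R) : bool :=
  (0 < form_at L u) || (form_at L u == 0) && (0 < form_dir L v).

(* The curve u + s v + s^2 v' with v' orthogonal to v is contained in no line. *)
Lemma germ (u v : R * R) (F G : seq (R * R * R)) : (v.1 != 0) || (v.2 != 0) ->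
  (forall L, L \in F -> inward u v L) ->
  (forall L, L \in G -> (L.1.1 != 0) || (L.1.2 != 0)) ->
  exists z, (forall L, L \in F -> 0 < form_at L z) /\ (forall L, L \in G -> form_at L z != 0).
Proof.
move=> v0 hF hG; pose z s := (u.1 + v.1 * s - v.2 * s ^+ 2, u.2 + v.2 * s + v.1 * s ^+ 2).
have zE L s : form_at L (z s) = form_at L u + form_dir L v * s + (L.1.2 * v.1 - L.1.1 * v.2) * s ^+ 2.
  by rewrite /form_at /form_dir /z /=; ring.
have sF : small (fun s => forall L, L \in F -> 0 < form_at L (z s)).
  apply: small_seq => L /hF LF; apply: small_impl (small_quad_gt0 _ LF) => s s0; rewrite zE; exact.
have sG : small (fun s => forall L, L \in G -> form_at L (z s) != 0).
  apply: small_seq => L /hG LG; apply: small_impl (small_quad_neq0 (q0 := form_at L u)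
    (q1 := form_dir L v) (q2 := L.1.2 * v.1 - L.1.1 * v.2) _) => [s s0|]; first by rewrite zE; exact.
  apply/orP; right; rewrite -negb_and; apply/negP => /andP[/eqP e1 /eqP e2]; move: e1 e2 v0 LG.
  rewrite /form_dir; set a := L.1.1; set b := L.1.2; set c := v.1; set d := v.2 => e1 e2 v0 LG.
  (* By Lagrange's identity the gradient of L and the vector v, both nonzero, are not at once
     orthogonal and parallel; so the coefficients of s and of s^2 along the curve do not both
     vanish. *)
  have e : (a ^+ 2 + b ^+ 2) * (c ^+ 2 + d ^+ 2) = 0.
    rewrite -[RHS](_ : (a * c + b * d) ^+ 2 + (b * c - a * d) ^+ 2 = 0); first by ring.
    by rewrite e1 e2 expr0n addr0.
  move/eqP: e; rewrite mulf_eq0 !paddr_eq0 ?sqr_ge0 // !sqrf_eq0.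
  by rewrite -!negb_and in v0 LG; rewrite (negbTE v0) (negbTE LG).
have [e ep he] := small_and sF sG; exists (z (e / 2)).
by have := he (e / 2); apply; rewrite divr_gt0 // ltr_pdivrMr // ltr_pMr // ltr1n.
Qed.

End SmallParameter.

(** * Lattice triangles and their hulls *)

Section Geometry.
Variables (R : realType) (m n : nat).
Implicit Types (a b c p q r v : grid m n) (s t u : {set grid m n}) (z : R * R).

(** Twice the signed area of the triangle a b z, positive when z lies to the left of the line
    directed from a to b. *)
Definition cross (a b z : R * R) : R := (b.1 - a.1) * (z.2 - a.2) - (b.2 - a.2) * (z.1 - a.1).

Definition pt v : R * R := (px R v, py R v).

Definition crossz a b c : int :=
  ((b.1 : nat)%:Z - (a.1 : nat)%:Z) * ((c.2 : nat)%:Z - (a.2 : nat)%:Z)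
  - ((b.2 : nat)%:Z - (a.2 : nat)%:Z) * ((c.1 : nat)%:Z - (a.1 : nat)%:Z).

Lemma cross_pt a b c : cross (pt a) (pt b) (pt c) = (crossz a b c)%:~R.
Proof. by rewrite /cross /crossz /pt /px /py /= intrB !intrM !intrB. Qed.

Lemma pt_inj : injective pt.
Proof.
move=> [x y] [x' y'] [] /eqP; rewrite eqr_nat => /eqP e1 /eqP; rewrite eqr_nat => /eqP e2.
by congr pair; apply: val_inj.
Qed.

Definition line (a b : R * R) : R * R * R :=
  (a.2 - b.2, b.1 - a.1, (b.2 - a.2) * a.1 - (b.1 - a.1) * a.2).

Lemma line_at (a b z : R * R) : form_at (line a b) z = cross a b z.
Proof. by rewrite /form_at /line /cross /=; ring. Qed.

Definition generic z := forall p q, p != q -> cross (pt p) (pt q) z != 0.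

(** The last conclusion is continuity: strict inequalities at u persist at z. It serves to carry
    membership in a hull back from z to u. *)
Lemma generic_germ (u v : R * R) (F : seq (R * R * R)) : (v.1 != 0) || (v.2 != 0) ->
  (forall L, L \in F -> inward u v L) ->
  exists z, [/\ generic z, forall L, L \in F -> 0 < form_at L z &
    forall p q, 0 < cross (pt p) (pt q) u -> 0 < cross (pt p) (pt q) z].
Proof.
move=> v0 hF.
pose G := [seq line (pt pq.1) (pt pq.2) | pq <- enum [set pq : grid m n * grid m n | pq.1 != pq.2]].
pose F' := [seq line (pt pq.1) (pt pq.2) | pq <- enum [set pq : grid m n * grid m n |
  0 < cross (pt pq.1) (pt pq.2) u]].
have [L|L|z [zF zG]] := @germ R u v (F ++ F') G v0.
- rewrite mem_cat => /orP[/hF //|/mapP[[p q]]]; rewrite mem_enum inE /= => h ->.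
  by rewrite /inward line_at h.
- move=> /mapP[[p q]]; rewrite mem_enum inE /= => pq -> /=.
  rewrite -negb_and !subr_eq0; apply/negP => /andP[/eqP e2 /eqP e1].
  by move/eqP: pq; apply; apply: pt_inj; rewrite /pt; congr pair.
exists z; split=> [p q pq|L LF|p q h].
- rewrite -line_at; apply: zG.
  by apply/mapP; exists (p, q); rewrite ?mem_enum ?inE.
- by apply: zF; rewrite mem_cat LF.
- rewrite -line_at; apply: zF; rewrite mem_cat; apply/orP; right.
  by apply/mapP; exists (p, q); rewrite ?mem_enum ?inE.
Qed.

Definition tri a b c : {set grid m n} := [set a; b; c].

(** Listing the vertices counterclockwise removes the absolute value from the area condition. *)
Definition unimod s := exists a b c, s = tri a b c /\ crossz a b c = 1.

Lemma crossz_rot a b c : crossz b c a = crossz a b c.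
Proof. by rewrite /crossz; ring. Qed.

Lemma crossz_swap a b c : crossz b a c = - crossz a b c.
Proof. by rewrite /crossz; ring. Qed.

Lemma tri_rot a b c : tri b c a = tri a b c.
Proof. by apply/setP => x; rewrite !inE orbC orbA. Qed.

Lemma tri_swap a b c : tri b a c = tri a b c.
Proof. by apply/setP => x; rewrite !inE [(x == b) || _]orbC. Qed.

Lemma ccw_neq a b c : crossz a b c = 1 -> [/\ a != b, b != c & a != c].
Proof.
move=> e; split; apply/eqP => ab; subst; move: e; rewrite /crossz; lia.
Qed.

Lemma unimodular_triangleE s : unimodular_triangle R s <-> unimod s.
Proof.
have areaE a b c : triangle_area R a b c = `|(crossz a b c)%:~R| / 2.
  by rewrite -cross_pt /triangle_area /cross /pt /=; congr (`|_| / _); ring.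
split=> [[a [b [c [-> ]]]]|[a [b [c [-> e]]]]]; last first.
  by exists a, b, c; split=> //; rewrite areaE e normr1.
rewrite areaE => /(divIf _); rewrite pnatr_eq0 => /(_ isT) /eqP; rewrite -intr_norm -[X in _ == X]/(1%:~R) eqr_int.
have [h|h] := leP 0 (crossz a b c).
  by rewrite ger0_norm // => /eqP e; exists a, b, c.
rewrite ltr0_norm // => /eqP e; exists b, a, c; split; first by rewrite tri_swap.
by rewrite crossz_swap.
Qed.

Lemma hull_form u z (L : R * R * R) : hull u z -> exists w : grid m n -> R,
  [/\ forall v, v \in u -> 0 <= w v, \sum_(v in u) w v = 1 &
      form_at L z = \sum_(v in u) w v * form_at L (pt v)].
Proof.
move=> [w [w0 w1 e1 e2]]; exists w; split=> //.
transitivity (L.1.1 * (\sum_(v in u) w v * px R v) + L.1.2 * (\sum_(v in u) w v * py R v)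
  + L.2 * \sum_(v in u) w v); first by rewrite -e1 -e2 w1 mulr1.
rewrite !mulr_sumr -!big_split /=; apply: eq_bigr => v _; rewrite /form_at /pt /=; ring.
Qed.

Lemma hull_form_ge0 u z (L : R * R * R) : (forall v, v \in u -> 0 <= form_at L (pt v)) ->
  hull u z -> 0 <= form_at L z.
Proof.
move=> h /(hull_form L)[w [w0 _ ->]]; apply: sumr_ge0 => v vu.
by rewrite mulr_ge0 ?w0 ?h.
Qed.

Lemma big_tri a b c (F : grid m n -> R) : crossz a b c = 1 ->
  \sum_(v in tri a b c) F v = F a + F b + F c.
Proof.
move=> /ccw_neq[ab bc ac]; rewrite /tri setUC big_setU1 /=; last first.
  by rewrite !inE negb_or ![c == _]eq_sym ac bc.
rewrite big_setU1 ?inE //= big_set1; ring.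
Qed.

Definition in_tri a b c z :=
  [/\ 0 <= cross (pt b) (pt c) z, 0 <= cross (pt c) (pt a) z & 0 <= cross (pt a) (pt b) z].

Lemma cross_sum (a b c z : R * R) : cross b c z + cross c a z + cross a b z = cross a b c.
Proof. by rewrite /cross; ring. Qed.

(** Cramer's rule: the three values of [cross] are the barycentric coordinates of z multiplied by
    twice the area. For a unimodular triangle they are the coordinates themselves. *)
Lemma cross_bary (a b c z : R * R) :
  cross b c z * a.1 + cross c a z * b.1 + cross a b z * c.1 = z.1 * cross a b c /\
  cross b c z * a.2 + cross c a z * b.2 + cross a b z * c.2 = z.2 * cross a b c.
Proof. by rewrite /cross; split; ring. Qed.

Lemma ccw_cross a b c : crossz a b c = 1 -> cross (pt a) (pt b) (pt c) = 1.
Proof. by rewrite cross_pt => ->. Qed.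

Lemma crossaa (a b : R * R) : cross a b a = 0 /\ cross a b b = 0.
Proof. by rewrite /cross; split; ring. Qed.

Lemma hull_tri a b c z : crossz a b c = 1 -> hull (tri a b c) z <-> in_tri a b c z.
Proof.
move=> e; have := e; rewrite -crossz_rot => e2; have := e2; rewrite -crossz_rot => e3.
have := ccw_cross e; have := ccw_cross e2; have := ccw_cross e3 => d3 d2 d1.
have [aa1 ab1] := crossaa (pt a) (pt b); have [bb1 bc1] := crossaa (pt b) (pt c).
have [cc1 ca1] := crossaa (pt c) (pt a).
split=> [h|[h1 h2 h3]].
  split; rewrite -line_at; apply: hull_form_ge0 h => v; rewrite !inE => /orP[/orP[]|] /eqP ->;
    rewrite line_at ?d1 ?d2 ?d3 ?aa1 ?ab1 ?bb1 ?bc1 ?cc1 ?ca1 //; exact: ler01.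
have [ab bc ac] := ccw_neq e.
exists (fun v => if v == a then cross (pt b) (pt c) z else if v == b then cross (pt c) (pt a) z
  else cross (pt a) (pt b) z).
have [x y] := cross_bary (pt a) (pt b) (pt c) z; rewrite d1 !mulr1 in x y.
rewrite !big_tri // !eqxx ![_ == a]eq_sym [c == b]eq_sym (negbTE ab) (negbTE bc) (negbTE ac).
split=> //; last by rewrite cross_sum.
by move=> v _; case: ifP => // _; case: ifP.
Qed.

(** The barycentric coordinates of a lattice point in a unimodular triangle are nonnegative integers
    of sum 1, so one of them is 1 and the others are 0. *)
Lemma lattice_in_hull s v : unimod s -> hull s (pt v) -> v \in s.
Proof.
move=> [a [b [c [-> e]]]] /(hull_tri _ e)[].
have [x y] := cross_bary (pt a) (pt b) (pt c) (pt v).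
have := cross_sum (pt a) (pt b) (pt c) (pt v); rewrite (ccw_cross e) !mulr1 in x y *.
move: x y; rewrite !cross_pt -!intrD -[1]/(1%:~R) => x y /eqP; rewrite eqr_int => /eqP s1.
rewrite !ler0z => l1 l2 l3; rewrite !inE.
have [] : [\/ crossz b c v = 1 /\ (crossz c a v = 0 /\ crossz a b v = 0),
    crossz b c v = 0 /\ (crossz c a v = 1 /\ crossz a b v = 0) |
    crossz b c v = 0 /\ (crossz c a v = 0 /\ crossz a b v = 1)].
  have [?|?] := eqVneq (crossz b c v) 1; first by constructor 1; lia.
  have [?|?] := eqVneq (crossz c a v) 1; first by constructor 2; lia.
  by constructor 3; lia.
- move=> [E1 [E2 E3]]; suff -> : v = a by rewrite eqxx.
  by apply: pt_inj; rewrite /pt; move: x y; rewrite E1 E2 E3 !mul0r !mul1r !addr0 /= => -> ->.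
- move=> [E1 [E2 E3]]; suff -> : v = b by rewrite eqxx orbT.
  by apply: pt_inj; rewrite /pt; move: x y; rewrite E1 E2 E3 !mul0r !mul1r !add0r !addr0 /= => -> ->.
- move=> [E1 [E2 E3]]; suff -> : v = c by rewrite eqxx !orbT.
  by apply: pt_inj; rewrite /pt; move: x y; rewrite E1 E2 E3 !mul0r !mul1r !add0r /= => -> ->.
Qed.

Lemma hull_rectangle u z : hull u z -> rectangle m n z.
Proof.
move=> h.
have b1 (v : grid m n) : px R v <= m%:R by rewrite ler_nat -ltnS.
have b2 (v : grid m n) : py R v <= n%:R by rewrite ler_nat -ltnS.
have hx : 0 <= form_at (1, 0, 0) z by apply: hull_form_ge0 h => v _; rewrite /form_at /= mul1r mul0r !addr0.
have hy : 0 <= form_at (0, 1, 0) z by apply: hull_form_ge0 h => v _; rewrite /form_at /= mul1r mul0r add0r !addr0.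
have hx' : 0 <= form_at (-1, 0, m%:R) z.
  by apply: hull_form_ge0 h => v _; rewrite /form_at /=; have := b1 v; lra.
have hy' : 0 <= form_at (0, -1, n%:R) z.
  by apply: hull_form_ge0 h => v _; rewrite /form_at /=; have := b2 v; lra.
by move: hx hy hx' hy'; rewrite /form_at /= => *; split; apply/andP; split; lra.
Qed.

(* A face containing a generic point is two-dimensional. *)
Lemma generic_face u s z : unimod s -> u \subset s -> generic z -> hull u z -> u = s.
Proof.
move=> [a [b [c [-> e]]]] us gz hz; apply/eqP; rewrite eqEsubset us /=.
have key : forall a b c, crossz a b c = 1 -> u \subset tri a b c -> c \in u.
  move=> {us e}{}a {}b {}c e us; apply/negPn/negP => cu; have [ab _ _] := ccw_neq e.
  have := gz a b ab; rewrite -line_at; have [w [_ _ ->]] := hull_form (line (pt a) (pt b)) hz.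
  rewrite big1 ?eqxx // => v vu; rewrite line_at.
  have [aa1 ab1] := crossaa (pt a) (pt b).
  have := subsetP us v vu; rewrite !inE => /orP[/orP[]|] /eqP ev; subst v.
  - by rewrite aa1 mulr0.
  - by rewrite ab1 mulr0.
  - by rewrite vu in cu.
apply/subsetP => v; rewrite !inE => /orP[/orP[]|] /eqP ->.
- by apply: (key b c a); [rewrite crossz_rot|rewrite tri_rot].
- by apply: (key c a b); [rewrite -crossz_rot|rewrite -tri_rot].
- exact: (key a b c).
Qed.

End Geometry.

(** * Exact covers and triangulations *)

Section ExactCover.
Variables (R : realType) (m n : nat).
Implicit Types (a b c p q r v : grid m n) (s t u : {set grid m n}) (z : R * R).
Implicit Types (T : {set {set grid m n}}).

Lemma cross_opp (a b z : R * R) : cross b a z = - cross a b z.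
Proof. by rewrite /cross; ring. Qed.

Lemma inwardI (u v : R * R) (L : R * R * R) : 0 <= form_at L u ->
  (form_at L u = 0 -> 0 < form_dir L v) -> inward u v L.
Proof.
by rewrite le0r /inward => /orP[/eqP e h|-> //]; rewrite e eqxx h ?orbT.
Qed.

Definition cnt T z : nat := #|[set t in T | `[< hull t z >]]|.

Definition exact (reg : R * R -> bool) T :=
  (forall t, t \in T -> unimod t) /\
  forall z, generic m n z -> rectangle m n z -> cnt T z = reg z.

Lemma cnt_gt0 T z : (0 < cnt T z)%N <-> exists2 t, t \in T & hull t z.
Proof.
rewrite card_gt0; split=> [/set0Pn[t]|[t tT tz]]; first by rewrite inE => /andP[tT /asboolP]; exists t.
by apply/set0Pn; exists t; rewrite inE tT; apply/asboolP.
Qed.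

Lemma exact_uniq reg T z t1 t2 : exact reg T -> generic m n z ->
  t1 \in T -> t2 \in T -> hull t1 z -> hull t2 z -> t1 = t2.
Proof.
move=> [_ ex] gz t1T t2T h1 h2.
have cle : (cnt T z <= 1)%N by rewrite ex //; [case: (reg z)|apply: hull_rectangle h1].
by apply: (card_le1_eqP cle); rewrite inE ?t1T ?t2T; apply/asboolP.
Qed.

(** The points u + s v with small s > 0 are interior to t; u itself may lie on the boundary. *)
Definition germ_in t (u v : R * R) := exists a b c, [/\ t = tri a b c, crossz a b c = 1 &
  [/\ inward u v (line (pt R b) (pt R c)), inward u v (line (pt R c) (pt R a))
    & inward u v (line (pt R a) (pt R b))]].

Definition germ_forms (a b c : grid m n) : seq (R * R * R) :=
  [:: line (pt R b) (pt R c); line (pt R c) (pt R a); line (pt R a) (pt R b)].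

Lemma germ_forms_hull a b c z : crossz a b c = 1 ->
  (forall L, L \in germ_forms a b c -> 0 < form_at L z) -> hull (tri a b c) z.
Proof.
move=> e h; apply/(hull_tri _ e); split; rewrite -line_at; apply: ltW; apply: h;
  by rewrite !inE eqxx ?orbT.
Qed.

(** The common germ contains points interior to both triangles, and near them there is a generic
    one, which an exact cover counts only once. *)
Lemma exact_overlap reg T t1 t2 (u v : R * R) : exact reg T -> t1 \in T -> t2 \in T ->
  (v.1 != 0) || (v.2 != 0) -> germ_in t1 u v -> germ_in t2 u v -> t1 = t2.
Proof.
move=> ex t1T t2T v0 [a [b [c [e1 d1 [x1 y1 w1]]]]] [a' [b' [c' [e2 d2 [x2 y2 w2]]]]].
have [L|z [gz zF _]] := generic_germ m n v0
    (F := germ_forms a b c ++ germ_forms a' b' c') (u := u).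
  by rewrite mem_cat !inE => /orP[]/or3P[]/eqP->.
apply: (exact_uniq ex gz t1T t2T).
  by rewrite e1; apply: germ_forms_hull => // L LF; apply: zF; rewrite mem_cat LF.
by rewrite e2; apply: germ_forms_hull => // L LF; apply: zF; rewrite mem_cat LF orbT.
Qed.

(* Whatever vanishes at u but not nearby is the only obstacle to membership. *)
Lemma hull_near t (u z : R * R) : unimod t -> hull t z ->
  (forall p q, 0 < cross (pt R p) (pt R q) u -> 0 < cross (pt R p) (pt R q) z) -> hull t u.
Proof.
move=> [a [b [c [-> e]]]] /(hull_tri _ e)[h1 h2 h3] near; apply/(hull_tri _ e).
have key p q : 0 <= cross (pt R p) (pt R q) z -> 0 <= cross (pt R p) (pt R q) u.
  move=> h; rewrite leNgt; apply/negP => lt.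
  have := near q p; rewrite cross_opp oppr_gt0 => /(_ lt); rewrite cross_opp oppr_gt0.
  by rewrite ltNge h.
by split; apply: key.
Qed.

Lemma unimod_generic t : unimod t -> exists2 z : R * R, generic m n z & hull t z.
Proof.
move=> [a [b [c [-> e]]]].
pose u : R * R := (((pt R a).1 + (pt R b).1 + (pt R c).1) / 3, ((pt R a).2 + (pt R b).2 + (pt R c).2) / 3).
have e1 := ccw_cross R e.
have [||z [gz zF _]] := @generic_germ R m n u (1, 0) (germ_forms a b c).
- by rewrite /= oner_eq0.
- have h x y w : cross x y w = 1 -> inward (R := R) ((x.1 + y.1 + w.1) / 3, (x.2 + y.2 + w.2) / 3) (1, 0) (line x y).
    move=> exy; rewrite /inward line_at; apply/orP; left.
    have -> : cross x y ((x.1 + y.1 + w.1) / 3, (x.2 + y.2 + w.2) / 3) = cross x y w / 3.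
      by rewrite /cross /=; field.
    by rewrite exy divr_gt0 ?ltr01 ?ltr0n.
  have h1 : cross (pt R b) (pt R c) (pt R a) = 1 by rewrite -e1 /cross; ring.
  have h2 : cross (pt R c) (pt R a) (pt R b) = 1 by rewrite -e1 /cross; ring.
  move=> L; rewrite !inE => /or3P[]/eqP->.
  + by have := h _ _ _ h1; congr (inward (_, _)); rewrite /u; congr (_ / _); ring.
  + by have := h _ _ _ h2; congr (inward (_, _)); rewrite /u; congr (_ / _); ring.
  + exact: h.
by exists z => //; apply: germ_forms_hull.
Qed.

Lemma hull_mem v s : v \in s -> hull s (pt R v).
Proof.
move=> vs; exists (fun x => (x == v)%:R).
have S (f : grid m n -> R) : \sum_(x in s) (x == v)%:R * f x = f v.
  rewrite (bigD1 v) //= eqxx mul1r big1 ?addr0 // => x /andP[_ /negbTE->]; exact: mul0r.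
split=> [x _|||]; rewrite ?S ?ler0n //.
by rewrite -[RHS](S (fun=> 1)); apply: eq_bigr => x _; rewrite mulr1.
Qed.

(** The weights are sums of two indicators, so that a = b is not a separate case. *)
Lemma hull_seg a b s (k : R) : a \in s -> b \in s -> 0 <= k <= 1 ->
  hull s ((1 - k) * (pt R a).1 + k * (pt R b).1, (1 - k) * (pt R a).2 + k * (pt R b).2).
Proof.
move=> as_ bs /andP[k0 k1]; exists (fun x => (x == a)%:R * (1 - k) + (x == b)%:R * k).
have S (f : grid m n -> R) c : c \in s -> \sum_(x in s) (x == c)%:R * f x = f c.
  move=> cs; rewrite (bigD1 c) //= eqxx mul1r big1 ?addr0 // => x /andP[_ /negbTE->]; exact: mul0r.
have D (f : grid m n -> R) : \sum_(x in s) ((x == a)%:R * (1 - k) + (x == b)%:R * k) * f x = (1 - k) * f a + k * f b.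
  transitivity (\sum_(x in s) ((x == a)%:R * ((1 - k) * f x)) + \sum_(x in s) ((x == b)%:R * (k * f x))).
    by rewrite -big_split; apply: eq_bigr => x _ /=; rewrite mulrDl !mulrA.
  by rewrite !S.
split; rewrite ?D //.
- by move=> x _; rewrite addr_ge0 // mulr_ge0 ?ler0n // subr_ge0.
- rewrite -[RHS](_ : (1 - k) * 1 + k * 1 = 1); last by ring.
  by rewrite -(D (fun=> 1)); apply: eq_bigr => x _; rewrite mulr1.
Qed.

(* Up to rotation only the third barycentric coordinate of a point other than
   a vertex may vanish. *)
Lemma hull_cases s z : unimod s -> hull s z -> (exists2 v, v \in s & z = pt R v) \/
  exists a b c, [/\ s = tri a b c, crossz a b c = 1 &
  [/\ 0 < cross (pt R b) (pt R c) z, 0 < cross (pt R c) (pt R a) z & 0 <= cross (pt R a) (pt R b) z]].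
Proof.
move=> [a [b [c [sE e]]]] hz.
have [h1 h2 h3] : in_tri a b c z by apply/(hull_tri _ e); rewrite -sE.
have e2 : crossz b c a = 1 by rewrite crossz_rot.
have e3 : crossz c a b = 1 by rewrite 2!crossz_rot.
have V : forall a b c, s = tri a b c -> crossz a b c = 1 -> cross (pt R b) (pt R c) z = 0 -> cross (pt R c) (pt R a) z = 0 ->
    exists2 v, v \in s & z = pt R v.
  move=> a1 b1 c1 sE1 d1 h h'; exists c1; first by rewrite sE1 !inE eqxx !orbT.
  have := cross_sum (pt R a1) (pt R b1) (pt R c1) z; rewrite h h' (ccw_cross R d1) !add0r => h''.
  have [] := cross_bary (pt R a1) (pt R b1) (pt R c1) z.
  rewrite h h' h'' (ccw_cross R d1) !mul0r !mulr1 !mul1r !add0r => x y.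
  by rewrite [LHS]surjective_pairing -x -y -surjective_pairing.
move: h1 h2 h3; rewrite !le0r => /orP[/eqP h1|h1] /orP[/eqP h2|h2] /orP[/eqP h3|h3];
  try by left; first [exact: (V a b c)|by apply: (V b c a) => //; rewrite tri_rot|
    by apply: (V c a b) => //; rewrite 2!tri_rot].
- by right; exists b, c, a; rewrite tri_rot; split=> //; split=> //; rewrite h1.
- by right; exists c, a, b; rewrite 2!tri_rot; split=> //; split=> //; rewrite h2.
- by right; exists a, b, c; split=> //; split=> //; rewrite h3.
- by right; exists a, b, c; split=> //; split=> //; rewrite ltW.
Qed.

(** The direction is the gradient of the form, so the value is its squared length. *)
Lemma line_nz a b c : crossz a b c = 1 ->
  0 < form_dir (line (pt R a) (pt R b)) (line (pt R a) (pt R b)).1.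
Proof.
move=> /(ccw_cross R); rewrite /form_dir /cross /=.
set x := (pt R b).1 - _; set y := (pt R b).2 - _ => e.
rewrite -[_ - (pt R b).2]opprB -/y mulrNN -!expr2.
rewrite lt_neqAle addr_ge0 ?sqr_ge0 // andbT eq_sym paddr_eq0 ?sqr_ge0 // !sqrf_eq0.
by apply/negP => /andP[/eqP ey /eqP ex]; move: e; rewrite ex ey !mul0r subr0 => /eqP; rewrite eq_sym oner_eq0.
Qed.

Lemma dir_neq0 (L : R * R * R) (v : R * R) : 0 < form_dir L v -> (v.1 != 0) || (v.2 != 0).
Proof.
rewrite -negb_and => h; apply/negP => /andP[/eqP e1 /eqP e2]; move: h.
by rewrite /form_dir e1 e2 !mulr0 addr0 ltxx.
Qed.

(** Measured along ab by [crossz c a], the points a' and b' have integer coordinates k and k'. The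
    difference k' - k divides the area form of a' b' c', which is 1, so it is 1 or -1. The
    coordinate of z is strictly between 0 and 1 and strictly between k and k', so k and k' are 0 and
    1 in some order. *)
Lemma collinear_edges a b c a' b' c' z : crossz a b c = 1 -> crossz a' b' c' = 1 ->
  0 < cross (pt R b) (pt R c) z -> 0 < cross (pt R c) (pt R a) z -> cross (pt R a) (pt R b) z = 0 ->
  0 < cross (pt R b') (pt R c') z -> 0 < cross (pt R c') (pt R a') z -> cross (pt R a') (pt R b') z = 0 ->
  crossz a b a' = 0 -> crossz a b b' = 0 -> (a' = a /\ b' = b) \/ (a' = b /\ b' = a).
Proof.
move=> e e' l1 l2 l3 k1 k2 k3 ea eb.
have on v : crossz a b v = 0 -> [/\ cross (pt R c) (pt R a) (pt R v) = (crossz c a v)%:~R,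
    (pt R v).1 = (pt R a).1 + (crossz c a v)%:~R * ((pt R b).1 - (pt R a).1)
    & (pt R v).2 = (pt R a).2 + (crossz c a v)%:~R * ((pt R b).2 - (pt R a).2)].
  move=> ev; have [x y] := cross_bary (pt R a) (pt R b) (pt R c) (pt R v).
  have := cross_sum (pt R a) (pt R b) (pt R c) (pt R v).
  move: x y; rewrite (ccw_cross R e) !(cross_pt R) ev !mul0r !addr0 !mulr1 => x y.
  move=> f; have {}f : (crossz b c v)%:~R = 1 - (crossz c a v)%:~R :> R by lra.
  by split=> //; rewrite -?x -?y f; ring.
have [xa1 xa2 xa3] := on _ ea; have [xb1 xb2 xb3] := on _ eb.
set k := crossz c a a' in xa1 xa2 xa3; set k' := crossz c a b' in xb1 xb2 xb3.
pose w := ((pt R b).1 - (pt R a).1) * ((pt R c').2 - (pt R a').2) - ((pt R b).2 - (pt R a).2) * ((pt R c').1 - (pt R a').1).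
pose wz : int := ((b.1 : nat)%:Z - (a.1 : nat)%:Z) * ((c'.2 : nat)%:Z - (a'.2 : nat)%:Z)
  - ((b.2 : nat)%:Z - (a.2 : nat)%:Z) * ((c'.1 : nat)%:Z - (a'.1 : nat)%:Z).
have wE : w = wz%:~R by rewrite /w /wz /pt /px /py /= intrB !intrM !intrB.
have kw : (k' - k) * wz = 1.
  apply: (@intr_inj R); rewrite intrM intrB -wE -[RHS](ccw_cross R e') /w /cross xb2 xb3 xa2 xa3; ring.
have kk : k' - k = 1 \/ k' - k = -1.
  move: (k' - k) wz kw {wE} => x y xy.
  have x1 : x <= 1 by rewrite leNgt; apply/negP => ?; have [?|?] := leP y 0; nia.
  have x2 : -1 <= x by rewrite leNgt; apply/negP => ?; have [?|?] := leP 0 y; nia.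
  have x0 : x != 0 by apply/eqP => x0; move: xy; rewrite x0 mul0r.
  by lia.
(* the coordinate of z along ab is a convex combination of k and k' *)
have zk : cross (pt R c) (pt R a) z = cross (pt R b') (pt R c') z * k%:~R + cross (pt R c') (pt R a') z * k'%:~R.
  have [x y] := cross_bary (pt R a') (pt R b') (pt R c') z.
  have := cross_sum (pt R a') (pt R b') (pt R c') z.
  move: x y; rewrite k3 (ccw_cross R e') !mul0r !addr0 !mulr1 -xa1 -xb1.
  set A := cross _ _ z; set B := cross _ _ z => x y S.
  rewrite /cross -x -y; have -> : A = 1 - B by lra.
  ring.
have S1 := cross_sum (pt R a) (pt R b) (pt R c) z; rewrite l3 (ccw_cross R e) in S1.
have S2 := cross_sum (pt R a') (pt R b') (pt R c') z; rewrite k3 (ccw_cross R e') in S2.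
have c0 : 0 < cross (pt R c) (pt R a) z < 1 by apply/andP; split=> //; lra.
have fin : k = 0 /\ k' = 1 \/ k = 1 /\ k' = 0.
  have kk' : k'%:~R = (k%:~R + 1 : R) \/ k'%:~R = (k%:~R - 1 : R).
    by case: kk => h; [left|right]; rewrite -[1]/(1%:~R) -?intrD -?intrB; congr (_%:~R); lia.
  have ub : (k%:~R < 2%:~R :> R) && ((-1)%:~R < k%:~R :> R).
    by move/andP: c0; rewrite zk => -[c1 c2]; apply/andP; split; case: kk' => h; rewrite h in c1 c2; nra.
  have ub' : (k'%:~R < 2%:~R :> R) && ((-1)%:~R < k'%:~R :> R).
    by move/andP: c0; rewrite zk => -[c1 c2]; apply/andP; split; case: kk' => h; rewrite h in c1 c2 *; nra.
  by move: ub ub'; rewrite !ltr_int; lia.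
case: fin => -[ek ek']; rewrite ek in xa2 xa3; rewrite ek' in xb2 xb3.
  by left; split; apply: (@pt_inj R); rewrite [LHS]surjective_pairing [RHS]surjective_pairing; congr pair; rewrite ?xa2 ?xa3 ?xb2 ?xb3; ring.
by right; split; apply: (@pt_inj R); rewrite [LHS]surjective_pairing [RHS]surjective_pairing; congr pair; rewrite ?xa2 ?xa3 ?xb2 ?xb3; ring.
Qed.

(** Unless z is a vertex, each triangle looks near z like the plane or a half plane. A direction
    entering both would make the triangles overlap. Hence they are two opposite half planes, z lies
    on a side of each, the sides are collinear, and then they are equal. *)
Lemma exact_faces reg T s t z : exact reg T -> s \in T -> t \in T -> s != t ->
  hull s z -> hull t z -> hull (s :&: t) z.
Proof.
move=> ex sT tT st hs ht; have us := ex.1 _ sT; have ut := ex.1 _ tT.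
have lat v : z = pt R v -> hull (s :&: t) z.
  by move=> e; rewrite e in hs ht *; apply: hull_mem; rewrite inE !(lattice_in_hull (R := R)).
have [[v _ /lat //]|[a [b [c [sE e [l1 l2 l3]]]]]] := hull_cases us hs.
have [[v _ /lat //]|[a' [b' [c' [tE e' [k1 k2 k3]]]]]] := hull_cases ut ht.
have good (v : R * R) : inward z v (line (pt R a) (pt R b)) -> inward z v (line (pt R a') (pt R b')) ->
    (v.1 != 0) || (v.2 != 0) -> hull (s :&: t) z.
  move=> i1 i2 v0; case/eqP: st; apply: (exact_overlap (u := z) (v := v) ex) => //.
    by exists a, b, c; split=> //; split=> //; rewrite /inward line_at ?l1 ?l2.
  by exists a', b', c'; split=> //; split=> //; rewrite /inward line_at ?k1 ?k2.
have d := line_nz e; have d' := line_nz e'.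
move: l3; rewrite le0r => /orP[/eqP l3|l3]; last first.
  apply: (good (line (pt R a') (pt R b')).1); last exact: dir_neq0 d'.
    by rewrite /inward line_at l3.
  by rewrite /inward line_at d' andbT orbC -le0r.
move: k3; rewrite le0r => /orP[/eqP k3|k3]; last first.
  apply: (good (line (pt R a) (pt R b)).1); last exact: dir_neq0 d.
    by rewrite /inward line_at d l3 eqxx orbT.
  by rewrite /inward line_at k3.
have inw (v : R * R) (x y : grid m n) : cross (pt R x) (pt R y) z = 0 -> 0 < form_dir (line (pt R x) (pt R y)) v ->
    inward z v (line (pt R x) (pt R y)).
  by move=> h1 h2; rewrite /inward line_at h1 eqxx h2 orbT.
set L := line (pt R a) (pt R b) in d; set L' := line (pt R a') (pt R b') in d'.
have [D0|D0] := eqVneq (L.1.1 * L'.1.2 - L'.1.1 * L.1.2) 0; last first.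
  (* By Cramer's rule both forms grow with slope 1 along v. *)
  pose v : R * R := ((L'.1.2 - L.1.2) / (L.1.1 * L'.1.2 - L'.1.1 * L.1.2), (L.1.1 - L'.1.1) / (L.1.1 * L'.1.2 - L'.1.1 * L.1.2)).
  have v1 : form_dir L v = 1 by rewrite /form_dir /v /=; field.
  have v2 : form_dir L' v = 1 by rewrite /form_dir /v /=; field.
  by apply: (good v); [apply: inw; rewrite ?v1|apply: inw; rewrite ?v2|apply: (@dir_neq0 L); rewrite v1].
have [pos|neg] := ltP 0 (form_dir L' L.1).
  by apply: (good L.1); [apply: inw|apply: inw|apply: (dir_neq0 d)].
have [ea eb] : crossz a b a' = 0 /\ crossz a b b' = 0.
  have key v : cross (pt R a') (pt R b') (pt R v) = 0 -> crossz a b v = 0.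
    move=> ev; apply: (@intr_inj R); rewrite -cross_pt mulr0z.
    rewrite -!line_at -/L -/L' in ev l3 k3 *; move: D0 d' ev l3 k3; rewrite /form_at /form_dir.
    set A := L.1.1; set B := L.1.2; set A' := L'.1.1; set B' := L'.1.2 => D0 d' ev l3 k3.
    have f1 : A' * ((pt R v).1 - z.1) + B' * ((pt R v).2 - z.2) = 0 by lra.
    suff f2 : A * ((pt R v).1 - z.1) + B * ((pt R v).2 - z.2) = 0 by lra.
    have : (A' * A' + B' * B') * (A * ((pt R v).1 - z.1) + B * ((pt R v).2 - z.2)) = 0.
      rewrite -[RHS](_ : (A * A' + B * B') * (A' * ((pt R v).1 - z.1) + B' * ((pt R v).2 - z.2)) +
        (A * B' - A' * B) * (B' * ((pt R v).1 - z.1) - A' * ((pt R v).2 - z.2)) = 0); first by ring.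
      by rewrite f1 D0 mulr0 mul0r addr0.
    by move/eqP; rewrite mulf_eq0 (gt_eqF d') /= => /eqP.
  by have [h1 h2] := crossaa (pt R a') (pt R b'); split; apply: key.
have S := cross_sum (pt R a) (pt R b) (pt R c) z; rewrite l3 (ccw_cross R e) in S.
have k01 : 0 <= cross (pt R c) (pt R a) z <= 1 by apply/andP; split; lra.
have [x y] := cross_bary (pt R a) (pt R b) (pt R c) z.
move: x y; rewrite l3 (ccw_cross R e) !mul0r !addr0 !mulr1 => x y.
have zE : z = ((1 - cross (pt R c) (pt R a) z) * (pt R a).1 + cross (pt R c) (pt R a) z * (pt R b).1,
    (1 - cross (pt R c) (pt R a) z) * (pt R a).2 + cross (pt R c) (pt R a) z * (pt R b).2).
  by rewrite [LHS]surjective_pairing -x -y; congr (_ * _ + _, _ * _ + _); lra.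
have [ai bi] : a \in s :&: t /\ b \in s :&: t.
  rewrite !inE sE tE !inE !eqxx ?orbT /=.
  by have [[-> ->]|[-> ->]] := collinear_edges e e' l1 l2 l3 k1 k2 k3 ea eb; rewrite !eqxx ?orbT.
by rewrite zE; apply: hull_seg.
Qed.

Hypotheses (m0 : (0 < m)%N) (n0 : (0 < n)%N).

(** From z one moves a little towards the centre of the rectangle, or horizontally if z is the
    centre, to a generic point. The triangle found there contains z as well, since hulls are
    closed. *)
Lemma exact_cover T z : exact (fun=> true) T -> rectangle m n z -> exists2 t, t \in T & hull t z.
Proof.
move=> [uT ex] [/andP[x0 x1] /andP[y0 y1]].
have mp : 0 < m%:R :> R by rewrite ltr0n.
have np : 0 < n%:R :> R by rewrite ltr0n.
pose w : R * R := (m%:R / 2 - z.1, n%:R / 2 - z.2).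
pose v : R * R := if (w.1 != 0) || (w.2 != 0) then w else (1, 0).
pose F : seq (R * R * R) := [:: (1, 0, 0); (-1, 0, m%:R); (0, 1, 0); (0, -1, n%:R)].
have v0 : (v.1 != 0) || (v.2 != 0) by rewrite /v; case: ifP => //; rewrite /= oner_eq0.
have [L|z' [gz zF near]] := generic_germ m n v0 (u := z) (F := F).
  rewrite /v; case: ifPn => [_|].
    by rewrite !inE => /or4P[]/eqP->; apply: inwardI; rewrite /form_at /form_dir /w /=; lra.
  rewrite -negb_and negbK => /andP[/eqP w1 /eqP w2]; rewrite /w /= in w1 w2.
  by rewrite !inE => /or4P[]/eqP->; rewrite /inward /form_at /=; apply/orP; left; lra.
have rz' : rectangle m n z'.
  have := zF (1, 0, 0); have := zF (-1, 0, m%:R); have := zF (0, 1, 0); have := zF (0, -1, n%:R).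
  rewrite !inE !eqxx ?orbT /form_at /= => /(_ isT) a1 /(_ isT) a2 /(_ isT) a3 /(_ isT) a4.
  by split; apply/andP; split; lra.
have : (0 < cnt T z')%N by rewrite ex.
by move/cnt_gt0 => [t tT tz]; exists t => //; apply: hull_near tz near; apply: uT.
Qed.

(** If a generic point lies in two triangles of a triangulation, their intersection is a face
    containing it, hence all of either triangle. The hulls then agree, and so do the vertices, being
    the only lattice points in them. *)
Lemma triangulation_exact T : unimodular_triangulation R T <-> exact (fun=> true) T.
Proof.
split=> [[uT cov fT]|ex].
  split=> [t /uT /unimodular_triangleE //|z gz rz].
  have : (\bigcup_(s in [set s | s \in T]%classic) hull s)%classic z by rewrite cov.
  move=> [t /= tT tz].
  have -> : cnt T z = #|[set t]|; last by rewrite cards1.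
  apply: eq_card => s; rewrite !inE; apply/andP/eqP => [[sT /asboolP sz]|->]; last by split=> //; apply/asboolP.
  have [[u us eu] [u' ut eu']] := fT s t sT tT.
  have hz : (hull s `&` hull t)%classic z by [].
  have us' : unimod s by apply/(unimodular_triangleE R); apply: uT.
  have ut' : unimod t by apply/(unimodular_triangleE R); apply: uT.
  have ue := generic_face us' us gz; rewrite -eu in ue.
  have ue' := generic_face ut' ut gz; rewrite -eu' in ue'.
  have E : hull s = hull t :> set (R * R) by rewrite -{1}(ue hz) -{1}(ue' hz) -eu -eu'.
  apply/eqP; rewrite eqEsubset; apply/andP; split; apply/subsetP => v vs.
    by apply: (lattice_in_hull (R := R) ut'); rewrite -E; apply: hull_mem.
  by apply: (lattice_in_hull (R := R) us'); rewrite E; apply: hull_mem.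
split=> [s sT|| s t sT tT].
- by apply/unimodular_triangleE; apply: ex.1.
- apply/seteqP; split=> [z [s sT sz]|z rz]; first exact: hull_rectangle sz.
  by have [t tT tz] := exact_cover ex rz; exists t.
have [<-|st] := eqVneq s t.
  by rewrite classical_sets.setIid; split; exists s.
have E : (hull s `&` hull t)%classic = hull (s :&: t) :> set (R * R).
  apply/seteqP; split=> [z [sz tz]|z [w [w0 w1 e1 e2]]]; first exact: exact_faces ex sT tT st sz tz.
  have sub (x : {set grid m n}) : s :&: t \subset x -> hull x z.
    move=> sx; exists (fun v => if v \in s :&: t then w v else 0).
    have S (f : grid m n -> R) : \sum_(v in x) (if v \in s :&: t then w v else 0) * f v = \sum_(v in s :&: t) w v * f v.
      rewrite [RHS]big_mkcond [LHS]big_mkcond /=; apply: eq_bigr => v _.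
      by have := subsetP sx v; case: (v \in s :&: t) => [/(_ isT) ->|_] //; case: ifP; rewrite ?mul0r.
    split=> [v _|||]; rewrite ?S //; first by case: ifP => // /w0.
    rewrite -w1 (eq_bigr (fun v => (if v \in s :&: t then w v else 0) * 1)).
      by rewrite S; apply: eq_bigr => v _; rewrite mulr1.
    by move=> v _; rewrite mulr1.
  by split; apply: sub; rewrite ?subsetIl ?subsetIr.
by rewrite E; split; exists (s :&: t); rewrite ?subsetIl ?subsetIr.
Qed.

End ExactCover.

(** * Monotone lattice paths *)

Section Consecutive.
Variable m : nat.
Implicit Types (g : 'I_m.+1 -> nat) (i j k l : 'I_m.+1).

(** A positive g i means that column i carries a vertex of the path; consecutive columns are then
    the ends of an edge. It is phrased for any function g so that it applies both to paths and to
    the digits of a code. *)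
Definition consecutive g i k :=
  [&& (0 < g i)%N, (0 < g k)%N, (i < k)%N & [forall j : 'I_m.+1, (i < j < k)%N ==> (g j == 0%N)]].

Lemma consecutiveP g i k : reflect
  [/\ (0 < g i)%N, (0 < g k)%N, (i < k)%N & forall j, (i < j)%N -> (j < k)%N -> g j = 0%N]
  (consecutive g i k).
Proof.
apply: (iffP and4P) => -[gi gk ik h]; split=> //.
  by move=> j ij jk; apply/eqP; have := forallP h j; rewrite ij jk.
by apply/forallP => j; apply/implyP => /andP[ij jk]; apply/eqP/h.
Qed.

Lemma consecutive_uniq g i k i' k' : consecutive g i k -> consecutive g i' k' ->
  (i < k')%N -> (i' < k)%N -> i = i' /\ k = k'.
Proof.
move=> /consecutiveP[gi gk ik h] /consecutiveP[gi' gk' ik' h'] l1 l2.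
have := h i'; have := h' i; have := h k'; have := h' k => n1 n2 n3 n4.
by split; apply: val_inj => /=; lia.
Qed.

Lemma consecutive_next g i l : (0 < g i)%N -> (0 < g l)%N -> (i < l)%N -> exists k, consecutive g i k.
Proof.
move=> gi gl il; pose P k := (i < k)%N && (0 < g k)%N.
have Pl : P l by rewrite /P il.
case: (@arg_minnP _ l P (fun k => k) Pl) => k /andP[ik gk] kmin; exists k; apply/consecutiveP; split=> // j ij jk.
by have := kmin j; rewrite /P; lia.
Qed.

Lemma consecutive_prev g l k : (0 < g k)%N -> (0 < g l)%N -> (l < k)%N -> exists i, consecutive g i k.
Proof.
move=> gk gl lk; pose P i := (i < k)%N && (0 < g i)%N.
have Pl : P l by rewrite /P lk.
case: (@arg_maxnP _ l P (fun k => k) Pl) => i /andP[ik gi] imax; exists i; apply/consecutiveP; split=> // j ij jk.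
by have := imax j; rewrite /P; lia.
Qed.

Lemma eq_consecutive g g' i k : (forall j, (0 < g j)%N = (0 < g' j)%N) ->
  consecutive g i k = consecutive g' i k.
Proof.
move=> e; apply/consecutiveP/consecutiveP => -[gi gk ik h]; split=> //.
- by rewrite -e.
- by rewrite -e.
- by move=> j ij jk; have := h j ij jk; have := e j; lia.
- by rewrite e.
- by rewrite e.
- by move=> j ij jk; have := h j ij jk; have := e j; lia.
Qed.

Lemma consecutive_change g g' i k : (forall j, (i <= j <= k)%N -> g j = g' j) ->
  consecutive g i k -> consecutive g' i k.
Proof.
move=> e /consecutiveP[gi gk ik h]; apply/consecutiveP; split=> //.
- by rewrite -e //; lia.
- by rewrite -e //; lia.
- by move=> j ij jk; rewrite -e ?h //; lia.
Qed.

End Consecutive.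

Lemma sum_nat1 (I : finType) (P : pred I) (i : I) :
  P i -> (forall j : I, P j -> j = i) -> (\sum_(j : I) P j = 1)%N.
Proof.
move=> Pi uniq; rewrite (bigD1 i) //= Pi big1 // => j ji.
by case Pj : (P j) => //; rewrite (uniq _ Pj) eqxx in ji.
Qed.

(** * Moves as arithmetic formulas *)

Section MoveFormula.
Variable m : nat.
Implicit Types (g : 'I_m.+1 -> nat) (i j k l : 'I_m.+1).

Definition agree_off g g' j := [forall l, (l != j) ==> (g' l == g l)].

(* The triangle i j k is positively oriented of area 1/2; all terms of the
   determinant are moved to their positive side. *)
Definition ccw_area g i j k :=
  ((j - i) * g k + (k - i) * g i == (j - i) * g i + (k - i) * g j + 1)%N.

Definition neighbour i l : bool := (l.+1 == i :> nat) || (l == i.+1 :> nat).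

Definition insert_formula g g' i j k :=
  [&& consecutive g i k, (i < j)%N, (j < k)%N, (0 < g' j)%N, agree_off g g' j & ccw_area g' i j k].

Definition delete_formula g g' i j k :=
  [&& consecutive g' i k, (i < j)%N, (j < k)%N, (0 < g j)%N, agree_off g' g j & ccw_area g i k j].

Definition lower_formula g g' j :=
  [&& (0 < g' j)%N, g j == (g' j + 1)%N, agree_off g g' j & [forall l, neighbour j l ==> (0 < g l)%N]].

Definition bottom_formula g := [forall l, g l == 1%N].

(** The disjuncts are: pass column K without a move, insert a vertex, delete one, lower one. Only
    comparisons of numbers occur, so that the whole can be evaluated by an expression. *)
Definition peel_formula g (K : nat) g' (K' : nat) :=
  [|| [&& (K < m)%N, [forall l, g' l == g l] & K' == (K + 1)%N],
      [exists i : 'I_m.+1, exists j : 'I_m.+1, exists k : 'I_m.+1, [&& K == i, K' == i & insert_formula g g' i j k]],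
      [exists i : 'I_m.+1, exists j : 'I_m.+1, exists k : 'I_m.+1, [&& K == j, K' == i & delete_formula g g' i j k]]
    | [exists j : 'I_m.+1, [&& K == j, K' == j.-1 & lower_formula g g' j]]].

End MoveFormula.

(** * The strip over one edge *)

Section Wedges.
Variable R : realType.
Implicit Types a b c z : R * R.

Definition inside a b c z := [&& 0 < cross b c z, 0 < cross c a z & 0 < cross a b z].

Lemma nlt0_gt0 (x : R) : x != 0 -> (x < 0) = ~~ (0 < x).
Proof. by move=> x0; rewrite -leNgt lt_neqAle x0. Qed.

Lemma cross_interp a b c z : cross a b c = 1 ->
  z.1 = cross b c z * a.1 + cross c a z * b.1 + cross a b z * c.1.
Proof. by move=> e; have [x _] := cross_bary a b c z; rewrite x e mulr1. Qed.

(** The wedge lemmas are the moves seen in one vertical strip. Here the apex p lies below the edge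
    ac and between its ends. In all four, z.1 expressed by the barycentric coordinates excludes the
    sign patterns that would violate the identity. *)
Lemma wedge_low a p c z : a.1 < p.1 < c.1 -> cross a p c = 1 -> a.1 < z.1 < c.1 ->
  cross a p z != 0 -> cross p c z != 0 -> cross a c z != 0 ->
  nat_of_bool (cross a c z < 0) =
  ((if z.1 < p.1 then cross a p z < 0 else cross p c z < 0)%R + inside a p c z)%N.
Proof.
move=> /andP[ap pc] e /andP[az zc] n1 n2 n3; have := cross_interp z e; have := cross_sum a p c z; rewrite e.
rewrite /inside [cross c a z]cross_opp !oppr_gt0 !nlt0_gt0 //.
move: n1 n2 n3; set A := cross p c z; set C := cross a p z; set B := cross a c z => n1 n2 n3 s x.
have zE : z.1 = (1 + B - C) * a.1 - B * p.1 + C * c.1 by rewrite x; (have -> : A = 1 + B - C by lra); ring.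
case: (ltP z.1 p.1) => zp.
- have CA : 0 < C -> 0 < A by move=> ?; rewrite ltNge; apply/negP => ?; nra.
  have BC : C < 0 -> B < 0 by move=> ?; rewrite ltNge; apply/negP => ?; nra.
  case: (ltgtP C 0) n1 => // C0 _; case: (ltgtP B 0) n3 => // B0 _ /=; rewrite ?andbF ?andbT //.
    by exfalso; have := BC C0; lra.
  by rewrite CA.
- have AC : 0 < A -> 0 < C by move=> ?; rewrite ltNge; apply/negP => ?; nra.
  have BA : A < 0 -> B < 0 by move=> ?; rewrite ltNge; apply/negP => ?; nra.
  case: (ltgtP A 0) n2 => // A0 _; case: (ltgtP B 0) n3 => // B0 _ /=; rewrite ?andbF ?andbT //.
    by exfalso; have := BA A0; lra.
  by rewrite AC.
Qed.

(** The apex b lies above ac: two edges of the path with a common triangle. *)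
Lemma wedge_high a b c z : a.1 < b.1 < c.1 -> cross a c b = 1 -> a.1 < z.1 < c.1 ->
  cross a b z != 0 -> cross b c z != 0 -> cross a c z != 0 ->
  nat_of_bool (if z.1 < b.1 then cross a b z < 0 else cross b c z < 0) =
  ((cross a c z < 0)%R + inside a c b z)%N.
Proof.
move=> /andP[ab bc] e /andP[az zc] n1 n2 n3; have := cross_interp z e; have := cross_sum a c b z; rewrite e.
rewrite /inside [cross c b z]cross_opp [cross b a z]cross_opp !oppr_gt0 !nlt0_gt0 //.
move: n1 n2 n3; set A := cross b c z; set C := cross a b z; set B := cross a c z => n1 n2 n3 s x.
have zE : z.1 = (1 + C - B) * a.1 - C * c.1 + B * b.1 by rewrite x; (have -> : - A = 1 + C - B by lra); ring.
case: (ltP z.1 b.1) => zp.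
- have CA : C < 0 -> 0 < B -> A < 0 by move=> *; rewrite ltNge; apply/negP => ?; nra.
  have BC : 0 < C -> 0 < B by move=> ?; rewrite ltNge; apply/negP => ?; nra.
  case: (ltgtP C 0) n1 => // C0 _; case: (ltgtP B 0) n3 => // B0 _ /=; rewrite ?andbF ?andbT //.
    by rewrite lt_gtF // CA.
  by exfalso; have := BC C0; lra.
- have CA : A < 0 -> 0 < B -> C < 0 by move=> *; rewrite ltNge; apply/negP => ?; nra.
  have BC : 0 < A -> 0 < B by move=> ?; rewrite ltNge; apply/negP => ?; nra.
  case: (ltgtP A 0) n2 => // C0 _; case: (ltgtP B 0) n3 => // B0 _ /=; rewrite ?andbF ?andbT //.
    by rewrite lt_gtF // CA.
  by exfalso; have := BC C0; lra.
Qed.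

(** The right end b of the edge is lowered to p, so the triangle has a vertical side. *)
Lemma wedge_left a p b z : a.1 < b.1 -> p.1 = b.1 -> cross a p b = 1 -> a.1 < z.1 < b.1 ->
  cross a p z != 0 -> cross a b z != 0 ->
  nat_of_bool (cross a b z < 0) = ((cross a p z < 0)%R + inside a p b z)%N.
Proof.
move=> ab pb e /andP[az zb] n1 n2; have := cross_interp z e; have := cross_sum a p b z; rewrite e.
rewrite /inside [cross b a z]cross_opp !oppr_gt0 !nlt0_gt0 //.
move: n1 n2; set A := cross p b z; set C := cross a p z; set B := cross a b z => n1 n2 s x.
have zE : z.1 = (1 + B - C) * a.1 + (C - B) * b.1 by rewrite x pb; (have -> : A = 1 + B - C by lra); ring.
have A0 : 0 < A by nra.
rewrite A0 /=; case: (ltgtP C 0) n1 => // C0 _; case: (ltgtP B 0) n2 => // B0 _ /=; exfalso; nra.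
Qed.

Lemma wedge_right p c b z : b.1 < c.1 -> p.1 = b.1 -> cross p c b = 1 -> b.1 < z.1 < c.1 ->
  cross p c z != 0 -> cross b c z != 0 ->
  nat_of_bool (cross b c z < 0) = ((cross p c z < 0)%R + inside p c b z)%N.
Proof.
move=> bc pb e /andP[bz zc] n1 n2; have := cross_interp z e; have := cross_sum p c b z; rewrite e.
rewrite /inside [cross c b z]cross_opp !oppr_gt0 !nlt0_gt0 //.
move: n1 n2; set A := cross b p z; set C := cross p c z; set B := cross b c z => n1 n2 s x.
have zE : z.1 = (1 - A) * b.1 + A * c.1 by rewrite x pb; (have -> : A = 1 + B - C by lra); ring.
have A0 : 0 < A by nra.
have A1 : A < 1 by nra.
rewrite A0 /=; case: (ltgtP C 0) n1 => // C0 _; case: (ltgtP B 0) n2 => // B0 _ /=; exfalso; nra.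
Qed.

End Wedges.

(** * The region below a path *)

Section Below.
Variables (R : realType) (m n : nat).
Implicit Types (h : {ffun 'I_m.+1 -> option 'I_n.+1}) (i j k l : 'I_m.+1).
Implicit Types (a b c p q r : grid m n) (z : R * R) (t : {set grid m n}) (T D : {set {set grid m n}}).

(* A path has at most one vertex in each column; level 0 means no vertex. *)
Definition level h i : nat := if h i is Some y then y.+1 else 0%N.

(** The default is the bottom point of the column; the value is meaningful only where the level is
    positive. *)
Definition vx h i : grid m n := (i, odflt ord0 (h i)).

Definition edge h i k := consecutive (level h) i k.

Definition ends h := (0 < level h ord0)%N && (0 < level h ord_max)%N.

Definition below h z : bool := [exists i, exists k,
  [&& edge h i k, i%:R < z.1, z.1 < k%:R & cross (pt R (vx h i)) (pt R (vx h k)) z < 0]].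

Lemma level_inj h h' : (forall i, level h i = level h' i) -> h = h'.
Proof.
move=> e; apply/ffunP => i; have := e i; rewrite /level.
by case: (h i) => [x|]; case: (h' i) => [y|] // [] /val_inj ->.
Qed.

Lemma level_vx h i : (0 < level h i)%N -> level h i = (vx h i).2.+1.
Proof. by rewrite /level /vx; case: (h i). Qed.

Lemma eq_vx h h' i : level h i = level h' i -> vx h i = vx h' i.
Proof. by rewrite /level /vx; case: (h i) => [x|]; case: (h' i) => [y|] // [] /val_inj ->. Qed.

Lemma edgeP h i k : reflect
  [/\ (0 < level h i)%N, (0 < level h k)%N, (i < k)%N & forall j, (i < j)%N -> (j < k)%N -> level h j = 0%N]
  (edge h i k).
Proof. exact: consecutiveP. Qed.

Lemma edge_at h i k i' k' z : edge h i k -> edge h i' k' -> i%:R < z.1 < k%:R ->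
  i'%:R < z.1 < k'%:R -> i = i' /\ k = k'.
Proof.
move=> e e' /andP[z1 z2] /andP[z3 z4]; apply: consecutive_uniq e e' _ _.
  by rewrite -(ltr_nat R); lra.
by rewrite -(ltr_nat R); lra.
Qed.

Lemma below_edge h i k z : edge h i k -> i%:R < z.1 < k%:R ->
  below h z = (cross (pt R (vx h i)) (pt R (vx h k)) z < 0).
Proof.
move=> e z1; apply/existsP/idP => [[i' /existsP[k' /and4P[e' z2 z3 c]]]|c].
  by have [|-> ->] := edge_at e e' z1; rewrite ?z2.
by exists i; apply/existsP; exists k; rewrite e c; move/andP: z1 => [-> ->].
Qed.

Hypothesis n0 : (0 < n)%N.

(** As n > 0, each column contains two lattice points, so its line is one of those that a generic
    point avoids. *)
Lemma generic_column z i : generic m n z -> z.1 != i%:R.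
Proof.
move=> /(_ (i, ord0) (i, ord_max)); rewrite /cross /pt /px /py /=.
have -> : ((i, ord0) != (i, ord_max) :> grid m n).
  by apply/eqP => -[]; lia.
by move=> /(_ isT); apply: contraNneq => ->; apply/eqP; ring.
Qed.

Lemma edge_exists h z : ends h -> generic m n z -> rectangle m n z ->
  exists i k, edge h i k /\ i%:R < z.1 < k%:R.
Proof.
move=> /andP[e0 e1] gz [/andP[z0 z1] _].
have g0 := generic_column ord0 gz; have g1 := generic_column ord_max gz.
pose P i := (i%:R < z.1) && (0 < level h i)%N; pose Q k := (z.1 < k%:R) && (0 < level h k)%N.
have P0 : P ord0 by rewrite /P e0 lt_neqAle eq_sym g0 z0.
have Q0 : Q ord_max by rewrite /Q e1 lt_neqAle g1 z1.
case: (@arg_maxnP _ ord0 P (fun k => k) P0) => i /andP[iz gi] imax.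
case: (@arg_minnP _ ord_max Q (fun k => k) Q0) => k /andP[zk gk] kmin.
exists i, k; split; last by rewrite iz zk.
apply/edgeP; split=> //; first by rewrite -(ltr_nat R); lra.
move=> j ij jk; apply/eqP; rewrite -leqn0 leqNgt; apply/negP => gj.
have := generic_column j gz; rewrite neq_lt => /orP[zj|jz].
  by have := kmin j; rewrite /Q zj gj => /(_ isT); lia.
by have := imax j; rewrite /P jz gj => /(_ isT); lia.
Qed.

Lemma hull_inside a b c z : generic m n z -> crossz a b c = 1 ->
  `[< hull (tri a b c) z >] = inside (pt R a) (pt R b) (pt R c) z.
Proof.
move=> gz e; have [ab bc ac] := ccw_neq e.
have ge p q : p != q -> (0 <= cross (pt R p) (pt R q) z) = (0 < cross (pt R p) (pt R q) z).
  by move=> /gz h; rewrite lt_neqAle eq_sym h.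
apply/asboolP/and3P => [/(hull_tri _ e)[]|[h1 h2 h3]].
  by rewrite !ge // eq_sym.
by apply/(hull_tri _ e); split; apply: ltW.
Qed.

Lemma hull_columns a b c i k z : (forall p, p \in tri a b c -> i <= p.1 <= k)%N ->
  hull (tri a b c) z -> i%:R <= z.1 <= k%:R.
Proof.
move=> h hz; apply/andP; split.
  have : 0 <= form_at (1, 0, - i%:R) z.
    apply: hull_form_ge0 hz => p /h /andP[ip _]; rewrite /form_at /pt /px /=.
    by have : i%:R <= p.1%:R :> R; [rewrite ler_nat|lra].
  by rewrite /form_at /=; lra.
have : 0 <= form_at (- 1, 0, k%:R) z.
  apply: hull_form_ge0 hz => p /h /andP[_ ip]; rewrite /form_at /pt /px /=.
  by have : p.1%:R <= k%:R :> R; [rewrite ler_nat|lra].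
by rewrite /form_at /=; lra.
Qed.

Definition splits h h' D := forall z, generic m n z -> rectangle m n z ->
  (below h z : nat) = (below h' z + cnt D z)%N.

Lemma cnt1 t z : cnt [set t] z = `[< hull t z >].
Proof.
rewrite /cnt; case: asboolP => hz.
  rewrite (_ : [set _ in _ | _] = [set t]) ?cards1 //; apply/setP => s; rewrite !inE.
  by case: eqP => // ->; apply/asboolP.
by apply/eqP; rewrite cards_eq0; apply/eqP/setP => s; rewrite !inE; case: eqP => // ->; apply/asboolP.
Qed.

Lemma cnt0 z D : (forall t, t \in D -> ~ hull t z) -> cnt D z = 0%N.
Proof.
move=> h; apply/eqP; rewrite cards_eq0; apply/eqP/setP => s; rewrite !inE.
by apply/andP => -[/h sD /asboolP].
Qed.

Lemma cntU T D z : [disjoint T & D] -> cnt (T :|: D) z = (cnt T z + cnt D z)%N.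
Proof.
move=> /setDidPl dTD; rewrite /cnt -cardsUI [X in (_ = _ + X)%N](_ : _ = 0%N); last first.
  apply/eqP; rewrite cards_eq0; apply/eqP/setP => s; rewrite !inE -dTD !inE.
  by case: (s \in D); rewrite ?andbF.
by rewrite addn0; congr #|pred_of_set _|; apply/setP => s; rewrite !inE andb_orl.
Qed.

(** A triangle common to T and D would contain a generic point counted twice, while the region below
    h counts every point at most once. *)
Lemma exact_add h h' D T : splits h h' D -> (forall t, t \in D -> unimod t) ->
  exact (below h') T -> [disjoint T & D] /\ exact (below h) (T :|: D).
Proof.
clear n0.
move=> sp uD [uT ex].
have dis : [disjoint T & D].
  apply/pred0P => t /=; apply/negP => /andP[tT tD]; have [z gz tz] := unimod_generic R (uT _ tT).
  have rz := hull_rectangle tz; have c1 : (0 < cnt T z)%N by apply/cnt_gt0; exists t.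
  have c2 : (0 < cnt D z)%N by apply/cnt_gt0; exists t.
  by have := sp z gz rz; rewrite -ex //; move: c1 c2; case: (below h z) => /=; lia.
split=> //; split=> [t|z gz rz]; first by rewrite inE => /orP[/uT|/uD].
by rewrite cntU // ex // sp.
Qed.

Lemma exact_sub h h' D T : splits h h' D -> exact (below h) T -> D \subset T ->
  exact (below h') (T :\: D).
Proof.
move=> sp [uT ex] DT; split=> [t|z gz rz]; first by rewrite inE => /andP[_ /uT].
have := ex z gz rz; rewrite -{1}(setID T D) (setIidPr DT) setUC cntU ?sp //.
  by move/addIn.
by apply/pred0P => t /=; rewrite inE; case: (t \in D); rewrite ?andbF.
Qed.

(** h' is h with an additional vertex in column j. Insertions use this as it stands, deletions with
    the two paths exchanged. *)
Definition refines h h' i j k := [/\ edge h i k, (i < j < k)%N, (0 < level h' j)%N &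
  forall l, l != j -> level h' l = level h l].

Lemma refines_edges h h' i j k : refines h h' i j k -> edge h' i j /\ edge h' j k.
Proof.
clear n0.
move=> [/edgeP[hi hk ik e] /andP[ij jk] hj ag].
have ni : i != j by rewrite -(inj_eq val_inj) /=; lia.
have nk : k != j by rewrite -(inj_eq val_inj) /=; lia.
split; apply/edgeP; rewrite ?(ag i ni) ?(ag k nk); split=> // l l1 l2; rewrite ag ?e //; try lia;
  by rewrite -(inj_eq val_inj) /=; lia.
Qed.

Lemma refines_other h h' i j k (p q : 'I_m.+1) : refines h h' i j k -> edge h p q -> p != i -> edge h' p q.
Proof.
clear n0.
move=> [eik /andP[ij jk] hj ag] epq pi; apply: consecutive_change (epq) => l lpq; rewrite ag //.
apply: contraNneq pi => lj; subst l; apply/eqP/esym.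
by apply: (consecutive_uniq eik epq _ _).1; lia.
Qed.

Lemma refines_below h h' i j k z : refines h h' i j k -> i%:R < z.1 < k%:R -> generic m n z ->
  below h z = (cross (pt R (vx h' i)) (pt R (vx h' k)) z < 0) /\
  below h' z = if z.1 < j%:R then cross (pt R (vx h' i)) (pt R (vx h' j)) z < 0
     else cross (pt R (vx h' j)) (pt R (vx h' k)) z < 0.
Proof.
move=> rf zik gz; have [eij ejk] := refines_edges rf; have [eik /andP[ij jk] hj ag] := rf.
have ni : i != j by rewrite -(inj_eq val_inj) /=; lia.
have nk : k != j by rewrite -(inj_eq val_inj) /=; lia.
split; first by rewrite (below_edge eik zik) !(@eq_vx h h') // ag.
have := generic_column j gz; move/andP: zik => [iz zk].
by case: ltgtP => // zj _; [apply: below_edge eij _|apply: below_edge ejk _]; rewrite ?iz ?zj.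
Qed.

Lemma refines_outside h h' i j k z : ends h -> refines h h' i j k -> generic m n z -> rectangle m n z ->
  ~~ (i%:R < z.1 < k%:R) -> below h z = below h' z.
Proof.
move=> eh rf gz rz nz; have [p [q [epq zpq]]] := edge_exists eh gz rz.
have pi : p != i.
  apply: contra nz => /eqP pi; subst p; have [eik _ _ _] := rf.
  have /edgeP[_ _ iq _] := epq; have /edgeP[_ _ ik _] := eik.
  by have [|| _ ->] := consecutive_uniq eik epq; rewrite ?iq ?ik.
have e' := refines_other rf epq pi; rewrite (below_edge epq zpq) (below_edge e' zpq).
have [_ _ _ ag] := rf; have /edgeP[lp lq pq _] := epq.
have [eik /andP[ij jk] _ _] := rf.
have nj (l : 'I_m.+1) : l = p \/ l = q -> l != j.
  move=> lpq; apply: contraNneq pi => lj; apply/eqP/esym; subst l.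
  by apply: (consecutive_uniq eik epq _ _).1; case: lpq => jE; rewrite jE in ij jk; lia.
have -> : vx h p = vx h' p by apply: eq_vx; rewrite ag //; apply: nj; left.
by have -> : vx h q = vx h' q by apply: eq_vx; rewrite ag //; apply: nj; right.
Qed.

Lemma tri_outside a b c i k z : (forall p, p \in tri a b c -> i <= p.1 <= k)%N ->
  generic m n z -> ~~ (i%:R < z.1 < k%:R) -> ~ hull (tri a b c) z.
Proof.
move=> h gz nz /(hull_columns h)/andP[a1 a2]; move: nz.
by rewrite !lt_neqAle a1 a2 !andbT [_ == z.1]eq_sym !generic_column.
Qed.

Lemma mem_tri a b c p : (p \in tri a b c) = [|| p == a, p == b | p == c].
Proof. by rewrite !inE orbA. Qed.

Lemma splits_insert h h' i j k : ends h -> refines h h' i j k ->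
  crossz (vx h' i) (vx h' j) (vx h' k) = 1 ->
  splits h h' [set tri (vx h' i) (vx h' j) (vx h' k)].
Proof.
move=> eh rf e z gz rz; rewrite cnt1; have [eik ijk _ _] := rf.
have [zik|zik] := boolP (i%:R < z.1 < k%:R); last first.
  rewrite (refines_outside eh rf gz rz zik) (asboolF (P := hull _ z)) ?addn0 //.
  by apply: tri_outside gz zik => p; rewrite mem_tri => /or3P[]/eqP-> /=; lia.
have [b1 b2] := refines_below rf zik gz; have [ij jk ik] := ccw_neq e.
rewrite hull_inside // b1 b2 (wedge_low (p := pt R (vx h' j))) ?(ccw_cross R e) ?gz //.
by rewrite /pt /px /= !ltr_nat.
Qed.

Lemma splits_delete h h' i j k : ends h' -> refines h' h i j k ->
  crossz (vx h i) (vx h k) (vx h j) = 1 ->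
  splits h h' [set tri (vx h i) (vx h k) (vx h j)].
Proof.
move=> eh rf e z gz rz; rewrite cnt1; have [eik ijk _ _] := rf.
have [zik|zik] := boolP (i%:R < z.1 < k%:R); last first.
  rewrite -(refines_outside eh rf gz rz zik) (asboolF (P := hull _ z)) ?addn0 //.
  by apply: tri_outside gz zik => p; rewrite mem_tri => /or3P[]/eqP-> /=; lia.
have [b1 b2] := refines_below rf zik gz; have [ik kj ij] := ccw_neq e.
rewrite eq_sym in kj.
rewrite hull_inside // b1 b2 -(wedge_high (b := pt R (vx h j))) ?(ccw_cross R e) ?gz //.
by rewrite /pt /px /= !ltr_nat.
Qed.

Definition lowers h h' j := [/\ (0 < level h' j)%N, level h j = (level h' j).+1,
  forall l, l != j -> level h' l = level h l & forall l, neighbour j l -> (0 < level h l)%N].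

(** The triangles share the vertical segment between the old and the new vertex. There is one of
    them in the first and in the last column, and there are two elsewhere. *)
Definition lowD h h' j : {set {set grid m n}} :=
  [set tri (vx h' j) (vx h l) (vx h j) | l : 'I_m.+1 in [pred l : 'I_m.+1 | neighbour j l]].

Lemma lowers_ccw h h' j l : lowers h h' j ->
  (l.+1 = j :> nat -> crossz (vx h l) (vx h' j) (vx h j) = 1) /\
  (l = j.+1 :> nat -> crossz (vx h' j) (vx h l) (vx h j) = 1).
Proof.
clear n0.
move=> [h'j hj _ _]; have := level_vx h'j; have : (0 < level h j)%N by rewrite hj.
move/level_vx; rewrite hj => -[e1] e2; have e : (vx h j).2 = (vx h' j).2.+1 :> nat by rewrite -e1.
rewrite /crossz e; set y := nat_of_ord (vx h' j).2; set y' := nat_of_ord (vx h l).2 => /=.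
by split=> lj; [rewrite -lj|rewrite lj]; lia.
Qed.

Lemma lowD_unimod h h' j t : lowers h h' j -> t \in lowD h h' j -> unimod t.
Proof.
move=> lw /imsetP[l]; rewrite inE => /orP[]/eqP e ->; have [c1 c2] := lowers_ccw l lw.
  by exists (vx h l), (vx h' j), (vx h j); rewrite tri_swap c1.
by exists (vx h' j), (vx h l), (vx h j); rewrite c2.
Qed.

Lemma lowers_edge h h' j i k : lowers h h' j -> edge h' i k = edge h i k.
Proof.
move=> [h'j hj ag _]; apply: eq_consecutive => l.
by have [->|/ag ->//] := eqVneq l j; rewrite h'j hj.
Qed.

Lemma cnt_lowD h h' j l z : neighbour j l ->
  (forall l', neighbour j l' -> l' != l -> ~ hull (tri (vx h' j) (vx h l') (vx h j)) z) ->
  cnt (lowD h h' j) z = `[< hull (tri (vx h' j) (vx h l) (vx h j)) z >].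
Proof.
move=> jl other; rewrite -cnt1 /cnt; apply: eq_card => t; rewrite !inE.
have [hz|] := asboolP; rewrite ?andbF ?andbT //.
apply/imsetP/eqP => [[l']|->]; last by exists l.
rewrite inE => jl' tE; subst t.
by have [->|/(other _ jl')] := eqVneq l' l.
Qed.

(** As the neighbouring columns carry vertices, the edges meeting in column j span one column each,
    and on either side the wedge with a vertical side applies. In all other strips nothing
    changes. *)
Lemma splits_lower h h' j : ends h -> lowers h h' j -> splits h h' (lowD h h' j).
Proof.
move=> eh lw z gz rz; have [i [k [eik zik]]] := edge_exists eh gz rz.
have eik' : edge h' i k by rewrite (lowers_edge _ _ lw).
rewrite (below_edge eik zik) (below_edge eik' zik).
have [h'j hj ag nb] := lw; have /edgeP[_ _ ik noik] := eik; move/andP: (zik) => [iz zk].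
have vE l : l != j -> vx h' l = vx h l by move=> lj; apply: eq_vx; rewrite ag.
have far l : ((maxn j l <= i) || (k <= minn j l))%N -> ~ hull (tri (vx h' j) (vx h l) (vx h j)) z.
  move=> c hz; have [|z1 z2] := andP (@hull_columns (vx h' j) (vx h l) (vx h j) (if (j <= l)%N then j else l) (if (j <= l)%N then l else j) z _ hz).
    by move=> p; rewrite mem_tri => /or3P[]/eqP-> /=; case: (leqP j l) => ?; lia.
  case/orP: c => c; move: z1 z2; case: (leqP j l) => jl z1 z2.
  - by have : l%:R <= i%:R :> R; [rewrite ler_nat; lia|lra].
  - by have : j%:R <= i%:R :> R; [rewrite ler_nat; lia|lra].
  - by have : k%:R <= j%:R :> R; [rewrite ler_nat; lia|lra].
  - by have : k%:R <= l%:R :> R; [rewrite ler_nat; lia|lra].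
have [ij|nij] := eqVneq i j; last first.
  have [kj|nkj] := eqVneq k j; last first.
    rewrite !vE // cnt0 ?addn0 // => t /imsetP[l]; rewrite inE => jl ->; apply: far.
    have : ~~ (i < j < k)%N by apply/negP => /andP[ij jk]; have := noik j ij jk; rewrite hj.
    move: jl nij nkj; rewrite /neighbour -!(inj_eq val_inj) /=; lia.
  have ij : i.+1 = j.
    have j0 : (j.-1 < m.+1)%N by have := ltn_ord j; lia.
    have := nb (Ordinal j0); have := noik (Ordinal j0); rewrite /neighbour /=; subst k; lia.
  have [c _] := lowers_ccw i lw; have {}c := c ij.
  rewrite (@cnt_lowD h h' j i); last 2 first.
  - by rewrite /neighbour ij eqxx.
  - by move=> l jl li; apply: far; move: jl li; rewrite /neighbour -(inj_eq val_inj) /=; subst k; lia.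
  rewrite tri_swap hull_inside // vE // kj; have [d1 d2 d3] := ccw_neq c.
  apply: wedge_left; rewrite ?(ccw_cross R c) ?gz //.
    by rewrite /pt /px /= ltr_nat -ij.
  by rewrite /pt /px /= iz -kj zk.
have kj : k = j.+1 :> nat.
  have kj : (j < k)%N by rewrite -ij.
  have j0 : (j.+1 < m.+1)%N by have := ltn_ord k; lia.
  have := nb (Ordinal j0); have := noik (Ordinal j0); rewrite /neighbour /= eqxx orbT; subst i; lia.
have [_ c] := lowers_ccw k lw; have {}c := c kj.
have nkj : k != j by rewrite -(inj_eq val_inj) /=; lia.
rewrite (@cnt_lowD h h' j k); last 2 first.
- by rewrite /neighbour kj eqxx orbT.
- by move=> l jl lk; apply: far; move: jl lk; rewrite /neighbour -(inj_eq val_inj) /=; subst i; lia.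
rewrite hull_inside // (vE k nkj) ij; have [d1 d2 d3] := ccw_neq c.
apply: wedge_right; rewrite ?(ccw_cross R c) ?gz //.
- by rewrite /pt /px /= ltr_nat kj.
- by rewrite /pt /px /= -ij iz zk.
- by rewrite eq_sym.
Qed.

End Below.

(** * Triangles below an edge *)

Section Under.
Variables (R : realType) (m n : nat).
Implicit Types (h : {ffun 'I_m.+1 -> option 'I_n.+1}) (i j k l : 'I_m.+1).
Implicit Types (a b c p q r : grid m n) (z : R * R) (t : {set grid m n}) (T D : {set {set grid m n}}).

(** Coprimality of the coordinates of c - a in Bézout form; the coefficients s and t recover the
    multiplier of any vector parallel to c - a as an integer. *)
Definition primitive a c := exists s t : int,
  ((c.1 : nat)%:Z - (a.1 : nat)%:Z) * s + ((c.2 : nat)%:Z - (a.2 : nat)%:Z) * t = 1.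

Definition midpoint a c : R * R := (((pt R a).1 + (pt R c).1) / 2, ((pt R a).2 + (pt R c).2) / 2).

(** Otherwise both coordinates of c - a would be even. *)
Lemma primitive_midpoint a c (v : grid m n) : primitive a c -> midpoint a c != pt R v.
Proof.
move=> [s [t e]]; apply/eqP => -[e1 e2].
have d1 : (a.1 + c.1 = 2 * v.1)%N.
  by apply/eqP; rewrite -(eqr_nat R) natrD natrM; apply/eqP; move: e1; rewrite /pt /px /=; lra.
have d2 : (a.2 + c.2 = 2 * v.2)%N.
  by apply/eqP; rewrite -(eqr_nat R) natrD natrM; apply/eqP; move: e2; rewrite /pt /py /=; lra.
have f1 : (c.1 : nat)%:Z - (a.1 : nat)%:Z = 2 * ((v.1 : nat)%:Z - (a.1 : nat)%:Z) by lia.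
have f2 : (c.2 : nat)%:Z - (a.2 : nat)%:Z = 2 * ((v.2 : nat)%:Z - (a.2 : nat)%:Z) by lia.
by move: e; rewrite f1 f2; lia.
Qed.

Lemma cross_mid (a c z : R * R) :
  [/\ cross a c ((a.1 + c.1) / 2, (a.2 + c.2) / 2) = 0,
   cross a z ((a.1 + c.1) / 2, (a.2 + c.2) / 2) = cross a z c / 2 &
   cross z c ((a.1 + c.1) / 2, (a.2 + c.2) / 2) = cross z c a / 2].
Proof. by rewrite /cross /=; split; field. Qed.

(* Two parallel primitive vectors x - y and c - a pointing the same way agree,
   and c is the only lattice point strictly between the midpoint of ac and its
   translate. *)
Lemma primitive_edge a c (x y w : grid m n) : primitive a c -> (a.1 < c.1)%N -> crossz x y w = 1 ->
  ((x.1 : nat)%:Z - (y.1 : nat)%:Z) * ((c.2 : nat)%:Z - (a.2 : nat)%:Z)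
    = ((x.2 : nat)%:Z - (y.2 : nat)%:Z) * ((c.1 : nat)%:Z - (a.1 : nat)%:Z) ->
  (y.1 <= x.1)%N -> 0 < cross (pt R y) (pt R w) (midpoint a c) ->
  0 < cross (pt R w) (pt R x) (midpoint a c) -> cross (pt R x) (pt R y) (midpoint a c) = 0 ->
  x = c /\ y = a.
Proof.
move=> [s [t bz]] ac e par yx A0 B0 C0; set u := midpoint a c in A0 B0 C0.
have u1 : u.1 = ((pt R a).1 + (pt R c).1) / 2 by [].
have u2 : u.2 = ((pt R a).2 + (pt R c).2) / 2 by [].
have [x1 x2] := cross_bary (pt R x) (pt R y) (pt R w) u; have S := cross_sum (pt R x) (pt R y) (pt R w) u.
rewrite C0 (ccw_cross R e) ?mul0r ?addr0 ?mulr1 in x1 x2 S.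
set A := cross _ _ _ in A0 x1 x2 S; set B := cross _ _ _ in B0 x1 x2 S.
set e1 := (c.1 : nat)%:Z - _ in bz par; set e2 := (c.2 : nat)%:Z - _ in bz par.
set d1 := (x.1 : nat)%:Z - _ in par; set d2 := (x.2 : nat)%:Z - _ in par.
pose kp := d1 * s + d2 * t.
have k1 : d1 = kp * e1.
  by rewrite -[LHS]mulr1 -bz /kp; transitivity (d1 * e1 * s + d1 * e2 * t); [|rewrite par]; ring.
have k2 : d2 = kp * e2.
  by rewrite -[LHS]mulr1 -bz /kp; transitivity (d2 * e1 * s + d2 * e2 * t); [|rewrite -par]; ring.
have kw : kp * (e2 * ((w.1 : nat)%:Z - (x.1 : nat)%:Z) - e1 * ((w.2 : nat)%:Z - (x.2 : nat)%:Z)) = 1.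
  by rewrite -e mulrBr !mulrA -k1 -k2 /crossz /d1 /d2; ring.
have e1p : 0 < e1 by rewrite /e1; lia.
have d1p : 0 <= d1 by rewrite /d1; lia.
have kp1 : kp = 1.
  have kpp : 0 < kp.
    rewrite ltNge; apply/negP => kn; have [k0|k0] := eqVneq kp 0.
      by move: kw; rewrite k0 mul0r.
    by move: d1p; rewrite k1; nia.
  by move: (_ - _) kw => N kw; have [?|?] := leP N 0; nia.
rewrite kp1 !mul1r in k1 k2.
have y1 : (pt R y).1 = (pt R x).1 - e1%:~R by rewrite -k1 /d1 intrB /pt /px /=; lra.
have y2 : (pt R y).2 = (pt R x).2 - e2%:~R by rewrite -k2 /d2 intrB /pt /py /=; lra.
have c1 : (pt R c).1 = (pt R a).1 + e1%:~R by rewrite /e1 intrB /pt /px /=; lra.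
have c2 : (pt R c).2 = (pt R a).2 + e2%:~R by rewrite /e2 intrB /pt /py /=; lra.
(* [B + 1 / 2] is the position of x on the line ac, measured from a in units of c - a. It is an
   integer by the Bézout relation and lies between 1/2 and 3/2, so it is 1. *)
have Bz : B + 1 / 2 = (((x.1 : nat)%:Z - (a.1 : nat)%:Z) * s + ((x.2 : nat)%:Z - (a.2 : nat)%:Z) * t)%:~R.
  have f1 : (pt R x).1 - (pt R a).1 = (B + 1 / 2) * e1%:~R.
    move: x1; rewrite u1 c1 y1; have -> : A = 1 - B by lra.
    lra.
  have f2 : (pt R x).2 - (pt R a).2 = (B + 1 / 2) * e2%:~R.
    move: x2; rewrite u2 c2 y2; have -> : A = 1 - B by lra.
    lra.
  transitivity ((B + 1 / 2) * (e1 * s + e2 * t)%:~R); first by rewrite bz mulr1.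
  by rewrite !intrD !intrM mulrDr !mulrA -f1 -f2 !intrB.
have kI : ((x.1 : nat)%:Z - (a.1 : nat)%:Z) * s + ((x.2 : nat)%:Z - (a.2 : nat)%:Z) * t = 1.
  move: Bz; set k := (X in _ = X%:~R -> _) => Bz.
  have l1 : 0%:~R < k%:~R :> R by rewrite -Bz; lra.
  have l2 : k%:~R < 2%:~R :> R by rewrite -Bz; lra.
  by move: l1 l2; rewrite !ltr_int; lia.
rewrite kI in Bz; have {}Bz : B = 1 / 2 by lra.
have AE : A = 1 / 2 by lra.
rewrite AE Bz ?u1 ?u2 ?c1 ?c2 ?y1 ?y2 in x1 x2.
have f1 : (pt R x).1 = (pt R c).1 by rewrite c1; lra.
have f2 : (pt R x).2 = (pt R c).2 by rewrite c2; lra.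
split; apply: (@pt_inj R); rewrite [LHS]surjective_pairing [RHS]surjective_pairing; congr pair => //.
  by rewrite y1 f1 c1; ring.
by rewrite y2 f2 c2; ring.
Qed.

Definition okpath h := ends h /\ forall i k, edge h i k -> primitive (vx h i) (vx h k).

Definition bottom_edge a c := ((a.2 : nat) == 0%N) && ((c.2 : nat) == 0%N).

(** A generic point just below the midpoint u of the edge lies in a triangle t, and then t contains
    u. Near u, t has no points above the edge, since these are above the path. As u is no lattice
    point, it must lie on a side of t running along the edge, and primitivity identifies this side
    with the edge. For an edge on the bottom side there would be no room below u. *)
Lemma under_edge h T i k : okpath h -> exact (R := R) (below h) T -> edge h i k ->
  ~~ bottom_edge (vx h i) (vx h k) ->
  exists2 r, tri (vx h i) (vx h k) r \in T & crossz (vx h k) (vx h i) r = 1.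
Proof.
move=> [eh ok] ex eik nb; have pr := ok _ _ eik; have /edgeP[_ _ ik _] := eik.
set a := vx h i in nb pr *; set c := vx h k in nb pr *; set u := midpoint a c.
have ac : px R a < px R c by rewrite /pt /px /= ltr_nat.
pose X1 : R * R * R := (1, 0, - px R a); pose X2 : R * R * R := (-1, 0, px R c).
have X1u : 0 < form_at X1 u by rewrite /form_at /u /midpoint /=; lra.
have X2u : 0 < form_at X2 u by rewrite /form_at /u /midpoint /=; lra.
have u0 : cross (pt R a) (pt R c) u = 0 by have [-> _ _] := cross_mid (pt R a) (pt R c) (pt R a).
have ya0 : 0 <= py R a by rewrite /pt /py /= ler0n.
have yc0 : 0 <= py R c by rewrite /pt /py /= ler0n.
have yan : py R a <= n%:R by rewrite /pt /py /= ler_nat -ltnS.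
have ycn : py R c <= n%:R by rewrite /pt /py /= ler_nat -ltnS.
have y0 : 0 < py R a + py R c.
  by rewrite -natrD ltr0n addn_gt0 !lt0n -negb_and.
have strip z : 0 < form_at X1 z -> 0 < form_at X2 z -> i%:R < z.1 < k%:R.
  by rewrite /form_at /pt /px /= => *; apply/andP; split; lra.
pose Y1 : R * R * R := (0, 1, 0); pose Y2 : R * R * R := (0, -1, n%:R).
have [||z [gz zF near]] := @generic_germ R m n u (0, -1) [:: X1; X2; Y1; Y2; line (pt R c) (pt R a)].
- by rewrite /= oppr_eq0 oner_eq0 orbT.
- move=> L; rewrite !inE => /or4P[/eqP->|/eqP->|/eqP->|/orP[]/eqP->].
  + by rewrite /inward X1u.
  + by rewrite /inward X2u.
  + by rewrite /inward /form_at /u /midpoint /=; apply/orP; left; lra.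
  + by apply: inwardI; rewrite /form_at /form_dir /u /midpoint /=; lra.
  + by rewrite /inward line_at cross_opp u0 oppr0 eqxx /form_dir /=; apply/orP; right; lra.
have zX1 := zF X1; have zX2 := zF X2; have zY1 := zF Y1; have zY2 := zF Y2.
have zL := zF (line (pt R c) (pt R a)); rewrite !inE !eqxx ?orbT in zX1 zX2 zY1 zY2 zL.
have zik := strip z (zX1 isT) (zX2 isT).
have rz : rectangle m n z.
  have : (k : nat)%:R <= m%:R :> R by rewrite ler_nat -ltnS.
  have : 0 <= (i : nat)%:R :> R by rewrite ler0n.
  move/andP: zik => [z1 z2] i0 km; have := zY1 isT; have := zY2 isT; rewrite /form_at /= => *.
  by split; apply/andP; split; lra.
have : (0 < cnt T z)%N.
  rewrite ex.2 // (below_edge eik zik); have := zL isT; rewrite line_at cross_opp oppr_gt0.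
  by move=> ->.
move=> /cnt_gt0[t tT tz]; have ut := ex.1 _ tT.
have tu : hull t u := hull_near ut tz near.
have [[v _ uv]|[x [y [w [tE e [l1 l2 l3]]]]]] := hull_cases ut tu.
  by have := primitive_midpoint v pr; rewrite -/u uv eqxx.
(* A direction that enters t at u and points above the edge leads to a generic point of t above the
   path. *)
have bad (v : R * R) : inward u v (line (pt R x) (pt R y)) -> 0 < form_dir (line (pt R a) (pt R c)) v -> False.
  move=> iv v0; have [||z' [gz' zF' _]] := @generic_germ R m n u v (germ_forms R x y w ++ [:: X1; X2; line (pt R a) (pt R c)]).
  - exact: dir_neq0 v0.
  - move=> L; rewrite mem_cat !inE => /orP[/or3P[]/eqP->|/or3P[]/eqP->] //.
    + by rewrite /inward line_at l1.
    + by rewrite /inward line_at l2.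
    + by rewrite /inward X1u.
    + by rewrite /inward X2u.
    + by rewrite /inward line_at u0 eqxx v0 orbT.
  have tz' : hull t z'.
    by rewrite tE; apply: germ_forms_hull => // L LF; apply: zF'; rewrite mem_cat LF.
  have z1 := zF' X1; have z2 := zF' X2; have z3 := zF' (line (pt R a) (pt R c)).
  rewrite !mem_cat !inE !eqxx ?orbT in z1 z2 z3.
  have : (0 < cnt T z')%N by apply/cnt_gt0; exists t.
  rewrite ex.2 //; last exact: hull_rectangle tz'.
  rewrite (below_edge eik (strip _ (z1 isT) (z2 isT))) -/a -/c.
  by have := z3 isT; rewrite line_at => /lt_gtF ->.
have l3' : cross (pt R x) (pt R y) u = 0.
  move: l3; rewrite le0r => /orP[/eqP//|l3]; exfalso; apply: (bad (0, 1)).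
    by rewrite /inward line_at l3.
  by rewrite /form_dir /=; lra.
have inw (v : R * R) : 0 < form_dir (line (pt R x) (pt R y)) v -> inward u v (line (pt R x) (pt R y)).
  by rewrite /inward line_at l3' eqxx => ->; rewrite orbT.
set L := line (pt R x) (pt R y) in inw bad; set L' := line (pt R a) (pt R c) in bad.
have par : L.1.1 * L'.1.2 - L'.1.1 * L.1.2 = 0.
  apply/eqP; apply/negPn/negP => D0.
  pose v : R * R := ((L'.1.2 - L.1.2) / (L.1.1 * L'.1.2 - L'.1.1 * L.1.2), (L.1.1 - L'.1.1) / (L.1.1 * L'.1.2 - L'.1.1 * L.1.2)).
  have v1 : form_dir L v = 1 by rewrite /form_dir /v /=; field.
  have v2 : form_dir L' v = 1 by rewrite /form_dir /v /=; field.
  by apply: (bad v); [apply: inw|]; rewrite ?v1 ?v2.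
have yx : (y.1 <= x.1)%N.
  rewrite leqNgt; apply/negP => xy; apply: (bad (0, 1)); last by rewrite /L' /form_dir /=; lra.
  have : px R x < px R y by rewrite /pt /px /= ltr_nat.
  by move=> ?; apply: inw; rewrite /L /form_dir /=; lra.
have [||xc ya] := primitive_edge pr _ e _ yx l1 l2 l3' => //.
  apply: (@intr_inj R); rewrite !intrM !intrB; move: par; rewrite /L /L' /pt /px /py /=; lra.
subst x y; exists w => //; rewrite -[tri a c w]tri_swap -tE //.
Qed.

(** Two triangles below the same edge overlap just below its midpoint. *)
Lemma under_uniq reg T a c r r' : exact (R := R) reg T -> (a.1 < c.1)%N ->
  tri a c r \in T -> tri a c r' \in T -> crossz c a r = 1 -> crossz c a r' = 1 -> r = r'.
Proof.
move=> ex ac rT r'T e e'.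
have G p : crossz c a p = 1 -> germ_in (tri a c p) (midpoint a c) (0, -1).
  move=> d; exists c, a, p; split=> //; first by rewrite tri_swap.
  have [u0 u1 _] := cross_mid (pt R a) (pt R c) (pt R p).
  have [_ _ u2] := cross_mid (pt R a) (pt R c) (pt R p).
  have d1 : cross (pt R a) (pt R p) (pt R c) = 1 by rewrite cross_pt crossz_rot d.
  have d2 : cross (pt R p) (pt R c) (pt R a) = 1 by rewrite cross_pt 2!crossz_rot d.
  have : px R a < px R c by rewrite /pt /px /= ltr_nat.
  move=> ?; split; rewrite /inward line_at /midpoint.
  - by rewrite u1 d1; apply/orP; left; lra.
  - by rewrite u2 d2; apply/orP; left; lra.
  - by rewrite cross_opp u0 oppr0 eqxx /form_dir /=; apply/orP; right; lra.
have E : tri a c r = tri a c r'.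
  apply: (exact_overlap (u := midpoint a c) (v := (0, -1)) ex) => //; try exact: G.
  by rewrite /= oppr_eq0 oner_eq0 orbT.
have [ca ar cr] := ccw_neq e; have : r \in tri a c r' by rewrite -E mem_tri eqxx !orbT.
by rewrite mem_tri ![r == _]eq_sym (negbTE ar) (negbTE cr) => /eqP.
Qed.

Lemma mul_eq1_neg (x y : int) : x * y = 1 -> x < 0 -> x = -1 /\ y = -1.
Proof.
move=> e x0; have y0 : y < 0 by rewrite ltNge; apply/negP => ?; nia.
have x1 : x = -1 by apply: le_anti; apply/andP; split; [lia|rewrite leNgt; apply/negP => ?; nia].
by split=> //; rewrite x1 in e; lia.
Qed.

(** The first triangle leans to the right, the second to the left, so both contain the points below
    b in a suitable steep direction and coincide; their vertices are then a, b, c. The exception is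
    a vertical side below b in both of them: by the area it has length 1, and the third vertices lie
    in adjacent columns. *)
Lemma adjacent_triangles reg T a b c p q : exact (R := R) reg T -> (a.1 < b.1 < c.1)%N ->
  tri a b p \in T -> crossz b a p = 1 -> (b.1 <= p.1)%N ->
  tri b c q \in T -> crossz c b q = 1 -> (q.1 <= b.1)%N ->
  (p = c /\ q = a) \/
  [/\ p = q, p.1 = b.1, p.2.+1 = b.2 :> nat, a.1.+1 = b.1 :> nat & c.1 = b.1.+1 :> nat].
Proof.
move=> ex /andP[ab bc] pT e bp qT e' qb.
have down (x : grid m n) : crossz b x p = 1 -> p.1 = b.1 :> nat -> (x.1 < b.1)%N -> p.2.+1 = b.2 :> nat /\ x.1.+1 = b.1 :> nat.
  rewrite /crossz => + E; rewrite E subrr mulr0 subr0 => /mul_eq1_neg H xb.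
  by case: H => [|f1 f2]; [lia|split; lia].
have down' (x : grid m n) : crossz x b q = 1 -> q.1 = b.1 :> nat -> (b.1 < x.1)%N -> q.2.+1 = b.2 :> nat /\ x.1 = b.1.+1 :> nat.
  move=> H E bx; have : ((b.1 : nat)%:Z - (x.1 : nat)%:Z) * ((q.2 : nat)%:Z - (b.2 : nat)%:Z) = 1.
    by rewrite -H /crossz E; ring.
  by move/mul_eq1_neg; case=> [|f1 f2]; [lia|split; lia].
have [E|E] := boolP ((p.1 == b.1 :> nat) && (q.1 == b.1 :> nat)).
  right; move/andP: E => [/eqP E1 /eqP E2]; have [f1 f2] := down _ e E1 ab; have [f3 f4] := down' _ e' E2 bc.
  split=> //; last by apply: val_inj.
  by apply: (@pt_inj R); rewrite /pt /px /py E1 E2; congr (_, _%:R); apply: succn_inj; rewrite f1 f3.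
(* The direction is steeper than any lattice segment spanning at least one column, whose slope is at
   most n. If q is in the column of b, the triangle b c q lies to the right of this column, hence
   the tilt to the right; otherwise the tilt is to the left. *)
left; pose v : R * R := (if (q.1 == b.1 :> nat) then 1 else -1, - (2 * n%:R + 2)).
have vq : q.1 = b.1 :> nat -> v.1 = 1 by move=> qb'; rewrite /v /= (introT eqP qb').
have v0 : (v.1 != 0) || (v.2 != 0) by rewrite /v /=; case: ifP; rewrite ?oppr_eq0 oner_eq0.
have X : px R a + 1 <= px R b by rewrite /pt /px /= natr1 ler_nat.
have X' : px R b + 1 <= px R c by rewrite /pt /px /= natr1 ler_nat.
have Y (x : grid m n) : 0 <= py R x <= n%:R by rewrite /pt /py /= ler0n ler_nat -ltnS /=.
have nR : 0 <= n%:R :> R by rewrite ler0n.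
have big (x y k : R) : 0 <= x <= n%:R -> 0 <= y <= n%:R -> 1 <= k -> 0 < (x - y) * v.1 + k * (2 * n%:R + 2).
  move=> /andP[x0 x1] /andP[y0 y1] k1; have : n%:R + 1 <= k * (2 * n%:R + 2) by nra.
  by rewrite /v /=; case: ifP => _; lra.
have [aa1 ab1] := crossaa (pt R b) (pt R a); have [bb1 bc1] := crossaa (pt R b) (pt R q).
have [pb1 pb2] := crossaa (pt R p) (pt R b); have [cb1 cb2] := crossaa (pt R c) (pt R b).
have G1 : germ_in (tri a b p) (pt R b) v.
  exists b, a, p; split=> //; first by rewrite tri_swap.
  split; rewrite /inward line_at.
  - by rewrite cross_pt crossz_rot e ltr01.
  - rewrite pb2 ltxx eqxx /form_dir /=; have [pb|pb] := eqVneq (p.1 : nat) b.1.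
      have [f1 f2] := down _ e pb ab.
      move: E; rewrite /v /= pb eqxx /= => /negbTE ->.
      have -> : py R b = py R p + 1 by rewrite /pt /py /= -f1 natr1.
      have -> : px R b = px R p by rewrite /pt /px /= pb.
      by lra.
    have k1 : 1 <= px R p - px R b.
      suff : px R b + 1 <= px R p by lra.
      by rewrite /px natr1 ler_nat ltn_neqAle eq_sym pb bp.
    by have := big _ _ _ (Y p) (Y b) k1; rewrite /v /=; lra.
  - rewrite aa1 ltxx eqxx /form_dir /=.
    have k1 : 1 <= px R b - px R a by lra.
    by have := big _ _ _ (Y b) (Y a) k1; rewrite /v /=; lra.
have G2 : germ_in (tri b c q) (pt R b) v.
  exists c, b, q; split=> //; first by rewrite tri_swap.
  split; rewrite /inward line_at.
  - rewrite bb1 ltxx eqxx /form_dir; have [qb'|qb'] := eqVneq (q.1 : nat) b.1.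
      have [f1 f2] := down' _ e' qb' bc.
      rewrite (vq qb') /=.
      have -> : py R b = py R q + 1 by rewrite /pt /py /= -f1 natr1.
      have -> : px R b = px R q by rewrite /pt /px /= qb'.
      by lra.
    have k1 : 1 <= px R b - px R q.
      suff : px R q + 1 <= px R b by lra.
      by rewrite /px natr1 ler_nat ltn_neqAle qb' qb.
    by have := big _ _ _ (Y b) (Y q) k1; rewrite /v /=; lra.
  - by rewrite cross_pt 2!crossz_rot e' ltr01.
  - rewrite cb2 ltxx eqxx /form_dir /=.
    have k1 : 1 <= px R c - px R b by lra.
    by have := big _ _ _ (Y c) (Y b) k1; rewrite /v /=; lra.
have T12 := exact_overlap ex pT qT v0 G1 G2.
have : a \in tri b c q by rewrite -T12 mem_tri eqxx.
have : c \in tri a b p by rewrite T12 mem_tri eqxx !orbT.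
rewrite !mem_tri.
have ne (x y : grid m n) : (x.1 < y.1)%N -> (x == y) = false /\ (y == x) = false.
  by move=> xy; split; apply/eqP => xE; rewrite xE ltnn in xy.
have [n1 n2] := ne _ _ ab; have [n3 n4] := ne _ _ bc; have [n5 n6] := ne _ _ (ltn_trans ab bc).
by rewrite n1 n5 n6 n4 /= => /eqP <- /eqP <-.
Qed.

End Under.

(** * Peeling triangles off a path *)

Section Peeling.
Variables (R : realType) (m n : nat).
Hypotheses (m0 : (0 < m)%N) (n0 : (0 < n)%N).
Implicit Types (h : {ffun 'I_m.+1 -> option 'I_n.+1}) (i j k l : 'I_m.+1).
Implicit Types (a b c p q r : grid m n) (z : R * R) (t : {set grid m n}) (T D : {set {set grid m n}}).

(** The edge leans to the right: it permits no insertion, and whether it takes part in another move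
    depends on the edge that follows. *)
Definition right_triangle T a c :=
  exists r, [/\ tri a c r \in T, crossz c a r = 1 & (c.1 <= r.1)%N].

Definition scanned h (K : nat) T := forall i k, edge h i k -> (i < K)%N ->
  bottom_edge (vx h i) (vx h k) \/ right_triangle T (vx h i) (vx h k).

(* Scanning the edges from the left, those starting before column K have been
   found not to allow a move. *)
Definition peelable h (K : nat) T := exact (R := R) (below h) T /\ scanned h K T.

(** D is the set of removed triangles. The new scan position is the first column whose outgoing edge
    may have changed: the same column after an insertion, i after the deletion that creates the edge
    from i to k, and the preceding column after a lowering, where the predecessor of 0 is 0. *)
Inductive peel : {ffun 'I_m.+1 -> option 'I_n.+1} -> nat -> {set {set grid m n}} ->
    {ffun 'I_m.+1 -> option 'I_n.+1} -> nat -> Prop :=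
  | PeelSkip h (K : nat) : (K < m)%N -> peel h K set0 h K.+1
  | PeelInsert h h' i j k : refines h h' i j k -> crossz (vx h' i) (vx h' j) (vx h' k) = 1 ->
      peel h i [set tri (vx h' i) (vx h' j) (vx h' k)] h' i
  | PeelDelete h h' i j k : refines h' h i j k -> crossz (vx h i) (vx h k) (vx h j) = 1 ->
      peel h j [set tri (vx h i) (vx h k) (vx h j)] h' i
  | PeelLower h h' j : lowers h h' j -> peel h j (lowD h h' j) h' j.-1.

Lemma tri_swapr a b c : tri a c b = tri a b c.
Proof. by apply/setP => p; rewrite !mem_tri [(p == c) || _]orbC. Qed.

Lemma edge_upto h h' i (p q : 'I_m.+1) : (0 < level h i)%N ->
  (forall l, (l <= i)%N -> level h l = level h' l) ->
  edge h p q -> (p < i)%N -> [/\ edge h' p q, vx h p = vx h' p & vx h q = vx h' q].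
Proof.
move=> hi ag e pi; have /edgeP[_ _ pq no] := e.
have qi : (q <= i)%N by rewrite leqNgt; apply/negP => iq; have := no i pi iq; lia.
split.
- by apply: consecutive_change e => l lpq; apply: ag; lia.
- by apply: eq_vx; apply: ag; lia.
- by apply: eq_vx; apply: ag; lia.
Qed.

(** The record for the edges starting before column i rests on triangles with a vertex in such a
    column. A move that resets the scan to i removes none of these. *)
Lemma scanned_upto h h' i T T' : (0 < level h i)%N ->
  (forall l, (l <= i)%N -> level h l = level h' l) ->
  (forall t, t \in T -> (exists2 p, p \in t & (p.1 < i)%N) -> t \in T') ->
  scanned h i T -> scanned h' i T'.
Proof.
move=> hi ag TT sc p q e pi; have h'i : (0 < level h' i)%N by rewrite -ag.
have ag' l : (l <= i)%N -> level h' l = level h l by move=> li; rewrite ag.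
have [e' vp vq] := edge_upto h'i ag' e pi.
rewrite vp vq; have [bt|[r [rT re qr]]] := sc p q e' pi; [by left|right].
exists r; split=> //; apply: TT => //; exists (vx h p) => //; by rewrite mem_tri eqxx.
Qed.

Lemma lowers_next h h' j k : lowers h h' j -> edge h j k -> k = j.+1 :> nat.
Proof.
move=> [_ _ _ nb] /edgeP[_ hk jk no].
have j0 : (j.+1 < m.+1)%N by have := ltn_ord k; lia.
have := nb (Ordinal j0); have := no (Ordinal j0); rewrite /neighbour /= eqxx orbT; lia.
Qed.

Lemma lowers_prev h h' i j : lowers h h' j -> edge h i j -> i.+1 = j :> nat.
Proof.
move=> [_ _ _ nb] /edgeP[hi _ ij no].
have j0 : (j.-1 < m.+1)%N by have := ltn_ord j; lia.
have := nb (Ordinal j0); have := no (Ordinal j0); rewrite /neighbour /=; lia.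
Qed.

Lemma primitive_ccw a b c : crossz a b c = 1 -> primitive a b.
Proof.
move=> e; exists ((c.2 : nat)%:Z - (a.2 : nat)%:Z), (- ((c.1 : nat)%:Z - (a.1 : nat)%:Z)).
by rewrite -e /crossz; ring.
Qed.

Lemma primitive_next a b : b.1 = a.1.+1 :> nat -> primitive a b.
Proof. by move=> e; exists 1, 0; rewrite e; lia. Qed.

Lemma ends_agree h h' j : ends h -> (forall l, l != j -> level h' l = level h l) ->
  (0 < level h' j)%N || (0 < j < m)%N -> ends h'.
Proof.
move=> /andP[e0 e1] ag hj.
have key (l : 'I_m.+1) : (l == 0 :> nat) || (l == m :> nat) -> (0 < level h l)%N -> (0 < level h' l)%N.
  move=> lm hl; have [lj|/ag ->//] := eqVneq l j; subst l; case/orP: hj => // hj; lia.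
by rewrite /ends !key //= ?eqxx ?orbT.
Qed.

(** A new edge is a side of a unimodular triangle or spans a single column, and is primitive in
    either case. *)
Lemma peel_okpath h K D h' K' : okpath h -> peel h K D h' K' -> okpath h'.
Proof.
move=> + pl; case: pl => {h h' K K' D} [h K _|h h' i j k rf e|h h' i j k rf e|h h' j lw] [eh ok]; first by [].
- have [eij ejk] := refines_edges rf; have [eik /andP[ij jk] hj ag] := rf.
  split; first by apply: ends_agree eh ag _; rewrite hj.
  move=> p q epq; have [pi|pi] := eqVneq p i.
    subst p; have /edgeP[_ _ iq _] := epq.
    by have [|| _ <-] := consecutive_uniq eij epq => //; apply: primitive_ccw e.
  have [pj|pj] := eqVneq p j.
    subst p; have /edgeP[_ _ jq _] := epq.
    have [|| _ <-] := consecutive_uniq ejk epq => //.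
    by apply: (@primitive_ccw _ _ (vx h' i)); rewrite crossz_rot.
  have jpq l : (p <= l <= q)%N -> l != j.
    move=> lpq; apply/eqP => lj; subst l; case/eqP: pi; apply/esym.
    have : p != j :> nat by rewrite (inj_eq val_inj).
    by move=> ?; apply: (consecutive_uniq eij epq _ _).1; lia.
  have epq' : edge h p q by apply: consecutive_change epq => l /jpq /ag.
  have /edgeP[_ _ pq _] := epq.
  rewrite -(@eq_vx _ _ h h' p) -?(@eq_vx _ _ h h' q); [exact: ok| |]; rewrite ag // jpq //; lia.
- have [eij ejk] := refines_edges rf; have [eik /andP[ij jk] hj ag] := rf.
  split.
    apply: (ends_agree (j := j) eh); first by move=> l /ag.
    by have := ltn_ord k; lia.
  move=> p q epq; have /edgeP[hp hq pq no] := epq.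
  have no' : p != j /\ q != j.
    have h'j : level h' j = 0%N by have /edgeP[_ _ _] := eik; apply.
    by split; apply/eqP => E; subst; lia.
  rewrite -(@eq_vx _ _ h h' p) -?(@eq_vx _ _ h h' q) ?ag ?no'.1 ?no'.2 //.
  have [pi|pi] := eqVneq p i.
    subst p; have [|| _ <-] := consecutive_uniq eik epq => //; first by have /edgeP[] := eik.
    exact: primitive_ccw e.
  by apply: ok; apply: refines_other rf epq pi.
- have [h'j hj ag nb] := lw; split; first by apply: ends_agree eh ag _; rewrite h'j.
  move=> p q; rewrite (lowers_edge _ _ lw) => epq.
  have [pj|pj] := eqVneq p j; first by subst p; apply: primitive_next; apply: lowers_next lw epq.
  have [qj|qj] := eqVneq q j; first by subst q; apply: primitive_next; rewrite /= (lowers_prev lw epq).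
  by rewrite -(@eq_vx _ _ h h' p) -?(@eq_vx _ _ h h' q) ?ag //; apply: ok.
Qed.

Lemma peel_unimod h K D h' K' t : peel h K D h' K' -> t \in D -> unimod t.
Proof.
case=> {h h' K K' D} [h K _|h h' i j k rf e|h h' i j k rf e|h h' j lw]; rewrite ?inE //.
- by move=> /eqP->; exists (vx h' i), (vx h' j), (vx h' k).
- by move=> /eqP->; exists (vx h i), (vx h k), (vx h j).
- exact: lowD_unimod.
Qed.

Lemma peel_splits h K D h' K' : okpath h -> peel h K D h' K' -> splits R h h' D.
Proof.
move=> oh pl; have [eh' _] := peel_okpath oh pl; have [eh _] := oh.
case: pl eh' eh {oh} => {h h' K K' D} [h K _|h h' i j k rf e|h h' i j k rf e|h h' j lw] eh' eh.
- by move=> z _ _; rewrite cnt0 ?addn0 // => t; rewrite inE.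
- exact: splits_insert.
- exact: splits_delete.
- exact: splits_lower.
Qed.

(** The restored triangles supply the record for the edges behind which the scan had gone back. For
    a deletion, the edge from i to j leans to the right with apex in column k; for a lowering, the
    edge ending in column j has its apex at the lowered vertex. *)
Lemma peel_scanned_add h K D h' K' T : peel h K D h' K' -> scanned h' K' T ->
  scanned h K (T :|: D).
Proof.
case=> {h h' K K' D} [h K _|h h' i j k rf e|h h' i j k rf e|h h' j lw] sc.
- by rewrite setU0 => p q epq pK; apply: sc => //; apply: ltnW.
- have [eij ejk] := refines_edges rf; have [eik /andP[ij jk] hj ag] := rf.
  have /edgeP[h'i _ _ _] := eij.
  apply: scanned_upto sc => // [l li|t tT _]; last by rewrite inE tT.
  by rewrite ag //; apply/eqP => lj; subst l; lia.
- have [eij ejk] := refines_edges rf; have [eik /andP[ij jk] hj ag] := rf.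
  have /edgeP[h'i _ _ _] := eik; have /edgeP[hi _ _ no] := eij.
  have sci : scanned h i (T :|: [set tri (vx h i) (vx h k) (vx h j)]).
    apply: scanned_upto sc => // [l li|t tT _]; last by rewrite inE tT.
    by rewrite ag //; apply/eqP => lj; subst l; lia.
  move=> p q epq pj; have [pi|pi] := eqVneq p i; last first.
    apply: sci => //; have /edgeP[hp _ _ _] := epq.
    have : p != i :> nat by rewrite (inj_eq val_inj).
    by have := no p; lia.
  subst p; have /edgeP[_ _ iq _] := epq; have [|| _ <-] := consecutive_uniq eij epq => //.
  right; exists (vx h k); split; last exact: ltnW.
    by rewrite in_setU in_set1 tri_swapr eqxx orbT.
  by rewrite -crossz_rot.
- have [h'j hj ag nb] := lw; move=> p q epq pj.
  have [pj'|pj'] := eqVneq p.+1 (j : nat).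
    have qj : q = j.
      have /edgeP[_ _ pq no] := epq; apply: val_inj => /=.
      by have := no j pj; rewrite hj; lia.
    subst q; right; exists (vx h' j); split=> //.
      rewrite inE; apply/orP; right; apply/imsetP; exists p.
        by rewrite inE /neighbour pj' eqxx.
      by rewrite -[RHS]tri_rot.
    by have [c _] := lowers_ccw p lw; rewrite 2!crossz_rot c.
  have j0 : (j.-1 < m.+1)%N by have := ltn_ord j; lia.
  have jp : (0 < level h (Ordinal j0))%N by apply: nb; rewrite /neighbour /=; lia.
  have agl l : (l <= Ordinal j0)%N -> level h' l = level h l.
    by move=> /= lj; apply: ag; apply/eqP => lE; subst l; lia.
  have scj : scanned h (Ordinal j0) (T :|: lowD h h' j).
    apply: (scanned_upto (h := h') (T := T)) => //; first by rewrite agl.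
    by move=> t tT _; rewrite inE tT.
  by apply: scj => //=; lia.
Qed.

Lemma peel_add h K D h' K' T : okpath h -> peel h K D h' K' -> peelable h' K' T ->
  [disjoint T & D] /\ peelable h K (T :|: D).
Proof.
move=> oh pl [ex sc].
have [dis ex'] := exact_add (peel_splits oh pl) (fun t => @peel_unimod _ _ _ _ _ t pl) ex.
by split=> //; split=> //; apply: peel_scanned_add pl sc.
Qed.

Lemma scanned_le h K K' T : (K' <= K)%N -> scanned h K T -> scanned h K' T.
Proof. by move=> KK sc i k e iK; apply: sc => //; apply: leq_trans iK KK. Qed.

(** A nonempty D excludes the skip, which extends the record and is legitimate only if the edge at K
    leans to the right or lies on the bottom. *)
Lemma peel_sub h K D h' K' T : okpath h -> peel h K D h' K' -> D != set0 -> D \subset T ->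
  peelable h K T -> peelable h' K' (T :\: D).
Proof.
move=> oh pl D0 DT [ex sc]; split; first exact: exact_sub (peel_splits oh pl) ex DT.
case: pl D0 sc {DT ex oh} => {h h' K K' D} [h K _|h h' i j k rf e|h h' i j k rf e|h h' j lw] D0 sc.
- by rewrite eqxx in D0.
- have [eik /andP[ij jk] hj ag] := rf; have /edgeP[hi _ _ _] := eik.
  apply: scanned_upto sc => // [l li|t tT [p pt pi]].
    by rewrite ag //; apply/eqP => lj; subst l; lia.
  rewrite inE tT andbT; apply: contraTN pt; rewrite inE => /eqP ->.
  by rewrite mem_tri; apply/negP => /or3P[]/eqP pE; subst p; rewrite /= in pi; lia.
- have [eij _] := refines_edges rf; have [eik /andP[ij jk] hj ag] := rf; have /edgeP[hi _ _ _] := eij.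
  apply: scanned_upto (scanned_le (ltnW ij) sc) => // [l li|t tT [p pt pi]].
    by rewrite ag //; apply/eqP => lj; subst l; lia.
  rewrite inE tT andbT; apply: contraTN pt; rewrite inE => /eqP ->.
  by rewrite mem_tri; apply/negP => /or3P[]/eqP pE; subst p; rewrite /= in pi; lia.
- have [h'j hj ag nb] := lw; have [j0|j0] := posnP j; first by move=> p q _; rewrite j0.
  have j1 : (j.-1 < m.+1)%N by have := ltn_ord j; lia.
  have jp : (0 < level h (Ordinal j1))%N by apply: nb; rewrite /neighbour /=; lia.
  apply: (scanned_upto (i := Ordinal j1) jp _ _ (scanned_le _ sc)) => [l li|t tT [p pt pi]|]; last by rewrite /=; lia.
    by rewrite ag //; apply/eqP => lj; subst l; rewrite /= in li; lia.
  rewrite inE tT andbT; apply: contraTN pt => /imsetP[l]; rewrite inE /neighbour => jl ->.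
  by rewrite mem_tri; apply/negP => /or3P[]/eqP pE; subst p; rewrite /= in pi; lia.
Qed.

Lemma crossz_bottom_right p q r : crossz q p r = 1 -> (p.1 < q.1)%N -> (q.2 : nat) = 0%N ->
  (q.1 <= r.1)%N -> False.
Proof. by rewrite /crossz => e pq q0 qr; rewrite q0 in e; nia. Qed.

Lemma crossz_bottom_left p q r : crossz q p r = 1 -> (p.1 < q.1)%N -> (p.2 : nat) = 0%N ->
  (r.1 <= p.1)%N -> False.
Proof. by rewrite /crossz => e pq p0 rp; rewrite p0 in e; nia. Qed.

Lemma crossz_bottom p q r : crossz q p r = 1 -> (p.1 < q.1)%N -> ~~ bottom_edge p q.
Proof. by rewrite /crossz => e pq; apply/negP => /andP[/eqP p0 /eqP q0]; rewrite p0 q0 in e; nia. Qed.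

(** From right to left: an edge ending on the bottom side cannot lean to the right, as its apex
    would be outside the rectangle. So it lies on the bottom, and being primitive it spans one
    column. *)
Lemma bottom_path h T : okpath h -> scanned h m T -> ((vx h ord_max).2 : nat) = 0%N ->
  forall l, level h l = 1%N.
Proof.
move=> [/andP[e0 e1] ok] sc lm.
suff H d (l : 'I_m.+1) : (m - l = d)%N -> level h l = 1%N by move=> l; apply: (H (m - l)%N).
elim: d l => [|d IH] l ml.
  have -> : l = ord_max by apply: val_inj => /=; have := ltn_ord l; lia.
  by rewrite level_vx // lm.
have l1 : (l.+1 < m.+1)%N by lia.
have {}IH := IH (Ordinal l1) (_ : m - l.+1 = d)%N.
have hl : level h (Ordinal l1) = 1%N by apply: IH; lia.
have hl0 : (0 < level h (Ordinal l1))%N by rewrite hl.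
have q0 : ((vx h (Ordinal l1)).2 : nat) = 0%N by have := level_vx hl0; rewrite hl => -[].
have [p epq] := consecutive_prev hl0 e0 (isT : (ord0 < Ordinal l1)%N).
have /edgeP[hp _ pq _] := epq.
have bt : bottom_edge (vx h p) (vx h (Ordinal l1)).
  have [|//|[r [_ e qr]]] := sc p _ epq; first by rewrite /= in pq *; lia.
  by case: (crossz_bottom_right e pq q0 qr).
have [s [t]] := ok _ _ epq; move/andP: bt => [/eqP p0 _].
rewrite p0 q0 subrr mul0r addr0 /= => pr.
have pl : p = l.
  apply: val_inj => /=; rewrite /= in pq; move: pr.
  have [?|?] := leP s 0; nia.
by subst p; rewrite level_vx // p0.
Qed.

Definition upd h j o : {ffun 'I_m.+1 -> option 'I_n.+1} := [ffun l => if l == j then o else h l].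

Lemma level_upd h j o l : level (upd h j o) l = if l == j then (if o is Some y then y.+1 else 0)%N else level h l.
Proof. by rewrite /level ffunE; case: (l == j). Qed.

Lemma vx_upd h j y : vx (upd h j (Some y)) j = (j, y).
Proof. by rewrite /vx ffunE eqxx. Qed.

Lemma vx_upd_other h j o l : l != j -> vx (upd h j o) l = vx h l.
Proof. by move=> lj; apply: eq_vx; rewrite level_upd (negbTE lj). Qed.

Lemma lowD_neq0 h h' j : lowD h h' j != set0.
Proof.
have [l jl] : exists l, neighbour j l.
  have [jm|jm] := ltnP j m; first by exists (Ordinal (jm : j.+1 < m.+1)%N); rewrite /neighbour /= eqxx orbT.
  have j1 : (j.-1 < m.+1)%N by have := ltn_ord j; lia.
  by exists (Ordinal j1); rewrite /neighbour /=; lia.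
by apply/set0Pn; exists (tri (vx h' j) (vx h l) (vx h j)); apply/imsetP; exists l.
Qed.

Lemma peel_lower h j r T : okpath h -> peelable h j T -> r.1 = j -> (0 < level h j)%N ->
  r.2.+1 = (vx h j).2 :> nat -> (forall l, neighbour j l -> (0 < level h l)%N /\ tri (vx h l) (vx h j) r \in T) ->
  exists D h' K', [/\ peel h j D h' K', D \subset T & peelable h' K' (T :\: D)].
Proof.
move=> oh pT rj hj ry nb; pose h' := upd h j (Some r.2).
have rE : vx h' j = r by rewrite vx_upd -rj -surjective_pairing.
have lw : lowers h h' j.
  split=> [||l lj|l /nb[]//]; rewrite ?level_upd ?eqxx ?(negbTE lj) //.
  by rewrite level_vx // ry.
have pl := PeelLower lw; have DT : lowD h h' j \subset T.
  apply/subsetP => t /imsetP[l]; rewrite inE => /nb[_ lT] ->.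
  by rewrite rE -tri_rot.
exists (lowD h h' j), h', j.-1; split=> //; apply: (peel_sub oh pl) => //.
exact: lowD_neq0.
Qed.

(** A vertical side of a unimodular triangle has length 1, and the third vertex lies in an adjacent
    column. *)
Lemma crossz_column p q r : crossz q p r = 1 -> (p.1 < q.1)%N ->
  (r.1 = p.1 :> nat -> r.2.+1 = p.2 :> nat /\ q.1 = p.1.+1 :> nat) /\
  (r.1 = q.1 :> nat -> r.2.+1 = q.2 :> nat /\ q.1 = p.1.+1 :> nat).
Proof.
move=> e pq; split=> rE.
  have : ((p.1 : nat)%:Z - (q.1 : nat)%:Z) * ((r.2 : nat)%:Z - (p.2 : nat)%:Z) = 1.
    by rewrite -e /crossz rE; ring.
  by move/mul_eq1_neg; case=> [|f1 f2]; [lia|split; lia].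
have : ((p.1 : nat)%:Z - (q.1 : nat)%:Z) * ((r.2 : nat)%:Z - (q.2 : nat)%:Z) = 1.
  by rewrite -e /crossz rE; ring.
by move/mul_eq1_neg; case=> [|f1 f2]; [lia|split; lia].
Qed.

(** At the last column the last edge leans to the right, so its apex is in that column and the right
    end is lowered. Before it, the triangle below the edge starting at K decides: leaning right
    gives a skip, an apex between the ends an insertion. If it leans left, then at K = 0 the left
    end is lowered, and otherwise the preceding edge leans right by the record, so that there is a
    common triangle or a common vertical side. *)
Lemma peel_exists h (K : 'I_m.+1) T : okpath h -> peelable h K T -> (exists l, level h l != 1%N) ->
  exists D h' K', [/\ peel h K D h' K', D \subset T & peelable h' K' (T :\: D)].
Proof.
move=> oh pT nb; have [eh ok] := oh; have /andP[e0 e1] := eh; have [ex sc] := pT.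
have [Km|Km] := ltnP K m; last first.
  have KE : K = ord_max by apply: val_inj => /=; have := ltn_ord K; lia.
  subst K; have [i ei] := consecutive_prev e1 e0 (m0 : (ord0 < ord_max)%N).
  have /edgeP[hi _ im no] := ei.
  have scm : scanned h m T by apply: scanned_le sc.
  have top0 : ((vx h ord_max).2 : nat) != 0%N.
    by apply/eqP => /(bottom_path oh scm) al; case: nb => l; rewrite al.
  have [|/andP[_ /eqP q0]|[r [rT e mr]]] := sc i ord_max ei; first by [].
    by rewrite q0 in top0.
  have rm : r.1 = ord_max by apply: val_inj; apply/eqP; rewrite eqn_leq (mr : ord_max <= r.1)%N andbT -ltnS ltn_ord.
  have [_ cc] := crossz_column e im; have [|c1 c2] := cc; first by rewrite rm.
  apply: (peel_lower (r := r)) => // l; rewrite /neighbour => lm; suff -> : l = i by [].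
  by apply: val_inj => /=; have := ltn_ord l; rewrite /= in c2 lm; lia.
have skip : scanned h K.+1 T -> exists D h' K', [/\ peel h K D h' K', D \subset T & peelable h' K' (T :\: D)].
  by move=> sc'; exists set0, h, K.+1; rewrite sub0set setD0; split=> //; apply: PeelSkip.
have sc1 : (forall k, edge h K k -> bottom_edge (vx h K) (vx h k) \/ right_triangle T (vx h K) (vx h k)) ->
    scanned h K.+1 T.
  move=> H p q epq; rewrite ltnS leq_eqVlt => /orP[/eqP pK|]; last exact: sc.
  have pK' : p = K by apply: val_inj.
  by subst p; apply: H.
have [hK|hK] := posnP (level h K).
  by apply/skip/sc1 => k /edgeP[]; rewrite hK.
have [k ek] := consecutive_next hK e1 (Km : (K < ord_max)%N).
have /edgeP[_ hk Kk no] := ek.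
have kuniq k' : edge h K k' -> k' = k.
  by move=> ek'; have /edgeP[_ _ Kk' _] := ek'; have [|| _ ->] := consecutive_uniq ek ek'.
have [bt|bt] := boolP (bottom_edge (vx h K) (vx h k)).
  by apply/skip/sc1 => k' /kuniq ->; left.
have [r rT e] := under_edge oh ex ek bt.
have [kr|rk] := leqP k r.1.
  by apply/skip/sc1 => k' /kuniq ->; right; exists r.
have [Kr|rK] := ltnP K r.1.
  pose h' := upd h r.1 (Some r.2).
  have rE : vx h' r.1 = r by rewrite vx_upd -surjective_pairing.
  have nK : K != r.1 by apply: contraTneq Kr => ->; rewrite ltnn.
  have nk : k != r.1 by apply: contraTneq rk => ->; rewrite ltnn.
  have rf : refines h h' K r.1 k.
    by split=> //; rewrite ?Kr ?rk ?level_upd ?eqxx // => l lr; rewrite level_upd (negbTE lr).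
  have vK := vx_upd_other h (Some r.2) nK; have vk := vx_upd_other h (Some r.2) nk.
  have e' : crossz (vx h' K) (vx h' r.1) (vx h' k) = 1 by rewrite rE vK vk crossz_rot.
  have pl := PeelInsert rf e'; rewrite rE vK vk in pl.
  have DT : [set tri (vx h K) r (vx h k)] \subset T by rewrite sub1set tri_swapr.
  by exists [set tri (vx h K) r (vx h k)], h', K; split=> //; apply: (peel_sub oh pl) => //; apply/set0Pn; exists (tri (vx h K) r (vx h k)); rewrite inE.
have [K0|K0] := posnP K.
  have rE : r.1 = K by apply: val_inj; apply/eqP; rewrite eqn_leq (rK : (r.1 <= K)%N) (K0 : val K = 0%N).
  have [cc _] := crossz_column e Kk; have [|c1 c2] := cc; first by rewrite rE.
  apply: (peel_lower (r := r)) => // l; rewrite /neighbour => lm; suff -> : l = k.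
    by split=> //; rewrite tri_swap.
  by apply: val_inj => /=; rewrite /= in c2; lia.
have [i ei] := consecutive_prev hK e0 (K0 : (ord0 < K)%N).
have /edgeP[hi _ iK noi] := ei.
have [/andP[_ /eqP q0]|[r' [r'T e' Kr']]] := sc i K ei iK.
  by case: (crossz_bottom_left e Kk q0 rK).
have iKk : ((vx h i).1 < (vx h K).1 < (vx h k).1)%N by rewrite /= iK Kk.
have [[r'k ri]|[r'r rb y1 c1 c2]] := adjacent_triangles ex iKk r'T e' Kr' rT e rK; last first.
  subst r'; apply: (peel_lower (r := r)) => // l; rewrite /neighbour => lm.
  have [->|->] : l = i \/ l = k.
    case/orP: lm => /eqP lm; [left|right]; apply: val_inj; rewrite /= in c1 c2 *; lia.
  - by [].
  - by split=> //; rewrite tri_swap.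
subst r r'; pose h' := upd h K None.
have nK l : l != K -> vx h' l = vx h l by move=> lK; rewrite vx_upd_other.
have rf : refines h' h i K k.
  split; rewrite ?iK ?Kk //; last by move=> l lK; rewrite level_upd (negbTE lK).
  have niK : (i == K) = false by apply/negP => /eqP E; rewrite E ltnn in iK.
  have nkK : (k == K) = false by apply/negP => /eqP E; rewrite E ltnn in Kk.
  apply/edgeP; rewrite !level_upd niK nkK; split=> //.
  move=> l il lk; rewrite level_upd; case: eqP => // /eqP; rewrite -(inj_eq val_inj) /= => lK.
  by have [?|?] := ltnP l K; [apply: noi|apply: no; lia].
have e2 : crossz (vx h i) (vx h k) (vx h K) = 1 by rewrite crossz_rot.
have pl := PeelDelete rf e2.
have DT : [set tri (vx h i) (vx h k) (vx h K)] \subset T by rewrite sub1set tri_swapr.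
by exists [set tri (vx h i) (vx h k) (vx h K)], h', i; split=> //; apply: (peel_sub oh pl) => //; apply/set0Pn; exists (tri (vx h i) (vx h k) (vx h K)); rewrite inE.
Qed.

(* The triangle with apex r below the edge from column K determines the move. *)
Definition apex h (K : 'I_m.+1) k r h' (K' : nat) := [/\ edge h K k, crossz (vx h k) (vx h K) r = 1, (r.1 < k)%N,
  K' = (if (K < r.1)%N then K : nat else if (r.1 < K)%N then r.1 : nat else K.-1) &
  forall l, level h' l =
    if (K < r.1)%N then (if l == r.1 then r.2.+1 else level h l)
    else if l == K then (if (r.1 < K)%N then 0%N else (level h K).-1) else level h l].

Lemma peel_apex h K0 D h' K' (K : 'I_m.+1) : peel h K0 D h' K' -> K = K0 :> nat -> (K < m)%N ->
  [/\ D = set0, h' = h & K' = K.+1] \/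
  (exists k r, tri (vx h K) (vx h k) r \in D /\ apex h K k r h' K').
Proof.
case=> {h h' K0 K' D} [h K0 _|h h' i j k rf e|h h' i j k rf e|h h' j lw] KE Km; [by left; split; rewrite ?KE| | |];
  right; move/val_inj: KE => KE; subst K.
- have [eik /andP[ij jk] hj ag] := rf.
  have ni : i != j by rewrite -(inj_eq val_inj) /=; lia.
  have nk : k != j by rewrite -(inj_eq val_inj) /=; lia.
  have vi : vx h' i = vx h i by apply: eq_vx; rewrite ag.
  have vk : vx h' k = vx h k by apply: eq_vx; rewrite ag.
  exists k, (vx h' j); split; first by rewrite vi vk in_set1 tri_swapr eqxx.
  split=> //=; rewrite ?ij //.
    by rewrite -vi -vk -crossz_rot.
  move=> l; have [->|/ag//] := eqVneq l j; exact: level_vx.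
- have [eij ejk] := refines_edges rf; have [eik /andP[ij jk] hj ag] := rf.
  exists k, (vx h i); split; first by rewrite in_set1 tri_rot tri_swapr eqxx.
  have ji : (j < i)%N = false by lia.
  split=> //=; rewrite ?ji ?ij //.
  - by rewrite crossz_rot.
  - exact: ltn_trans ij jk.
  - move=> l; have [->|/ag//] := eqVneq l j.
    by have /edgeP[_ _ _] := eik; apply.
- have [h'j hj ag nb] := lw.
  have l1 : (j.+1 < m.+1)%N by [].
  pose k : 'I_m.+1 := Ordinal l1; have jk : neighbour j k by rewrite /neighbour /= eqxx orbT.
  exists k, (vx h' j); split.
    by apply/imsetP; exists k => //; rewrite -[RHS]tri_rot tri_swap.
  have [_ c] := lowers_ccw k lw.
  split=> //=; rewrite ?ltnn //.
  - by apply/edgeP; rewrite hj (nb k jk); split=> //= l; lia.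
  - by rewrite crossz_rot c.
  - by move=> l; have [->|/ag//] := eqVneq l j; rewrite hj.
Qed.

(** The triangle below the edge at K is unique and its apex determines the move. A skip cannot
    compete with a move, since it demands an apex in or beyond the right end column, and the moves
    have it strictly before. In the last column only a lowering is possible. *)
Lemma peel_uniq h (K : 'I_m.+1) T D1 h1 K1 D2 h2 K2 : peelable h K T ->
  peel h K D1 h1 K1 -> D1 \subset T -> peelable h1 K1 (T :\: D1) ->
  peel h K D2 h2 K2 -> D2 \subset T -> peelable h2 K2 (T :\: D2) -> h1 = h2 /\ K1 = K2.
Proof.
move=> [ex _] p1 D1T q1 p2 D2T q2.
have [Km|Km] := ltnP K m; last first.
  have low D h' K' : peel h K D h' K' -> lowers h h' K /\ K' = K.-1.
    move E : (K : nat) => K0 pl; case: pl E => {h h' K0 K' D ex p1 p2 q1 q2} [h K0 K0m|h h' i j k rf _|h h' i j k rf _|h h' j lw] E.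
    - by move: Km; rewrite E leqNgt K0m.
    - by have [_ /andP[ij jk] _ _] := rf; have := ltn_ord k; lia.
    - by have [_ /andP[ij jk] _ _] := rf; have := ltn_ord k; lia.
    - by move/val_inj: E => ->.
  have [[_ l1 a1 _] ->] := low _ _ _ p1; have [[_ l2 a2 _] ->] := low _ _ _ p2; split=> //.
  apply: level_inj => l; have [->|lK] := eqVneq l K; last by rewrite a1 // a2.
  by move: l2; rewrite l1 => -[].
have skip D h' K' k r : tri (vx h K) (vx h k) r \in D -> D \subset T -> apex h K k r h' K' -> ~ peelable h K.+1 T.
  move=> rD DT [ek e rk _ _] [_ sc]; have /edgeP[_ _ Kk _] := ek.
  have [//|bt|[r' [r'T e' kr']]] := sc K k ek.
    by have := crossz_bottom e Kk; rewrite bt.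
  have rT := subsetP DT _ rD; have rr := under_uniq (a := vx h K) (c := vx h k) ex Kk rT r'T e e'.
  by subst r'; have := leq_trans rk kr'; rewrite ltnn.
have [[d1 d2 d3]|[k1 [r1 [rD1 a1]]]] := peel_apex p1 erefl Km;
  have [[e1 e2 e3]|[k2 [r2 [rD2 a2]]]] := peel_apex p2 erefl Km.
- by rewrite d2 e2 d3 e3.
- by case: (skip _ _ _ _ _ rD2 D2T a2); move: q1; rewrite d1 d2 d3 setD0.
- by case: (skip _ _ _ _ _ rD1 D1T a1); move: q2; rewrite e1 e2 e3 setD0.
have [g1 c1 l1 -> f1] := a1; have [g2 c2 l2 -> f2] := a2.
have /edgeP[_ _ Kk1 _] := g1; have /edgeP[_ _ Kk2 _] := g2.
have [|| _ kk] := consecutive_uniq g1 g2 => //; subst k2.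
have rr := under_uniq (a := vx h K) (c := vx h k1) ex Kk1 (subsetP D1T _ rD1) (subsetP D2T _ rD2) c1 c2; subst r2.
by split=> //; apply: level_inj => l; rewrite f1 f2.
Qed.

Lemma refines_column h h' i j k : refines h h' i j k -> level h j = 0%N /\ (0 < level h' j)%N.
Proof. by move=> [/edgeP[_ _ _ no] /andP[ij jk] hj _]; rewrite no. Qed.

(** Hence moves may be counted as pairs of states. The column where the two paths differ and the way
    its level changes reveal the kind of the move. *)
Lemma peel_fun h K D1 D2 h' K' : peel h K D1 h' K' -> peel h K D2 h' K' -> D1 = D2.
Proof.
have col (g g' : {ffun 'I_m.+1 -> option 'I_n.+1}) j j' : (forall l, l != j -> level g' l = level g l) ->
    (forall l, l != j' -> level g' l = level g l) -> level g j <> level g' j -> j = j'.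
  by move=> _ a' nj; apply/eqP; apply/negPn/negP => /a' /esym.
move=> p1 p2; case: p1 p2 => {h h' K K' D1} [h K Km|h h' i j k rf e|h h' i j k rf e|h h' j lw].
- move E : {2}h => h'; move E' : K.+1 => K' p2.
  case: p2 E E' {Km} => {h h' K K' D2} [//|h h' i j k rf e|h h' i j k rf e|h h' j lw] E _; subst h'.
  + by have [] := refines_column rf; lia.
  + by have [] := refines_column rf; lia.
  + by have [_ ] := lw; lia.
- have [eik /andP[ij jk] hj ag] := rf; have [hj0 _] := refines_column rf.
  move E : {1}(i : nat) => K; move E' : (i : nat) => K' p2.
  case: p2 rf e eik hj ag hj0 E E' => {h h' K K' D2} [h K Km|h h' i2 j2 k2 rf2 e2|h h' i2 j2 k2 rf2 e2|h h' j2 lw] rf e eik hj ag hj0 E E'.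
  + by move: hj; rewrite hj0.
  + move/val_inj: E => E; subst i2; have [eik2 /andP[ij2 jk2] hj2 ag2] := rf2.
    have jj : j = j2 by apply: col ag ag2 _; rewrite hj0; lia.
    have [|| _ kk] := consecutive_uniq eik eik2; [lia|lia|].
    by subst j2 k2.
  + by have [_ /andP[ij2 jk2] _ _] := rf2; lia.
  + have [l1 l2 l3 _] := lw.
    have jj : j = j2 by apply: col ag l3 _; rewrite hj0; lia.
    by subst j2; lia.
- have [eik /andP[ij jk] hj ag] := rf; have [hj0 _] := refines_column rf.
  move E : {1}(j : nat) => K; move E' : (i : nat) => K' p2.
  case: p2 rf e eik hj ag hj0 E E' => {h h' K K' D2} [h K Km|h h' i2 j2 k2 rf2 e2|h h' i2 j2 k2 rf2 e2|h h' j2 lw] rf e eik hj ag hj0 E E'.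
  + by move: hj; rewrite hj0.
  + by lia.
  + move/val_inj: E => E; subst j2; have [eik2 /andP[ij2 jk2] _ _] := rf2.
    have [|| ii kk] := consecutive_uniq eik eik2; [lia|lia|].
    by subst i2 k2.
  + by have [l1 l2 l3 _] := lw; move/val_inj: E => E; subst j2; lia.
- have [l1 l2 l3 _] := lw.
  move E : {1}(j : nat) => K; move E' : (j.-1) => K' p2.
  case: p2 lw l1 l2 l3 E E' => {h h' K K' D2} [h K Km|h h' i2 j2 k2 rf2 e2|h h' i2 j2 k2 rf2 e2|h h' j2 lw2] lw l1 l2 l3 E E'.
  + by lia.
  + have [_ /andP[ij2 jk2] _ _] := rf2.
    have [hj0 hj] := refines_column rf2; have [//|jj] := eqVneq j2 j; last by have := l3 _ jj; lia.
    by move=> jj; subst j2; lia.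
  + by move/val_inj: E => E; subst j2; have [] := refines_column rf2; lia.
  + by move/val_inj: E => E; subst j2.
Qed.

Lemma agree_offP h h' j : reflect (forall l, l != j -> level h' l = level h l) (agree_off (level h) (level h') j).
Proof.
apply: (iffP forallP) => H l; first by move=> lj; apply/eqP; have := H l; rewrite lj.
by apply/implyP => lj; apply/eqP; apply: H.
Qed.

Lemma ccw_areaP h i j k : (0 < level h i)%N -> (0 < level h j)%N -> (0 < level h k)%N ->
  (i <= j)%N -> (i <= k)%N ->
  reflect (crossz (vx h i) (vx h j) (vx h k) = 1) (ccw_area (level h) i j k).
Proof.
move=> /level_vx hi /level_vx hj /level_vx hk ij ik; rewrite /ccw_area /crossz hi hj hk.
set yi := nat_of_ord (vx h i).2; set yj := nat_of_ord (vx h j).2; set yk := nat_of_ord (vx h k).2 => /=.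
have jE := subnKC ij; have kE := subnKC ik; move: jE kE; set d := (j - i)%N; set d' := (k - i)%N => <- <-.
by apply: (iffP eqP) => H; nia.
Qed.

Lemma peel_formulaP h K h' K' :
  reflect (exists D, peel h K D h' K') (peel_formula (level h) K (level h') K').
Proof.
apply: (iffP idP) => [/or4P[]|[D pl]].
- move=> /and3P[Km /forallP ag /eqP ->]; exists set0.
  have -> : h' = h by apply: level_inj => l; apply/eqP/ag.
  by rewrite addn1; apply: PeelSkip.
- move=> /existsP[i /existsP[j /existsP[k /and3P[/eqP-> /eqP-> /and5P[eik ij jk hj /andP[/agree_offP ag ar]]]]]].
  have rf : refines h h' i j k by split=> //; rewrite ij jk.
  exists [set tri (vx h' i) (vx h' j) (vx h' k)]; apply: PeelInsert (rf) _.
  have [/edgeP[hi _ _ _] /edgeP[_ hk _ _]] := refines_edges rf.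
  by apply/ccw_areaP => //; lia.
- move=> /existsP[i /existsP[j /existsP[k /and3P[/eqP-> /eqP-> /and5P[eik ij jk hj /andP[/agree_offP ag ar]]]]]].
  have rf : refines h' h i j k by split=> //; rewrite ij jk.
  exists [set tri (vx h i) (vx h k) (vx h j)]; apply: PeelDelete (rf) _.
  have [/edgeP[hi _ _ _] /edgeP[_ hk _ _]] := refines_edges rf.
  by apply/ccw_areaP => //; lia.
- move=> /existsP[j /and3P[/eqP-> /eqP-> /and4P[h'j /eqP hj /agree_offP ag /forallP nb]]].
  exists (lowD h h' j); apply: PeelLower; split=> //; first by rewrite hj addn1.
  by move=> l jl; have := nb l; rewrite jl.
case: pl => {h h' K K' D} [h K Km|h h' i j k rf e|h h' i j k rf e|h h' j lw]; apply/or4P.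
- by constructor 1; rewrite Km addn1 eqxx andbT; apply/forallP.
- constructor 2; apply/existsP; exists i; apply/existsP; exists j; apply/existsP; exists k.
  have [eik /andP[ij jk] hj ag] := rf; have [/edgeP[hi _ _ _] /edgeP[_ hk _ _]] := refines_edges rf.
  rewrite !eqxx /= /insert_formula; apply/and5P; split=> //; apply/andP; split; first exact/agree_offP.
  by apply/ccw_areaP => //; lia.
- constructor 3; apply/existsP; exists i; apply/existsP; exists j; apply/existsP; exists k.
  have [eik /andP[ij jk] hj ag] := rf; have [/edgeP[hi _ _ _] /edgeP[_ hk _ _]] := refines_edges rf.
  rewrite !eqxx /= /delete_formula; apply/and5P; split=> //; apply/andP; split; first exact/agree_offP.
  by apply/ccw_areaP => //; lia.
- constructor 4; apply/existsP; exists j; rewrite !eqxx /= /lower_formula; have [h'j hj ag nb] := lw.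
  apply/and4P; split=> //; [by rewrite addn1 hj|exact/agree_offP|].
  by apply/forallP => l; apply/implyP/nb.
Qed.

(** * Counting the covers of a state *)

Definition state : finType := ({ffun 'I_m.+1 -> option 'I_n.+1} * 'I_m.+1)%type.
Implicit Types x : state.

Definition covers x := [set T : {set {set grid m n}} | `[< peelable x.1 x.2 T >]].

Definition bottom_state x := bottom_formula (level x.1).

Definition next_state x x' :=
  ~~ bottom_state x && peel_formula (level x.1) x.2 (level x'.1) x'.2.

Lemma coversP x T : reflect (peelable x.1 x.2 T) (T \in covers x).
Proof. by rewrite inE; apply: asboolP. Qed.

Lemma peel_column h K D h' K' : (K <= m)%N -> peel h K D h' K' -> (K' < m.+1)%N.
Proof.
by move=> Km pl; case: pl Km => {h h' K K' D} //= *; rewrite ?ltn_ord // (leq_ltn_trans (leq_pred _)).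
Qed.

(** Double counting of pairs of a cover T and a successor x': every T admits exactly one x', and for
    fixed x' the map adding [D x'] is a bijection from the covers of x' to the covers of x that
    admit x'. *)
Lemma covers_rec x : okpath x.1 -> ~~ bottom_state x ->
  #|covers x| = (\sum_x' next_state x x' * #|covers x'|)%N.
Proof.
move=> ok nb; have [D HD] : exists D : state -> {set {set grid m n}},
    forall x', next_state x x' -> peel x.1 x.2 (D x') x'.1 x'.2.
  suff /choice[D HD] : forall x', exists D, next_state x x' -> peel x.1 x.2 D x'.1 x'.2 by exists D.
  move=> x'.
  have [/andP[_ /peel_formulaP[D pl]]|_] := boolP (next_state x x'); first by exists D.
  by exists set0.
pose P T x' := [&& next_state x x', D x' \subset T & T :\: D x' \in covers x'].
transitivity (\sum_(T in covers x) \sum_x' P T x')%N.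
  rewrite -sum1_card; apply: eq_bigr => T /coversP pT; apply/esym.
  have ne : exists l, level x.1 l != 1%N by apply/existsP; rewrite -negb_forall.
  have [D' [h' [K' [pl DT pT']]]] := peel_exists ok pT ne.
  have K'm := peel_column (ltn_ord x.2 : (x.2 <= m)%N) pl.
  pose x' : state := (h', Ordinal K'm).
  have nx : next_state x x' by rewrite /next_state nb; apply/peel_formulaP; exists D'.
  have DE : D x' = D' := peel_fun (HD _ nx) pl.
  apply: (@sum_nat1 _ (P T) x'); first by rewrite /P nx DE DT; apply/coversP.
  move=> y /and3P[ny Dy /coversP py].
  have [e1 e2] := peel_uniq pT (HD _ ny) Dy py pl DT pT'.
  by case: y e1 e2 {ny Dy py} => y1 y2 /= -> e; congr pair; apply: val_inj.
rewrite exchange_big /=; apply: eq_bigr => x' _.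
have [nx|nx] := boolP (next_state x x'); last by rewrite big1 // => T _; rewrite /P (negbTE nx).
rewrite mul1n; transitivity #|[set T in covers x | P T x']|.
  rewrite -sum1_card [LHS]big_mkcond [RHS]big_mkcond; apply: eq_bigr => T _.
  by rewrite in_set; case: (T \in covers x); case: (P T x').
have inj : {in covers x' &, injective (fun T => T :|: D x')}.
  move=> T1 T2 /coversP p1 /coversP p2 E.
  have [d1 _] := peel_add ok (HD _ nx) p1; have [d2 _] := peel_add ok (HD _ nx) p2.
  have K T : [disjoint T & D x'] -> (T :|: D x') :\: D x' = T.
    by move=> d; rewrite setDUl setDv setU0; apply/setDidPl.
  by rewrite -(K _ d1) -(K _ d2) E.
rewrite -(card_in_imset inj); apply: eq_card => T.
rewrite in_set /P nx /=; apply/andP/imsetP => [[/coversP pT /andP[DT cT]]|[T' /coversP pT' ->]].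
  exists (T :\: D x') => //.
  by rewrite setUC -{1}(setIidPr DT) setID.
have [d pT] := peel_add ok (HD _ nx) pT'.
split; first exact/coversP.
rewrite subsetUr /=; apply/coversP.
by rewrite setDUl setDv setU0 (_ : T' :\: D x' = T') //; apply/setDidPl.
Qed.

Lemma bottom_levels x l : bottom_state x -> level x.1 l = 1%N /\ ((vx x.1 l).2 : nat) = 0%N.
Proof.
move=> /forallP b; have l1 : level x.1 l = 1%N by apply/eqP/b.
by split=> //; have := @level_vx _ _ x.1 l; rewrite l1 => /(_ isT) [].
Qed.

(** No generic point lies below the bottom path, while each triangle contains one; so the empty set
    is the only cover. *)
Lemma covers_bottom x : okpath x.1 -> bottom_state x -> #|covers x| = 1%N.
Proof.
move=> [ex ok] bt; rewrite (_ : covers x = [set set0]) ?cards1 //.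
have nb z : generic m n z -> rectangle m n z -> below x.1 z = false.
  move=> gz rz; have [i [k [e zik]]] := edge_exists n0 ex gz rz.
  rewrite (below_edge e zik); apply/negbTE; rewrite -leNgt /cross /pt /px /py /=.
  have [_ ->] := bottom_levels i bt; have [_ ->] := bottom_levels k bt.
  have [_ /andP[z0 _]] := rz; have /edgeP[_ _ ik _] := e.
  have ik' : (i : nat)%:R <= (k : nat)%:R :> R by rewrite ler_nat ltnW.
  by rewrite !subr0 mul0r subr0 mulr_ge0 // subr_ge0.
apply/setP => T; rewrite in_set1; apply/coversP/eqP => [[[uT cT] _]|->].
  apply/setP => t; rewrite in_set0; apply/negP => tT.
  have [z gz tz] := unimod_generic R (uT _ tT); have rz := hull_rectangle tz.
  by have : (0 < cnt T z)%N; [apply/cnt_gt0; exists t|rewrite cT // nb].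
split; first split=> [t|z gz rz]; first by rewrite in_set0.
  by rewrite nb // cnt0 // => t; rewrite in_set0.
move=> i k _ _; left; rewrite /bottom_edge.
by have [_ ->] := bottom_levels i bt; have [_ ->] := bottom_levels k bt.
Qed.

Lemma next_state_peel x x' : next_state x x' -> exists D, peel x.1 x.2 D x'.1 x'.2.
Proof. by move=> /andP[_ /peel_formulaP]. Qed.

Lemma peel_neq0 h K D h' K' : peel h K D h' K' -> (K < K')%N \/ D != set0.
Proof.
case=> {h h' K K' D} [h K _|h h' i j k _ _|h h' i j k _ _|h h' j _]; [by left| | |right; exact: lowD_neq0].
  by right; rewrite -card_gt0 cards1.
by right; rewrite -card_gt0 cards1.
Qed.

(** Each removed triangle counts m + 1, which outweighs the at most m columns by which the scan goes
    back. *)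
Definition work (K : nat) T := (#|T| * m.+1 + (m - K))%N.

Lemma next_state_work x x' T' : okpath x.1 -> next_state x x' -> T' \in covers x' ->
  exists2 T, T \in covers x & (work x'.2 T' < work x.2 T)%N.
Proof.
move=> ok /next_state_peel[D pl] /coversP pT'; have [dis pT] := peel_add ok pl pT'.
exists (T' :|: D); first exact/coversP.
have c : (#|T' :|: D| = #|T'| + #|D|)%N by rewrite -cardsUI (disjoint_setI0 dis) cards0 addn0.
rewrite /work c; have := ltn_ord x'.2; have [lt|] := peel_neq0 pl; first by nia.
rewrite -card_gt0; nia.
Qed.

(** The number t of rounds has to exceed the work of every cover. Work decreases along each step, so
    the condition is inherited; at t = 0 it says that there is no cover. *)
Theorem covers_iteration (U : nat -> state -> nat) :
  (forall x, U 0%N x = 0%N) ->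
  (forall (t : nat) x, U t.+1 x = (bottom_state x + \sum_x' next_state x x' * U t x')%N) ->
  forall (t : nat) x, okpath x.1 -> (forall T, T \in covers x -> (work x.2 T < t)%N) -> U t x = #|covers x|.
Proof.
move=> U0 US; elim=> [|t IH] x ok wk.
  rewrite U0; apply/esym/eqP; rewrite cards_eq0; apply/eqP/setP => T; rewrite in_set0.
  by apply/negP => /wk.
rewrite US; have [bt|bt] := boolP (bottom_state x).
  rewrite (covers_bottom ok bt) big1 // => x' _; by rewrite /next_state bt.
rewrite add0n (covers_rec ok bt); apply: eq_bigr => x' _.
have [nx|//] := boolP (next_state x x'); rewrite !mul1n; apply: IH.
  by have [D pl] := next_state_peel nx; apply: peel_okpath pl.
by move=> T' /(next_state_work ok nx)[T /wk Tt lt]; apply: leq_trans lt Tt.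
Qed.

Definition top_state : state := ([ffun=> Some ord_max], ord0).

Lemma level_top l : level top_state.1 l = n.+1.
Proof. by rewrite /level /= ffunE. Qed.

Lemma vx_top l : vx top_state.1 l = (l, ord_max).
Proof. by rewrite /vx /= ffunE. Qed.

Lemma okpath_top : okpath top_state.1.
Proof.
split=> [|i k /edgeP[_ _ ik no]]; first by rewrite /ends !level_top.
apply: primitive_next => /=; have i1 : (i.+1 < m.+1)%N by have := ltn_ord k; lia.
by have := no (Ordinal i1); rewrite level_top /=; lia.
Qed.

(** At scan column 0 nothing is recorded yet, and every generic point of the rectangle is below the
    top path, because it avoids the line of the top side. *)
Lemma covers_top : #|covers top_state| = num_triangulations R m n.
Proof.
have [et _] := okpath_top.
have top z : generic m n z -> rectangle m n z -> below top_state.1 z = true.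
  move=> gz rz; have [i [k [e zik]]] := edge_exists n0 et gz rz.
  rewrite (below_edge e zik) !vx_top /cross /pt /px /py /=.
  have [_ /andP[_ zn]] := rz; have /edgeP[_ _ ik _] := e.
  have ik' : (i : nat)%:R < (k : nat)%:R :> R by rewrite ltr_nat.
  have zn' : z.2 != n%:R.
    have /gz : ((ord0, ord_max) != (ord_max, ord_max) :> grid m n) by apply/eqP => -[] E; move: (m0); rewrite -{1}E.
    by apply: contraNneq => zE; rewrite /cross /pt /px /py /= zE !subrr mulr0 mul0r subrr.
  have lt : z.2 < n%:R by rewrite lt_neqAle zn'.
  by rewrite subrr mul0r subr0 nmulr_llt0 // ?subr_lt0 // subr_gt0.
apply: eq_card => T; rewrite !inE; apply/asboolP/asboolP => [[[uT ex] _]|/(triangulation_exact R m0 n0)[uT ex]].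
  by apply/(triangulation_exact R m0 n0); split=> // z gz rz; rewrite ex // top.
by split=> [|i k _]; [split=> // z gz rz; rewrite ex // top|].
Qed.

(** The number of all triples of lattice points is a crude bound, but polynomial in n. *)
Lemma covers_card x T : T \in covers x -> (#|T| <= (m.+1 * n.+1) ^ 3)%N.
Proof.
move=> /coversP[[uT _] _].
have sub : T \subset [set tri p.1.1 p.1.2 p.2 | p in [set: grid m n * grid m n * grid m n]].
  apply/subsetP => t /uT[a [b [c [-> _]]]]; apply/imsetP; by exists (a, b, c).
apply: leq_trans (subset_leq_card sub) _; apply: leq_trans (leq_imset_card _ _) _.
by rewrite cardsT /grid !card_prod !card_ord !expnS expn0 muln1 !mulnA.
Qed.

End Peeling.

(** * Coding states by numbers *)

Section Coding.
Variables (m n : nat).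

(** Base n + 2, because a level takes the values 0, ..., n + 1. The path occupies m + 1 digits and
    the scan column stands above them. *)
Definition digit (s i : nat) : nat := ((s %/ (n + 2) ^ i) %% (n + 2))%N.

Definition column (s : nat) : nat := (s %/ (n + 2) ^ m.+1)%N.

(** For s below [codes] neither [inord] falls back to its default value. *)
Definition decode (s : nat) : state m n :=
  ([ffun i : 'I_m.+1 => if digit s i is d.+1 then Some (inord d) else None], inord (column s)).

Definition codes : nat := (m.+1 * (n + 2) ^ m.+1)%N.

Lemma base_gt0 i : (0 < (n + 2) ^ i)%N.
Proof. by rewrite expn_gt0 addn2. Qed.

Lemma level_decode s i : level (decode s).1 i = digit s i.
Proof.
rewrite /level /= ffunE; case E : (digit s i) => [//|d]; rewrite inordK //.
by have : (digit s i < n + 2)%N; [rewrite ltn_mod addn2|rewrite E; lia].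
Qed.

Lemma column_decode s : (s < codes)%N -> (decode s).2 = column s :> nat.
Proof. by move=> sc; rewrite /= inordK // /column ltn_divLR // base_gt0. Qed.

Lemma digit_inj k s s' : (forall i, (i < k)%N -> digit s i = digit s' i) ->
  (s %% (n + 2) ^ k = s' %% (n + 2) ^ k)%N.
Proof.
have split_mod u j : (u %% (n + 2) ^ j.+1 = digit u j * (n + 2) ^ j + u %% (n + 2) ^ j)%N.
  rewrite {1}(divn_eq u ((n + 2) ^ j)) {1}(divn_eq (u %/ (n + 2) ^ j) (n + 2)) -/(digit u j).
  rewrite mulnDl -mulnA -expnS -addnA modnMDl modn_small //.
  have d1 : (digit u j < n + 2)%N by rewrite ltn_mod addn2.
  have d2 : (u %% (n + 2) ^ j < (n + 2) ^ j)%N by rewrite ltn_mod base_gt0.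
  by rewrite expnS; nia.
elim: k => [|k IH] H; first by rewrite !modn1.
by rewrite !split_mod (H k) // IH // => i ik; apply: H; apply: ltnW.
Qed.

Lemma decode_inj (s s' : 'I_codes) : decode s = decode s' -> s = s'.
Proof.
move=> E; apply: val_inj => /=.
have c : column s = column s' by rewrite -!column_decode // E.
have d : (s %% (n + 2) ^ m.+1 = s' %% (n + 2) ^ m.+1)%N.
  apply: digit_inj => i im; have := level_decode s (Ordinal im); have := level_decode s' (Ordinal im).
  by rewrite E /= => <- <-.
by rewrite (divn_eq s ((n + 2) ^ m.+1)) d -[(s %/ _)%N]/(column s) c -divn_eq.
Qed.

Lemma decode_bij : bijective (fun s : 'I_codes => decode s).
Proof.
apply: inj_card_bij; first exact: decode_inj.
by rewrite card_prod card_ffun card_option !card_ord mulnC /codes addn2.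
Qed.

Lemma digit_max i k : (i < k)%N -> digit ((n + 2) ^ k - 1) i = n.+1.
Proof.
move=> ik; rewrite /digit; have [d kE] : exists d, k = (i + d.+1)%N by exists (k - i.+1)%N; lia.
have b0 := base_gt0 i; have b1 := base_gt0 d.
have -> : ((n + 2) ^ k - 1 = ((n + 2) ^ d.+1 - 1) * (n + 2) ^ i + ((n + 2) ^ i - 1))%N.
  by rewrite kE expnD; have := base_gt0 d.+1; nia.
rewrite divnMDl // divn_small ?addn0; last by lia.
have -> : ((n + 2) ^ d.+1 - 1 = ((n + 2) ^ d - 1) * (n + 2) + n.+1)%N by rewrite expnS; nia.
by rewrite modnMDl modn_small //; lia.
Qed.

Lemma decode_top : decode ((n + 2) ^ m.+1 - 1) = top_state m n.
Proof.
have b0 := base_gt0 m.+1.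
rewrite [LHS]surjective_pairing [RHS]surjective_pairing; congr pair.
  by apply: level_inj => l; rewrite level_decode level_top digit_max.
apply: ord_inj; rewrite column_decode; last by rewrite /codes; nia.
by rewrite /column divn_small //; lia.
Qed.

Definition bottom_code (s : nat) := bottom_formula (fun i : 'I_m.+1 => digit s i).

Definition next_code (s s' : nat) := ~~ bottom_code s &&
  peel_formula (fun i : 'I_m.+1 => digit s i) (column s) (fun i : 'I_m.+1 => digit s' i) (column s').

Lemma bottom_decode s : bottom_state (decode s) = bottom_code s.
Proof. by apply: eq_forallb => i; rewrite level_decode. Qed.

Lemma next_decode s s' : (s < codes)%N -> (s' < codes)%N ->
  next_state (decode s) (decode s') = next_code s s'.
Proof.
move=> sc sc'; rewrite /next_state bottom_decode !column_decode // /next_code.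
have E u : level (decode u).1 = (fun i : 'I_m.+1 => digit u i) by apply: funext => i; apply: level_decode.
by rewrite !E.
Qed.

Fixpoint count_peelings (t s : nat) : nat :=
  if t is t'.+1 then (bottom_code s + \sum_(s' < codes) next_code s s' * count_peelings t' s')%N
  else 0%N.

Lemma count_peelings_covers (R : realType) t s : (0 < m)%N -> (0 < n)%N -> (s < codes)%N ->
  okpath (decode s).1 -> (forall T, T \in covers R (decode s) -> (work (decode s).2 T < t)%N) ->
  count_peelings t s = #|covers R (decode s)|.
Proof.
move=> m0 n0 sc ok wk; have [code decodeK codeK] := decode_bij.
pose U t x := count_peelings t (code x).
have -> : count_peelings t s = U t (decode s) by rewrite /U (decodeK (Ordinal sc)).
apply: (covers_iteration m0 n0) => // {t ok wk} t x.
rewrite /U /= -bottom_decode codeK; congr (_ + _)%N.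
rewrite [RHS](reindex (fun s : 'I_codes => decode s)) /=; last by apply: onW_bij; apply: decode_bij.
by apply: eq_bigr => s' _; rewrite decodeK -next_decode // codeK.
Qed.

End Coding.

(** * The recursion on codes as a program *)

Lemma definable_succ f : definable f -> definable (fun X => (f X).+1).
Proof.
move=> df; apply: (definable_ext (f := fun X => f X + 1)%N) => [X|]; first by rewrite addn1.
by apply: definable_add => //; apply: definable_cst.
Qed.

Ltac definability := repeat first
  [ exact: definable_cst
  | solve [auto]
  | (apply: definable_forall => ?) | (apply: definable_exists => ?)
  | apply: definable_and | apply: definable_or | apply: definable_not | apply: definable_imply
  | apply: definable_eq | apply: definable_leq
  | apply: definable_add | apply: definable_mul | apply: definable_sub | apply: definable_exp
  | apply: definable_succ ].

(** As m is fixed, the quantifiers over columns unfold into finite conjunctions and disjunctions,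
    and m may enter the size of the expression. *)
Lemma definable_peel_formula m (g g' : memory -> 'I_m.+1 -> nat) (K K' : memory -> nat) :
  (forall i, definable (fun X => g X i)) -> (forall i, definable (fun X => g' X i)) ->
  definable K -> definable K' ->
  definable (fun X => peel_formula (g X) (K X) (g' X) (K' X) : nat).
Proof.
move=> dg dg' dK dK'.
rewrite /peel_formula /insert_formula /delete_formula /lower_formula /consecutive /agree_off /ccw_area.
by definability.
Qed.

Lemma definable_bottom_formula m (g : memory -> 'I_m.+1 -> nat) :
  (forall i, definable (fun X => g X i)) -> definable (fun X => bottom_formula (g X) : nat).
Proof. by move=> dg; rewrite /bottom_formula; definability. Qed.

Theorem mainTheorem7 (R : realType) (m : nat) (m_gt0 : (0 < m)%N) :
  exists (P : program) (p : {poly nat}),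
    forall n : nat, (0 < n)%N ->
      outputs_within P n (num_triangulations R m n) p.[n].
Proof.
(* [L n] exceeds the work of every cover of the top state: the bound on the number of triangles
   times m + 1, plus more than the m columns to scan. *)
pose L n := ((m.+1 * n.+1) ^ 3 * m.+1 + m.+1)%N.
(* The code of the top state: all digits are maximal and the scan column is 0. *)
pose out n := ((n + 2) ^ m.+1 - 1)%N.
have out_lt n : (out n < codes m n)%N by rewrite /out /codes; have := base_gt0 n m.+1; nia.
have codes0 n : (0 < codes m n)%N by rewrite muln_gt0 /= base_gt0.
have d2 : definable (fun X => X 0%N + 2)%N.
  by apply: definable_add; [apply: definable_var|apply: definable_cst].
have dcodes : definable (fun X => codes m (X 0%N)) by rewrite /codes; definability.
have dmod i : definable (fun X => X i %% codes m (X 0%N))%N.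
  by apply: definable_mod => //; apply: definable_var.
have ddiv f i : definable f -> definable (fun X => f X %/ (X 0%N + 2) ^ i)%N.
  by move=> df; apply: definable_div => // [X|]; [apply: base_gt0|apply: definable_exp].
have ddig f i : definable f -> definable (fun X => digit (X 0%N) (f X) i).
  by move=> df; apply: definable_mod => // [X|]; [rewrite addn2|apply: ddiv].
have [||||||||| P [p hP]] := @iteration_computable (codes m) L out (bottom_code m) (next_code m) (count_peelings m) => //.
- by rewrite /L; definability; apply: definable_var.
- by rewrite /out; definability.
- by apply: definable_bottom_formula => i; apply: ddig.
- apply: definable_and; first by apply: definable_not; apply: definable_bottom_formula => i; apply: ddig.
  by apply: definable_peel_formula => [i|i||]; [apply: ddig|apply: ddig|apply: ddiv|apply: ddiv].
exists P, p => n n_gt0; have := hP n.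
rewrite (count_peelings_covers (R := R)) // decode_top; [|exact: okpath_top|].
  by rewrite covers_top.
move=> T /covers_card cT; rewrite /work /L; have := ltn_ord (top_state m n).2; nia.
Qed.
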